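(* There is an absolute constant $C>0$ such that the following holds. Let $\xi$ and $\eta$ be Gaussian random elements in a real separable Hilbert space $\mathbb{H}$ with zero mean and covariance operators $\Sigma_\xi$ and $\Sigma_\eta$ respectively. Let $\lambda_{1\xi}\ge\lambda_{2\xi}\ge\cdots$ and $\lambda_{1\eta}\ge\lambda_{2\eta}\ge\cdots$ be the eigenvalues (with multiplicity) of $\Sigma_\xi$ and $\Sigma_\eta$ respectively. Then $$\sup_{x\ge0}\bigl|\mathbb{P}(\|\xi\|^2\ge x)-\mathbb{P}(\|\eta\|^2\ge x)\bigr|\le C\left(\frac1{\sqrt{\lambda_{1\eta}\lambda_{2\eta}}}+\frac1{\sqrt{\lambda_{1\xi}\lambda_{2\xi}}}\right)\|\Sigma_\xi-\Sigma_\eta\|_1.$$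
   Context: $\|\mathbf A\|_1=\operatorname{Tr}|\mathbf A|=\sum_k|\lambda_k(\mathbf A)|$ is the Schatten 1-norm (trace norm) of a self-adjoint operator $\mathbf{A}$ with eigenvalues $\lambda_k(\mathbf A)$; $\|\cdot\|$ is the norm of $\mathbb{H}$. The statement is meaningful when $\lambda_{2\xi}>0$ and $\lambda_{2\eta}>0$ (otherwise the right-hand side is understood as $+\infty$). *)

(* Defs.v *)
From HB Require Import structures.
From mathcomp Require Import all_boot all_order all_algebra.
From mathcomp Require Import all_classical all_reals all_analysis.

Set Implicit Arguments.
Unset Strict Implicit.
Unset Printing Implicit Defensive.

Import Order.TTheory GRing.Theory Num.Theory.
Import numFieldNormedType.Exports.

Local Open Scope classical_set_scope.
Local Open Scope ring_scope.

(* A real Hilbert space is a complete normed module whose norm comes from a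
   positive definite symmetric bilinear form [dot]. *)
Definition hilbert_norm (R : realType) (H : completeNormedModType R)
    (dot : {dot H for idfun}) : Prop :=
  forall x : H, dot x x = `|x| ^+ 2.

Definition separable (X : topologicalType) : Prop :=
  exists2 D : set X, countable D & dense D.

Definition random_element (d : measure_display) (T : measurableType d)
    (X : topologicalType) (xi : T -> X) : Prop :=
  forall B : set X, <<s @open X >> B -> measurable (xi @^-1` B).

(* The law N(m, s^2) on the line. The degenerate case is split off because
   [normal_prob m 0] is by convention the uniform law on [0, 1], whereas N(m, 0)
   is the Dirac mass at m. *)
Definition gaussian_law (R : realType) (m s : R) (A : set R) : \bar R :=
  if s == 0 then \d_m A else normal_prob m s A.

Definition gaussian_rv (d : measure_display) (T : measurableType d)
    (R : realType) (P : probability T R) (X : T -> R) : Prop :=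
  exists m s : R, forall A : set R,
    measurable A -> P (X @^-1` A) = gaussian_law m s A.

Section HilbertSpace.
Variables (R : realType) (H : completeNormedModType R).
Variable dot : {dot H for idfun}.

Section RandomElement.
Variables (d : measure_display) (T : measurableType d) (P : probability T R).
Variable xi : T -> H.

Definition gaussian_element : Prop :=
  random_element xi /\ forall h : H, gaussian_rv P (fun w => dot (xi w) h).

Definition is_mean (m : H) : Prop :=
  forall h : H, 'E_P[fun w => dot (xi w) h]%E = (dot m h)%:E.

Definition is_covariance_operator (S : {linear H -> H}) : Prop :=
  forall u v : H,
    (dot (S u) v)%:E
    = covariance P (fun w => dot (xi w) u) (fun w => dot (xi w) v).

End RandomElement.

Definition lin_indep (n : nat) (e : 'I_n -> H) : Prop :=
  forall c : 'I_n -> R, \sum_(i < n) c i *: e i = 0 -> forall i, c i = 0.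

(* Dimension of the eigenspace of A for mu: 0 when mu is not an eigenvalue,
   +oo when the eigenspace is infinite-dimensional. *)
Definition eigen_mult (A : H -> H) (mu : R) : \bar R :=
  ereal_sup [set n%:R%:E | n in [set n : nat |
    exists2 e : 'I_n -> H, lin_indep e & forall i, A (e i) = mu *: e i]].

(* For A compact, self-adjoint and nonnegative (such as a covariance operator),
   this determines lam: it is lam_1 >= lam_2 >= ... , indexed from 0, each
   positive eigenvalue being repeated according to its multiplicity. If A has
   finite rank (in particular if H is finite-dimensional) lam ends with zeros;
   otherwise every lam k is positive, and a possible kernel of A is not listed. *)
Definition eigenvalue_seq (A : H -> H) (lam : nat -> R) : Prop :=
  [/\ (forall k, 0 <= lam k),
      (forall k, lam k.+1 <= lam k) &
      forall mu : R, 0 < mu ->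
        counting [set k | lam k = mu] = eigen_mult A mu].

(* For A compact and self-adjoint (such as a difference of covariance
   operators), the sum of |lam_k(A)| over the eigenvalues counted with
   multiplicity; here the terms with the same eigenvalue mu are grouped. The
   value mu = 0 contributes 0, also when the kernel is infinite-dimensional,
   since 0 * +oo = 0. *)
Definition schatten1_norm (A : H -> H) : \bar R :=
  (\esum_(mu in [set: R]) (`|mu|%:E * eigen_mult A mu))%E.

End HilbertSpace.

(* Main.v *)
Require Import Defs.
From HB Require Import structures.
From mathcomp Require Import all_boot all_order all_algebra.
From mathcomp Require Import all_classical all_reals all_analysis.
From mathcomp Require Import measurable_realfun normal_distribution.
From mathcomp Require Import ring lra.

Set Implicit Arguments.
Unset Strict Implicit.
Unset Printing Implicit Defensive.

Import Order.TTheory GRing.Theory Num.Theory.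
Import numFieldNormedType.Exports.

Local Open Scope classical_set_scope.
Local Open Scope ring_scope.

(** The law of |xi|^2 depends on the covariance operator only through its
    eigenvalues lambda_k: it is the law of sum_k lambda_k g_k^2 with independent
    standard normal g_k. Two properties of the tails of such sums give the bound.

    - They increase with the weights ([wtail_le_weights]).
    - Raising the weights from lambda_k to lambda_k + d_k raises the tail by at
      most K sum_k d_k, with K of order 1 / sqrt (lambda_1 lambda_2). Indeed, once
      all coordinates but the two of largest weight are fixed, the increase is
      the planar Gaussian measure of a region between two ellipses
      {a g^2 + b h^2 < x}; its area is a multiple of its thickness divided by
      sqrt (a b), uniformly in x ([elliptic_annulus_area], [gaussian_annulus]),
      and the thickness is a combination of the d_k g_k^2, of mean at most
      sum_k d_k ([wtail_perturbed]).

    The covariance operators themselves are not ordered, but both are below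
    Q0 = Sigma_xi + (Sigma_xi - Sigma_eta)^-, and the trace of Q0 - Sigma_eta is
    the trace of the positive part of Sigma_xi - Sigma_eta ([exists_majorant]).
    The min-max principle orders the eigenvalues ([eigenframe_mono]), so that
    P (|xi|^2 >= x) is at most the tail for Q0, hence at most P (|eta|^2 >= x)
    plus K_eta times the trace norm of the difference ([norm_tail_compare]).
    Exchanging xi and eta gives the reverse inequality with K_xi, which is why
    both constants appear.

    The comparison is made on finite sections. An orthonormal basis b is chosen
    whose first vectors span the two leading eigenvectors of each operator
    ([exists_basis]); every large section then has its two largest eigenvalues
    bounded below by those of the operator ([eigenvalue_le_frame]), and the sums
    of the <xi, b_i>^2 increase to |xi|^2 ([norm_tail_le]). The law of such a sum
    is found from one-dimensional projections only: exp (- t Y^2) is the mean of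
    cos (sqrt (2 t) g Y) over a standard normal g, and the product of two cosines
    is a mean of two cosines, so that its Laplace transform reduces to
    characteristic functions of single <xi, h> ([laplace_cos]); two laws with the
    same Laplace transform have the same tails ([laplace_tail_le]).

    It remains to bound sum_j |<D w_j, w_j>| by the trace norm of
    D = Sigma_xi - Sigma_eta for orthonormal w_j ([sum_form_le]), the trace norm
    being given by eigenvalues and multiplicities. A covariance form is compact,
    since 1 - exp (- q(h) / 2) is the mean of 1 - cos <xi, h>, which is small
    uniformly over the unit vectors h orthogonal to many basis vectors
    ([covariance_cptform]). A compact symmetric form attains its supremum at an
    eigenvector ([form_sup_attained]); splitting off eigenvectors one at a time
    leaves after finitely many steps a form of norm at most e, because each step
    uses up more than e of the trace norm ([form_residual_small]). *)

(** * Symmetric matrices: eigenvectors, min-max principle, common majorant *)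

Section SymmetricMatrices.
Variable R : realType.

(** The inequality at the minimizer [t = c / s] of [t ^+ 2 * s - 2 * t * c], with
    [s] positive and above [A], leaves no room for a nonzero [c]. *)
Lemma quadratic_domination_eq0 (c A : R) : (forall t, 2 * t * c <= t ^+ 2 * A) -> c = 0.
Proof.
move=> H; pose s := `|A| + 1.
have s0 : 0 < s by rewrite ltr_wpDl.
have As : A <= s by rewrite (le_trans (ler_norm A))// lerDl.
have := H (c / s) => h.
have h2 : (c / s) ^+ 2 * A <= (c / s) ^+ 2 * s by rewrite ler_wpM2l// sqr_ge0.
have h3 : c ^+ 2 / s <= 0.
  have e1 : 2 * (c / s) * c = 2 * (c ^+ 2 / s) by ring.
  have e2 : (c / s) ^+ 2 * s = c ^+ 2 / s by field; rewrite gt_eqF.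
  by move: (le_trans h h2); rewrite e1 e2; lra.
apply/eqP; rewrite -sqrf_eq0 eq_le sqr_ge0 andbT.
by move: h3; rewrite ler_pdivrMr// mul0r.
Qed.

Section Form.
Variable n : nat.
Implicit Types (Q : 'M[R]_n) (x y : 'rV[R]_n) (w v : nat -> 'rV[R]_n).

Definition mxform Q x y : R := (x *m Q *m y^T) 0 0.
Definition dotrow x y : R := (x *m y^T) 0 0.

Definition frame w k := forall i j, (i < k)%N -> (j < k)%N ->
  dotrow (w i) (w j) = (i == j)%:R.

(** Successive maximizers of the quadratic form on the unit sphere, each orthogonal
    to the previous ones. This variational form of an eigenbasis in decreasing
    order is what the min-max principle uses directly. *)
Definition eigenframe Q w k := frame w k /\ forall i, (i < k)%N ->
  forall x, (forall j, (j < i)%N -> dotrow x (w j) = 0) ->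
  mxform Q x x <= mxform Q (w i) (w i) * dotrow x x.

Lemma mxformDl Q x1 x2 y : mxform Q (x1 + x2) y = mxform Q x1 y + mxform Q x2 y.
Proof. by rewrite /mxform !mulmxDl mxE. Qed.

Lemma mxformZl Q a x y : mxform Q (a *: x) y = a * mxform Q x y.
Proof. by rewrite /mxform -!scalemxAl mxE. Qed.

Lemma mxformDr Q x y1 y2 : mxform Q x (y1 + y2) = mxform Q x y1 + mxform Q x y2.
Proof. by rewrite /mxform linearD mulmxDr mxE. Qed.

Lemma mxformZr Q a x y : mxform Q x (a *: y) = a * mxform Q x y.
Proof. by rewrite /mxform linearZ -scalemxAr mxE. Qed.

Lemma mxform0l Q y : mxform Q 0 y = 0.
Proof. by rewrite /mxform !mul0mx mxE. Qed.

Lemma mxform0r Q x : mxform Q x 0 = 0.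
Proof. by rewrite /mxform trmx0 mulmx0 mxE. Qed.

Lemma mxform_suml Q I (r : seq I) (P : pred I) (f : I -> 'rV[R]_n) y :
  mxform Q (\sum_(i <- r | P i) f i) y = \sum_(i <- r | P i) mxform Q (f i) y.
Proof.
apply: (big_morph (fun x => mxform Q x y)) => [x1 x2|]; first exact: mxformDl.
exact: mxform0l.
Qed.

Lemma mxform_sumr Q I (r : seq I) (P : pred I) (f : I -> 'rV[R]_n) x :
  mxform Q x (\sum_(i <- r | P i) f i) = \sum_(i <- r | P i) mxform Q x (f i).
Proof.
apply: (big_morph (fun y => mxform Q x y)) => [y1 y2|]; first exact: mxformDr.
exact: mxform0r.
Qed.

Lemma mxformDQ Q1 Q2 x y : mxform (Q1 + Q2) x y = mxform Q1 x y + mxform Q2 x y.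
Proof. by rewrite /mxform mulmxDr mulmxDl mxE. Qed.

Lemma mxformNQ Q x y : mxform (- Q) x y = - mxform Q x y.
Proof. by rewrite /mxform mulmxN mulNmx mxE. Qed.

Lemma dotrowE x y : dotrow x y = mxform 1%:M x y.
Proof. by rewrite /mxform mulmx1. Qed.

Lemma dotrow_sum x y : dotrow x y = \sum_i x 0 i * y 0 i.
Proof. by rewrite /dotrow mxE; apply: eq_bigr => i _; rewrite mxE. Qed.

Lemma mxform_sum Q x y : mxform Q x y = \sum_i \sum_j x 0 i * Q i j * y 0 j.
Proof.
rewrite /mxform mxE exchange_big/=; apply: eq_bigr => j _.
by rewrite !mxE mulr_suml.
Qed.

Lemma dotrowC x y : dotrow x y = dotrow y x.
Proof. by rewrite !dotrow_sum; apply: eq_bigr => i _; rewrite mulrC. Qed.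

Lemma mxformC Q x y : Q^T = Q -> mxform Q x y = mxform Q y x.
Proof.
move=> sQ; rewrite /mxform.
have -> : x *m Q *m y^T = (y *m Q *m x^T)^T by rewrite !trmx_mul trmxK sQ mulmxA.
by rewrite mxE.
Qed.

Lemma dotrow_ge0 x : 0 <= dotrow x x.
Proof. by rewrite dotrow_sum sumr_ge0// => i _; rewrite -expr2 sqr_ge0. Qed.

Lemma dotrow_eq0 x : dotrow x x = 0 -> x = 0.
Proof.
rewrite dotrow_sum => /eqP; rewrite psumr_eq0; last by move=> i _; rewrite -expr2 sqr_ge0.
move=> /allP x0; apply/rowP => i; rewrite mxE.
by have := x0 i (mem_index_enum i); rewrite mulf_eq0 orbb => /eqP.
Qed.

(** [k < n] linear equations in [n] unknowns have a nonzero solution. *)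
Lemma exists_orthogonal_row w k : (k < n)%N ->
  exists x, dotrow x x = 1 /\ forall j, (j < k)%N -> dotrow x (w j) = 0.
Proof.
move=> kn; pose W : 'M[R]_(n, k) := \matrix_(i, j) w j 0 i.
have : kermx W != 0.
  rewrite -mxrank_eq0 mxrank_ker -lt0n subn_gt0.
  exact: leq_ltn_trans (rank_leq_col W) kn.
move=> /rowV0Pn[y /sub_kermxP yW y0].
have yy0 : dotrow y y != 0 by apply: contra y0 => /eqP/dotrow_eq0 ->.
have yy : 0 < dotrow y y by rewrite lt_def yy0 dotrow_ge0.
exists ((Num.sqrt (dotrow y y))^-1 *: y); split.
  rewrite !dotrowE mxformZl mxformZr -dotrowE mulrA -expr2 exprVn sqr_sqrtr ?ltW//.
  by rewrite mulVf.
move=> j jk; rewrite dotrowE mxformZl -dotrowE.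
have /matrixP/(_ 0 (Ordinal jk)) := yW; rewrite !mxE => yj.
rewrite (_ : dotrow y (w j) = 0) ?mulr0// dotrow_sum -[RHS]yj.
by apply: eq_bigr => i _; rewrite mxE.
Qed.

Lemma continuous_mxform Q : continuous (fun x => mxform Q x x).
Proof.
rewrite (_ : (fun x => _) = fun x => \sum_i \sum_j x 0 i * Q i j * x 0 j); last first.
  by apply/funext => y; rewrite mxform_sum.
have cc (i : 'I_n) : continuous (fun y : 'rV[R]_n => y 0 i) by exact: coord_continuous.
apply: (continuous_big (@add_continuous R)) => i _.
apply: (continuous_big (@add_continuous R)) => j _ x.
have c1 : (fun y : 'rV[R]_n => y 0 i * Q i j) y @[y --> x] --> x 0 i * Q i j.
  exact: (cvgM (cc i x) (cvg_cst _)).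
exact: (cvgM c1 (cc j x)).
Qed.

Lemma continuous_dotrow y : continuous (fun x => dotrow x y).
Proof.
rewrite (_ : (fun x => _) = fun x => \sum_i x 0 i * y 0 i); last first.
  by apply/funext => z; rewrite dotrow_sum.
apply: (continuous_big (@add_continuous R)) => i _ x.
exact: (cvgM (@coord_continuous _ _ _ 0 i x) (cvg_cst _)).
Qed.

(** Greedy construction: the form is continuous and the unit vectors orthogonal to
    the vectors found so far form a nonempty compact set. *)
Lemma eigenframe_exists Q k : (k <= n)%N -> exists w, eigenframe Q w k.
Proof.
elim: k => [_|k IH kn]; first by exists (fun=> 0); split.
have [w [fw gw]] := IH (ltnW kn).
pose A := [set x | dotrow x x = 1 /\ forall j, (j < k)%N -> dotrow x (w j) = 0].
have A0 : A !=set0 by have [x xP] := exists_orthogonal_row w kn; exists x.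
have cA : compact A.
  apply: bounded_closed_compact.
    exists 1; split => // M M1 x [x1 _]; apply/ltW/(le_lt_trans _ M1).
    rewrite [leLHS]mx_normrE; apply: bigmax_le => // -[i j] _ /=.
    rewrite (ord1 i) -(@ler_pXn2r _ 2) ?nnegrE// expr1n real_normK ?num_real//.
    rewrite -x1 dotrow_sum (bigD1 j)//= -expr2 lerDl.
    by rewrite sumr_ge0// => l _; rewrite -expr2 sqr_ge0.
  have -> : A = (fun x => dotrow x x) @^-1` [set 1] `&`
      \bigcap_(j in `I_k) ((fun x => dotrow x (w j)) @^-1` [set 0]).
    by apply/seteqP; split => x [].
  apply: closedI.
    apply: closed_comp; last exact: closed_eq.
    move=> x _; rewrite (_ : (fun x => dotrow x x) = (fun x => mxform 1%:M x x)).
      exact: continuous_mxform.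
    by apply/funext => y; rewrite dotrowE.
  apply: closed_bigI => j _; apply: closed_comp; last exact: closed_eq.
  by move=> x _; exact: continuous_dotrow.
have [f + fmax] := EVT_max_rV A0 cA (@continuous_subspaceT _ _ _ _ (@continuous_mxform Q)).
rewrite inE => -[f1 fw0].
exists (fun i => if i == k then f else w i); split.
  move=> i j; rewrite !ltnS (leq_eqVlt i) (leq_eqVlt j) => /orP[/eqP ->|ik] /orP[/eqP ->|jk].
  - by rewrite eqxx.
  - by rewrite eqxx (ltn_eqF jk) fw0// eq_sym (ltn_eqF jk).
  - by rewrite eqxx (ltn_eqF ik) dotrowC fw0.
  - by rewrite (ltn_eqF ik) (ltn_eqF jk) fw.
move=> i; rewrite ltnS leq_eqVlt => /orP[/eqP ->|ik] x xw; last first.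
  rewrite (ltn_eqF ik); apply: gw => // j ji; have := xw j ji.
  by rewrite (ltn_eqF (ltn_trans ji ik)).
rewrite eqxx; have [x0|x0] := eqVneq (dotrow x x) 0.
  by rewrite (dotrow_eq0 x0) mxform0l dotrowE mxform0l mulr0.
have xx : 0 < dotrow x x by rewrite lt_def x0 dotrow_ge0.
have /fmax : (Num.sqrt (dotrow x x))^-1 *: x \in A.
  rewrite inE; split.
    rewrite !dotrowE mxformZl mxformZr -dotrowE mulrA -expr2 exprVn sqr_sqrtr ?ltW//.
    by rewrite mulVf.
  by move=> j jk; rewrite dotrowE mxformZl -dotrowE; have := xw j jk; rewrite (ltn_eqF jk) => ->; rewrite mulr0.
rewrite mxformZl mxformZr mulrA -expr2 exprVn sqr_sqrtr; last exact: ltW.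
by rewrite ler_pdivrMl// mulrC.
Qed.

(** First order condition: perturbing the maximizer [w i] in the direction [w j]
    cannot increase the form. *)
Lemma eigenframe_orthogonal Q w k i j : Q^T = Q -> eigenframe Q w k ->
  (i < k)%N -> (j < k)%N -> i != j -> mxform Q (w i) (w j) = 0.
Proof.
move=> sQ [fw gw]; wlog ij : i j / (i < j)%N.
  move=> H ik jk ij; have /orP[ij'|ji'] : (i < j)%N || (j < i)%N by rewrite -neq_ltn.
  - exact: H.
  - by rewrite mxformC//; apply: H => //; rewrite eq_sym.
move=> ik jk _.
set a := mxform Q (w i) (w i); set b := mxform Q (w j) (w j); set c := mxform Q _ _.
have H t : 2 * t * c <= t ^+ 2 * (a - b).
  have : mxform Q (w i + t *: w j) (w i + t *: w j) <=
      a * dotrow (w i + t *: w j) (w i + t *: w j).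
    apply: gw => // l li; rewrite dotrowE mxformDl mxformZl -!dotrowE !fw ?(ltn_trans li)//.
    by rewrite (gtn_eqF li) (gtn_eqF (ltn_trans li ij)) mulr0 addr0.
  rewrite dotrowE !(mxformDl, mxformDr, mxformZl, mxformZr) -!dotrowE.
  rewrite (mxformC (w j) (w i))// !fw// !eqxx (ltn_eqF ij) (gtn_eqF ij) /=.
  by rewrite -/a -/b -/c expr2; nra.
exact: quadratic_domination_eq0 H.
Qed.

Lemma frame_unitary w : frame w n ->
  (\matrix_(i, j) w i 0 j : 'M[R]_n) *m (\matrix_(i, j) w i 0 j)^T = 1%:M.
Proof.
move=> fw; apply/matrixP => i j; rewrite !mxE.
under eq_bigr do rewrite !mxE.
by rewrite -dotrow_sum fw.
Qed.

(** The rows of an orthogonal matrix are orthonormal, hence so are its columns. *)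
Lemma frame_resolution w a b : frame w n ->
  \sum_(i < n) w i 0 a * w i 0 b = (a == b)%:R.
Proof.
move=> /frame_unitary/mulmx1C/matrixP/(_ a b); rewrite !mxE => <-.
by apply: eq_bigr => i _; rewrite !mxE.
Qed.

Lemma frame_parseval w x : frame w n -> \sum_(i < n) dotrow x (w i) ^+ 2 = dotrow x x.
Proof.
move=> fw.
transitivity (\sum_(a < n) \sum_(b < n) x 0 a * x 0 b * \sum_(i < n) w i 0 a * w i 0 b).
  under [RHS]eq_bigr do under eq_bigr do rewrite mulr_sumr.
  under [RHS]eq_bigr do rewrite exchange_big.
  rewrite exchange_big /=; apply: eq_bigr => i _.
  rewrite dotrow_sum expr2 mulr_suml; apply: eq_bigr => a _.
  by rewrite mulr_sumr; apply: eq_bigr => b _; ring.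
rewrite dotrow_sum; apply: eq_bigr => a _; rewrite (bigD1 a)//= frame_resolution// eqxx mulr1.
by rewrite big1 ?addr0// => b ba; rewrite frame_resolution// eq_sym (negbTE ba) mulr0.
Qed.

Lemma frame_trace Q w : frame w n -> \sum_(i < n) mxform Q (w i) (w i) = \tr Q.
Proof.
move=> fw; rewrite /mxtrace.
transitivity (\sum_(a < n) \sum_(b < n) Q a b * \sum_(i < n) w i 0 a * w i 0 b).
  under [RHS]eq_bigr do under eq_bigr do rewrite mulr_sumr.
  under [RHS]eq_bigr do rewrite exchange_big.
  rewrite exchange_big /=; apply: eq_bigr => i _.
  rewrite mxform_sum; apply: eq_bigr => a _; apply: eq_bigr => b _; ring.
apply: eq_bigr => a _; rewrite (bigD1 a)//= frame_resolution// eqxx mulr1.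
by rewrite big1 ?addr0// => b ba; rewrite frame_resolution// eq_sym (negbTE ba) mulr0.
Qed.

Lemma eigenframe_expand Q w x : Q^T = Q -> eigenframe Q w n ->
  mxform Q x x = \sum_(i < n) mxform Q (w i) (w i) * dotrow x (w i) ^+ 2.
Proof.
move=> sQ ew; have [fw _] := ew.
have xE : x = \sum_(i < n) dotrow x (w i) *: w i.
  apply/rowP => b; rewrite summxE.
  transitivity (\sum_(a < n) x 0 a * \sum_(i < n) w i 0 a * w i 0 b).
    rewrite (bigD1 b)//= frame_resolution// eqxx mulr1 big1 ?addr0// => a ab.
    by rewrite frame_resolution// (negbTE ab) mulr0.
  under eq_bigr do rewrite mulr_sumr.
  rewrite exchange_big; apply: eq_bigr => i _; rewrite !mxE dotrow_sum mulr_suml.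
  by apply: eq_bigr => a _; rewrite mulrA.
rewrite {1 2}xE mxform_suml; apply: eq_bigr => i _.
rewrite mxform_sumr (bigD1 i)//= mxformZl mxformZr big1 ?addr0; first by ring.
move=> j ji; rewrite mxformZl mxformZr (eigenframe_orthogonal sQ ew)// ?mulr0// eq_sym.
by apply: contra ji => /eqP/val_inj ->.
Qed.

(** [Q0] is [Q1] plus the negative part of [Q1 - Q2], and [w] diagonalizes
    [Q1 - Q2]; then [Q0 - Q2] is the positive part of [Q1 - Q2], whose trace is at
    most the sum of the absolute values of the eigenvalues. *)
Lemma exists_majorant Q1 Q2 : Q1^T = Q1 -> Q2^T = Q2 ->
  exists Q0 w, [/\ Q0^T = Q0, frame w n,
    (forall x, mxform Q1 x x <= mxform Q0 x x), (forall x, mxform Q2 x x <= mxform Q0 x x) &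
    \tr Q0 - \tr Q2 <= \sum_(i < n) `|mxform (Q1 - Q2) (w i) (w i)|].
Proof.
move=> s1 s2; have sD : (Q1 - Q2)^T = Q1 - Q2 by rewrite linearB /= s1 s2.
have [w ew] := eigenframe_exists (Q1 - Q2) (leqnn n); have [fw _] := ew.
pose d i := mxform (Q1 - Q2) (w i) (w i).
pose N : 'M[R]_n := \sum_(i < n) Num.max (- d i) 0 *: ((w i)^T *m w i).
have NE x : mxform N x x = \sum_(i < n) Num.max (- d i) 0 * dotrow x (w i) ^+ 2.
  rewrite /mxform /N mulmx_sumr mulmx_suml summxE; apply: eq_bigr => i _.
  rewrite -scalemxAr -scalemxAl mxE; congr (_ * _).
  rewrite (_ : _ *m _ *m _ = (x *m (w i)^T) *m (w i *m x^T)); last by rewrite !mulmxA.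
  rewrite mxE big_ord1.
  by rewrite expr2 {2}dotrowC.
have N0 x : 0 <= mxform N x x.
  by rewrite NE sumr_ge0// => i _; rewrite mulr_ge0 ?sqr_ge0// le_max lexx orbT.
have DN x : 0 <= mxform (Q1 - Q2) x x + mxform N x x.
  rewrite (eigenframe_expand x sD ew) NE -big_split sumr_ge0//= => i _.
  by rewrite -mulrDl mulr_ge0 ?sqr_ge0// -/(d i); case: (leP (- d i) 0) => ?; lra.
have sN : N^T = N.
  by rewrite /N linear_sum; apply: eq_bigr => i _; rewrite linearZ /= trmx_mul trmxK.
exists (Q1 + N), w; split => //.
- by rewrite linearD /= s1 sN.
- by move=> x; rewrite mxformDQ lerDl.
- by move=> x; have := DN x; rewrite !mxformDQ mxformNQ; lra.
- rewrite -!(frame_trace _ fw) -sumrB; apply: ler_sum => i _.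
  rewrite mxformDQ addrAC -mxformNQ -mxformDQ -/(d i) NE (bigD1 i)//= fw// eqxx expr1n mulr1.
  rewrite big1 ?addr0.
    by case: (leP (- d i) 0) => h; rewrite ?addr0 ?ler_norm// subrr.
  move=> j ji; rewrite fw// (_ : (i == j :> nat) = false) ?expr0n ?mulr0//.
  by apply/negbTE; apply: contra ji => /eqP/val_inj ->.
Qed.

End Form.

(** Among the [i.+1] dimensions spanned by [v] one unit vector is orthogonal to the
    [i] vectors [w 0], ..., [w i.-1]; the form is at least [l] there, and at most
    its value at [w i]. *)
Lemma eigenframe_minmax n (Q : 'M[R]_n) w v i l : eigenframe Q w n -> (i < n)%N ->
  frame v i.+1 ->
  (forall c : 'I_i.+1 -> R, l * \sum_j c j ^+ 2 <=
     mxform Q (\sum_j c j *: v j) (\sum_j c j *: v j)) ->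
  l <= mxform Q (w i) (w i).
Proof.
move=> [fw gw] ni fv Hv.
have [y [y1 yu]] := exists_orthogonal_row
  (fun k => \row_(j < i.+1) dotrow (v j) (w k)) (ltnSn i).
pose x := \sum_(j < i.+1) y 0 j *: v j.
have xw k : (k < i)%N -> dotrow x (w k) = 0.
  move=> ki; rewrite -(yu k ki) dotrowE mxform_suml dotrow_sum; apply: eq_bigr => j _.
  by rewrite mxformZl -dotrowE mxE.
have xx : dotrow x x = \sum_j y 0 j ^+ 2.
  rewrite dotrowE {1}/x mxform_suml; apply: eq_bigr => j _.
  rewrite mxformZl /x mxform_sumr (bigD1 j)//= mxformZr -dotrowE fv// eqxx mulr1.
  rewrite big1 ?addr0 ?expr2// => k kj; rewrite mxformZr -dotrowE fv//.
  by rewrite eq_sym (_ : (k == j :> nat) = false) ?mulr0//; apply/negbTE.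
have := gw i ni x xw; rewrite xx; have := Hv (fun j => y 0 j); rewrite -/x.
have -> : \sum_j y 0 j ^+ 2 = 1.
  by rewrite -y1 dotrow_sum; apply: eq_bigr => j _; rewrite expr2.
rewrite !mulr1; exact: le_trans.
Qed.
End SymmetricMatrices.

(** * The normal law on the line: moments and characteristic function *)

Section NormalLaw.
Variable R : realType.
Local Notation mu := (@lebesgue_measure R).
Local Notation N := (@normal_prob R).

Import HBNNSimple.

(** The law is defined by its density on sets; simple functions and monotone
    convergence extend this to nonnegative integrands. *)
Lemma normal_integral_ge0 (m s : R) (f : _ -> \bar R) :
  measurable_fun setT f -> (forall x, 0 <= f x)%E ->
  (\int[N m s]_x f x = \int[mu]_x (f x * (normal_pdf m s x)%:E))%E.
Proof.
move=> mf f0.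
have mp : measurable_fun setT (fun x => (normal_pdf m s x)%:E).
  by apply/measurable_EFinP; exact: measurable_normal_pdf.
have p0 x : (0 <= (normal_pdf m s x)%:E)%E by rewrite lee_fin normal_pdf_ge0.
pose f_ := nnsfun_approx measurableT mf.
have simple n : (\int[N m s]_x (f_ n x)%:E = \int[mu]_x ((f_ n x)%:E * (normal_pdf m s x)%:E))%E.
  rewrite integralT_nnsfun sintegralE.
  pose F r x := (r%:E * ((\1_(f_ n @^-1` [set r]) x)%:E * (normal_pdf m s x)%:E))%E.
  rewrite (eq_integral (fun x => \sum_(r \in range (f_ n)) F r x))%E; last first.
    move=> x _; rewrite fimfunE -fsumEFin// ge0_mule_fsuml.
      by apply: eq_fsbigr => r _; rewrite /F EFinM muleA.
    by move=> r; rewrite EFinM; apply: nnfun_muleindic_ge0.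
  rewrite ge0_integral_fsum//.
  - apply: eq_fsbigr => r; rewrite inE => -[x _ <-].
    rewrite ge0_integralZl//.
    + congr (_ * _)%E; rewrite /normal_prob/= [LHS]integral_mkcond; apply: eq_integral => y _.
      by rewrite patchE indicE; case: ifP; rewrite ?mul1e ?mul0e.
    + by apply: emeasurable_funM => //; apply/measurable_EFinP; exact: measurable_indic.
    + by move=> y _; rewrite mule_ge0// lee_fin.
    + by rewrite lee_fin.
  - move=> r; apply: measurable_funeM; apply: emeasurable_funM => //.
    by apply/measurable_EFinP; exact: measurable_indic.
  - move=> r x _; rewrite /F muleA mule_ge0//; exact: nnfun_muleindic_ge0.
transitivity (lim (\int[N m s]_x (f_ n x)%:E @[n --> \oo])%E).
  rewrite -monotone_convergence//=.
  - apply: eq_integral => x _; apply/esym/cvg_lim => //=; exact: cvg_nnsfun_approx.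
  - by move=> n; exact/measurable_EFinP/measurable_funTS.
  - by move=> n x _; rewrite lee_fin.
  - by move=> x _ k n kn; rewrite lee_fin; exact/lefP/nd_nnsfun_approx.
under eq_fun do rewrite simple.
rewrite -monotone_convergence//=.
- apply: eq_integral => x _; apply/cvg_lim => //=.
  by apply: cvgeZr => //; exact: cvg_nnsfun_approx.
- by move=> n; apply: emeasurable_funM => //; exact/measurable_EFinP/measurable_funTS.
- by move=> n x _; rewrite mule_ge0// lee_fin.
- move=> x _ k n kn; apply: lee_wpmul2r => //.
  by rewrite lee_fin; exact/lefP/nd_nnsfun_approx.
Qed.

(** The integral over [[-n, n]] is a difference of boundary values. *)
Lemma Rintegral_derivative_eq0 (f f' : R -> R) :
  (forall x : R, is_derive x 1 f (f' x)) -> continuous f' ->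
  mu.-integrable setT (EFin \o f') ->
  f n%:R @[n --> \oo] --> 0 -> f (- n%:R) @[n --> \oo] --> 0 ->
  \int[mu]_x f' x = 0.
Proof.
move=> df cf' intf' fy fNy.
have ftc n : (\int[mu]_(x in `[(- n.+1%:R)%R, n.+1%:R%R]) (f' x)%:E =
    (f n.+1%:R - f (- n.+1%:R))%:E)%E.
  rewrite EFinB; apply: continuous_FTC2.
  - by rewrite gtrN.
  - exact: continuous_subspaceT.
  - have cf : continuous f.
      by move=> x; apply: differentiable_continuous; apply/derivable1_diffP.
    split.
    + by move=> x _; exact: ex_derive.
    + by apply: cvg_at_right_filter; exact: cf.
    + by apply: cvg_at_left_filter; exact: cf.
  - by move=> x _; rewrite derive1E; exact: derive_val.
have cv1 : (\int[mu]_(x in `[(- n.+1%:R)%R, n.+1%:R%R]) (f' x)%:E)%E @[n --> \oo]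
    --> (\int[mu]_x (f' x)%:E)%E.
  under eq_fun do rewrite integral_mkcond.
  apply: (@dominated_cvg _ _ _ mu setT measurableT _ _ (fun x => `|f' x|%:E)).
  - move=> n; apply/measurable_restrict => //=; rewrite setTI.
    by apply: measurable_funTS; exact: measurable_int intf'.
  - move=> x _; apply: cvg_near_cst; exists `|Num.ceil `|x| |%N => // n /= xn.
    rewrite patchE mem_set//= in_itv/= -ler_norml.
    apply: (@le_trans _ _ n%:R); last by rewrite ler_nat.
    apply: le_trans (ceil_ge _) _; rewrite -(ler_nat R) in xn.
    by apply: le_trans xn; rewrite natr_absz ler_int ler_norm.
  - by [].
  - have := integrable_abse intf'; exact: eq_integrable.
  - move=> n x _; rewrite patchE; case: ifPn => _ //=.
    by rewrite lee_fin normr0 normr_ge0.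
have cv2 : (\int[mu]_(x in `[(- n.+1%:R)%R, n.+1%:R%R]) (f' x)%:E)%E @[n --> \oo]
    --> 0%E.
  under eq_fun do rewrite ftc.
  apply/cvg_EFin; first exact: nearW.
  rewrite -[X in _ --> X](subr0 0); apply: cvgB.
    by move: fy; rewrite -cvg_shiftS.
  by move: fNy; rewrite -(@cvg_shiftS _ (fun n => f (- n%:R))).
by rewrite /Rintegral (cvg_unique _ cv1 cv2).
Qed.

Section Density.
Variables (m s : R).
Hypothesis s0 : s != 0.
Local Notation p := (normal_pdf m s).

Let s2_gt0 : 0 < s ^+ 2. Proof. by rewrite exprn_even_gt0. Qed.

Let s22_gt0 : 0 < s ^+ 2 * 2. Proof. by rewrite pmulr_rgt0. Qed.

Lemma sqr_normal_pdf_bounded x : (x - m) ^+ 2 * p x <= 2 * s ^+ 2 * normal_peak s.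
Proof.
rewrite normal_pdfE// /normal_fun -mulr_natr mulNr expRN.
set u := (x - m) ^+ 2 / (s ^+ 2 * 2).
have -> : (x - m) ^+ 2 = u * (s ^+ 2 * 2).
  by rewrite /u divfK// gt_eqF.
have /(ler_wpM2r (ltW (normal_peak_gt0 s0))) : u / expR u * (s ^+ 2 * 2) <= 2 * s ^+ 2.
  rewrite (mulrC 2) ger_pMl ?s22_gt0// ler_pdivrMr ?expR_gt0// mul1r.
  by apply: le_trans (expR_ge1Dx u); rewrite lerDr.
by apply: le_trans; rewrite le_eqVlt; apply/orP; left; apply/eqP; ring.
Qed.

(** The quadratic factor is absorbed by half of the exponent: a normal density of
    twice the variance dominates. This yields the integrability of all functions of
    quadratic growth at once, before any moment is known. *)
Lemma sqr_normal_pdf_le :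
  {C : R | forall x, (x - m) ^+ 2 * p x <= C * normal_pdf m (Num.sqrt 2 * s) x}.
Proof.
have t0 : Num.sqrt 2 * s != 0 by rewrite mulf_neq0// gt_eqF// sqrtr_gt0.
exists (4 * s ^+ 2 * normal_peak s / normal_peak (Num.sqrt 2 * s)) => x.
rewrite (normal_pdfE _ t0) !normal_pdfE// /normal_fun.
rewrite [leRHS]mulrA divfK ?gt_eqF ?normal_peak_gt0//.
rewrite exprMn sqr_sqrtr// -(mulr_natr (s ^+ 2)) -(mulr_natr (2 * s ^+ 2)) !mulNr !expRN.
set u := (x - m) ^+ 2 / (2 * s ^+ 2 * 2).
have -> : (x - m) ^+ 2 / (s ^+ 2 * 2) = u + u.
  by rewrite /u; field; rewrite s0.
have -> : (x - m) ^+ 2 = 4 * s ^+ 2 * u.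
  by rewrite /u; field; rewrite s0.
rewrite expRD invfM.
have e0 : 0 < expR u := expR_gt0 u.
have ue : u <= expR u by apply: le_trans (expR_ge1Dx u); rewrite lerDr.
have : u / expR u <= 1 by rewrite ler_pdivrMr// mul1r.
move/(ler_wpM2r (ltW (normal_peak_gt0 s0))).
have : 0 <= 4 * s ^+ 2 / expR u by apply: divr_ge0; [apply: mulr_ge0; rewrite ?sqr_ge0|exact: ltW].
move=> /ler_wpM2l/[apply] H.
rewrite [leLHS](_ : _ = 4 * s ^+ 2 / expR u * (u / expR u * normal_peak s)).
  by apply: le_trans H _; rewrite mul1r mulrAC.
by field; rewrite gt_eqF.
Qed.

Lemma integrable_pdf_le (f : R -> R) (A B : R) : measurable_fun setT f ->
  (forall x, `|f x| <= A + B * (x - m) ^+ 2) ->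
  mu.-integrable setT (fun x => (f x * p x)%:E).
Proof.
move=> mf fAB; have [C HC] := sqr_normal_pdf_le.
have mp : measurable_fun setT p := measurable_normal_pdf m s.
apply: (@le_integrable _ _ _ mu setT measurableT _
  (fun x => (`|A|%:E * (p x)%:E + (`|B| * C)%:E * (normal_pdf m (Num.sqrt 2 * s) x)%:E)%E)).
- by apply/measurable_EFinP; exact: measurable_funM.
- move=> x _; rewrite -!EFinM -EFinD lee_fin.
  have p0 := normal_pdf_ge0 m s x.
  rewrite normrM (ger0_norm p0).
  apply: (@le_trans _ _ ((`|A| + `|B| * (x - m) ^+ 2) * p x)).
    apply: ler_wpM2r => //; apply: (le_trans (fAB x)).
    by apply: lerD; rewrite ?ler_norm// ler_wpM2r ?sqr_ge0 ?ler_norm.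
  apply: le_trans (ler_norm _).
  rewrite mulrDl lerD2l -mulrA -[leRHS]mulrA; apply: ler_wpM2l => //; exact: HC.
- by apply: integrableD => //; apply: integrableZl => //; exact: integrable_normal_pdf.
Qed.

Lemma is_derive_normal_pdf (x : R) :
  is_derive x 1 p (- ((x - m) / s ^+ 2 * p x)).
Proof.
rewrite normal_pdfE// /normal_fun.
apply: is_derive_eq.
rewrite /= !scaler0 /GRing.scale /=.
set e := expR _.
by field; rewrite s0.
Qed.

Lemma continuous_pdf : continuous p.
Proof. exact: continuous_normal_pdf. Qed.

Lemma pdf_tails (g : R -> R) (A : R) (u : R ^nat) :
  (forall x, `|g x| <= A * (1 + `|x - m|)) ->
  `|u n - m| @[n --> \oo] --> +oo ->
  g (u n) * p (u n) @[n --> \oo] --> 0.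
Proof.
move=> gA uy.
pose K := 2 * s ^+ 2 * normal_peak s.
have K0 : 0 <= K by rewrite mulr_ge0 ?normal_peak_ge0// (ltW (mulr_gt0 _ s2_gt0)).
have A0 : 0 <= A.
  have := le_trans (normr_ge0 _) (gA m).
  by rewrite subrr normr0 addr0 mulr1.
have dcv : 2 * A * K * `|u n - m|^-1 @[n --> \oo] --> 0.
  rewrite -[X in _ --> X](mulr0 (2 * A * K)); apply: cvgMr.
  by apply/gtr0_cvgV0 => //; near=> n; apply: (@lt_le_trans _ _ 1) => //;
    near: n; move/cvgryPge : uy; exact.
apply: norm_cvg0.
apply: (squeeze_cvgr _ (cvg_cst 0) dcv).
near=> n.
have d1 : 1 <= `|u n - m| by near: n; move/cvgryPge : uy; exact.
have d0 : 0 < `|u n - m| by apply: lt_le_trans d1.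
rewrite normr_ge0/= normrM (ger0_norm (normal_pdf_ge0 _ _ _)).
have h1 := sqr_normal_pdf_bounded (u n).
rewrite -real_normK ?num_real// mulrC in h1.
have h2 : p (u n) <= K / `|u n - m| ^+ 2.
  by rewrite ler_pdivlMr// exprn_gt0.
apply: (@le_trans _ _ (A * (2 * `|u n - m|) * (K / `|u n - m| ^+ 2))).
  apply: ler_pM => //; rewrite ?normal_pdf_ge0//.
  apply: (le_trans (gA _)); rewrite ler_wpM2l//.
  by rewrite mulr_natl mulr2n lerD2r.
by rewrite le_eqVlt; apply/orP; left; apply/eqP; field; rewrite gt_eqF.
Unshelve. all: by end_near. Qed.

Lemma natr_dist_cvgy : `|n%:R - m| @[n --> \oo] --> +oo.
Proof.
apply/cvgryPge => B; near=> n.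
apply: le_trans (ler_norm _); rewrite lerBrDr.
by near: n; apply: nbhs_infty_ger.
Unshelve. all: by end_near. Qed.

Lemma Nnatr_dist_cvgy : `|- n%:R - m| @[n --> \oo] --> +oo.
Proof.
apply/cvgryPge => B; near=> n.
rewrite -normrN opprB opprK addrC; apply: le_trans (ler_norm _); rewrite -lerBlDr.
by near: n; apply: nbhs_infty_ger.
Unshelve. all: by end_near. Qed.

(** Integration by parts against the density: p' is -(x - m) / s^2 times p. All the
    moments below, and the differential equation of the characteristic function,
    are instances. *)
Lemma Rintegral_normal_parts (g g' : R -> R) (A : R) :
  (forall x : R, is_derive x 1 g (g' x)) -> continuous g' ->
  (forall x, `|g x| <= A * (1 + `|x - m|)) ->
  (forall x, `|g' x| <= A) ->
  \int[mu]_x (g' x * p x) = (s ^+ 2)^-1 * \int[mu]_x ((x - m) * g x * p x).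
Proof.
move=> dg cg' gA g'A.
have cg : continuous g.
  by move=> x; apply: differentiable_continuous; apply/derivable1_diffP.
have A0 : 0 <= A by apply: le_trans (g'A m).
have i1 : mu.-integrable setT (fun x => (g' x * p x)%:E).
  apply: (@integrable_pdf_le _ A 0); first exact: continuous_measurable_fun.
  by move=> x; rewrite mul0r addr0.
have c2 : continuous (fun x : R => (x - m) * g x).
  move=> x; apply: cvgM; last exact: cg.
  by apply: cvgB; [exact: cvg_id|exact: cvg_cst].
have i2 : mu.-integrable setT (fun x => ((x - m) * g x * p x)%:E).
  apply: (@integrable_pdf_le _ A (A * 2)); first exact: continuous_measurable_fun.
  move=> x; rewrite normrM.
  have := ler_wpM2l (normr_ge0 (x - m)) (gA x) => /le_trans; apply.
  rewrite -real_normK ?num_real//; set d := `|x - m|.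
  have d0 : 0 <= d := normr_ge0 _.
  have -> : A + A * 2 * d ^+ 2 = A * (1 + 2 * d ^+ 2) by ring.
  rewrite mulrCA ler_wpM2l//.
  by have := sqr_ge0 (d - 1); nra.
have := @Rintegral_derivative_eq0 (fun x => g x * p x)
  (fun x => g' x * p x - (s ^+ 2)^-1 * ((x - m) * g x * p x)).
have i2' : mu.-integrable setT (fun x => ((s ^+ 2)^-1 * ((x - m) * g x * p x))%:E).
  by under eq_fun do rewrite EFinM; exact: integrableZl.
rewrite RintegralB// RintegralZl// => H.
apply/eqP; rewrite -subr_eq0; apply/eqP; apply: H.
- move=> x; have := is_derive_normal_pdf x => dp.
  apply: is_derive_eq; rewrite /GRing.scale /=.
  by field; rewrite s0.
- move=> x; apply: cvgB; first by apply: cvgM; [exact: cg'|exact: continuous_pdf].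
  apply: cvgMr; apply: cvgM; [exact: c2|exact: continuous_pdf].
- exact: (integrableB measurableT i1 i2').
- exact: (pdf_tails gA natr_dist_cvgy).
- exact: (pdf_tails gA Nnatr_dist_cvgy).
Qed.

Lemma Rintegral_normal_pdf : \int[mu]_x p x = 1.
Proof. by rewrite /Rintegral integral_normal_pdf. Qed.

Lemma normal_centered_mean : \int[mu]_x ((x - m) * p x) = 0.
Proof.
have := @Rintegral_normal_parts (fun=> 1) (fun=> 0) 1.
rewrite [X in _ -> _ -> _ -> _ -> X = _](_ : _ = 0); last first.
  by under eq_Rintegral do rewrite mul0r; rewrite Rintegral_cst ?mul0r.
move=> H; have /esym/eqP : 0 = (s ^+ 2)^-1 * \int[mu]_x ((x - m) * 1 * p x).
  apply: H.
  - by move=> x; exact: cvg_cst.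
  - by move=> x; rewrite normr1 mul1r lerDl.
  - by move=> x; rewrite normr0.
rewrite mulf_eq0 invr_eq0 (gt_eqF s2_gt0)/= => /eqP <-.
by under [RHS]eq_Rintegral do rewrite mulr1.
Qed.

Lemma normal_variance : \int[mu]_x ((x - m) ^+ 2 * p x) = s ^+ 2.
Proof.
have := @Rintegral_normal_parts (fun x => x - m) (fun=> 1) 1.
rewrite [X in _ -> _ -> _ -> _ -> X = _](_ : _ = 1); last first.
  by under eq_Rintegral do rewrite mul1r; rewrite Rintegral_normal_pdf.
move=> H; have : 1 = (s ^+ 2)^-1 * \int[mu]_x ((x - m) * (x - m) * p x).
  apply: H.
  - by move=> x; apply: is_derive_eq; rewrite oppr0 addr0.
  - by move=> x; exact: cvg_cst.
  - by move=> x; rewrite mul1r lerDr.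
  - by move=> x; rewrite normr1.
move=> /(congr1 (fun y => s ^+ 2 * y)).
rewrite mulr1 mulrA divff ?gt_eqF// mul1r => ->.
by under eq_Rintegral do rewrite expr2.
Qed.

End Density.
End NormalLaw.

Section CharacteristicFunction.
Variable R : realType.
Local Notation mu := (@lebesgue_measure R).

Section Centered.
Variable s : R.
Hypothesis s0 : s != 0.
Local Notation p := (normal_pdf 0 s).

Let Phi (c : R) : R := \int[mu]_x (cos (c * x) * p x).

Let f (c x : R) : R := cos (c * x) * p x.

Let is_derive_f (x c : R) :
  is_derive c 1 (f ^~ x) (- (x * sin (c * x)) * p x).
Proof.
rewrite /f; apply: is_derive_eq; rewrite /GRing.scale /=.
by ring.
Qed.

(** Differentiation under the integral sign gives the mean of -x sin (c x), which
    integration by parts turns back into a multiple of the characteristic function. *)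
Lemma is_derive_charf (c : R) : is_derive c 1 Phi (- (s ^+ 2 * c) * Phi c).
Proof.
have cI : (`]c - 1, c + 1[%classic : set R) c.
  by rewrite /= in_itv/= gtrBl ltrDl ltr01.
have mp : measurable_fun setT p := measurable_normal_pdf 0 s.
have mcos (k : R) : measurable_fun setT (fun x : R => cos (k * x)).
  apply: continuous_measurable_fun => x.
  apply: (continuous_comp (f := fun x : R => k * x)); last exact: continuous_cos.
  by apply: cvgMr; exact: cvg_id.
have intf (x : R) : (`]c - 1, c + 1[%classic : set R) x -> mu.-integrable setT (EFin \o f x).
  move=> _; apply: (integrable_pdf_le s0 (A := 1) (B := 0)); first exact: mcos.
  by move=> y; rewrite mul0r addr0 ler_norml cos_le1 cos_geN1.
have derf (x y : R) : (`]c - 1, c + 1[%classic : set R) x -> [set: R] y -> derivable (f ^~ y) x 1.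
  by move=> _ _; have := is_derive_f y x => ?; exact: ex_derive.
have p1E : partial1of2 f = (fun c x => - (x * sin (c * x)) * p x).
  apply/funext => x; apply/funext => y; rewrite partial1of2E.
  by have := is_derive_f y x => ?; exact: derive_val.
have iG : mu.-integrable setT (fun x => (`|x| * p x)%:E).
  apply: (integrable_pdf_le s0 (A := 1) (B := 1)).
    exact: normr_measurable.
  move=> x; rewrite normr_id subr0 mul1r -real_normK ?num_real//.
  by have := sqr_ge0 (`|x| - 1); have := normr_ge0 x; nra.
have G0 (x : R) : 0 <= `|x| * p x by rewrite mulr_ge0 ?normal_pdf_ge0.
have Gub (x y : R) : (`]c - 1, c + 1[%classic : set R) x -> [set: R] y ->
    `|partial1of2 f x y| <= `|y| * p y.
  move=> _ _; rewrite p1E normrM (ger0_norm (normal_pdf_ge0 _ _ _)).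
  rewrite normrN normrM ler_wpM2r ?normal_pdf_ge0// ler_piMr//.
  by rewrite ler_norml sin_le1 sin_geN1.
have d1 := derivable_under_integral measurableT cI intf derf G0 iG Gub.
have d2 := differentiation_under_integral measurableT cI intf derf G0 iG Gub.
apply: DeriveDef; first exact: d1.
rewrite -derive1E d2 p1E.
have isc : mu.-integrable setT (fun x => (x * sin (c * x) * p x)%:E).
  apply: (integrable_pdf_le s0 (A := 1) (B := 1)).
    apply: measurable_funM; first exact: measurable_id.
    apply: continuous_measurable_fun => x.
    apply: (continuous_comp (f := fun x : R => c * x)); last exact: continuous_sin.
    by apply: cvgMr; exact: cvg_id.
  move=> x; rewrite subr0 mul1r normrM.
  apply: (@le_trans _ _ (`|x| * 1)).
    by rewrite ler_wpM2l// ler_norml sin_le1 sin_geN1.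
  rewrite mulr1 -real_normK ?num_real//.
  by have := sqr_ge0 (`|x| - 1); have := normr_ge0 x; nra.
have parts := @Rintegral_normal_parts R 0 s s0 (fun x => sin (c * x))
  (fun x => c * cos (c * x)) (1 + `|c|).
have {}parts : \int[mu]_x (c * cos (c * x) * p x) =
    (s ^+ 2)^-1 * \int[mu]_x ((x - 0) * sin (c * x) * p x).
  apply: parts.
  - move=> x; apply: is_derive_eq; rewrite /GRing.scale /=; ring.
  - move=> x; apply: cvgMr.
    apply: (continuous_comp (f := fun x : R => c * x)); last exact: continuous_cos.
    by apply: cvgMr; exact: cvg_id.
  - move=> x; apply: (@le_trans _ _ 1).
      by rewrite ler_norml sin_le1 sin_geN1.
    by have := normr_ge0 c; have := normr_ge0 (x - 0); nra.
  - move=> x; rewrite normrM; apply: (@le_trans _ _ (`|c| * 1)).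
      by rewrite ler_wpM2l// ler_norml cos_le1 cos_geN1.
    by rewrite mulr1 lerDr.
rewrite (_ : \int[mu]_x _ = - \int[mu]_x (x * sin (c * x) * p x)); last first.
  under eq_Rintegral do rewrite mulNr -mulN1r.
  by rewrite RintegralZl// mulN1r.
have e1 : \int[mu]_x ((x - 0) * sin (c * x) * p x) = \int[mu]_x (x * sin (c * x) * p x).
  by apply: eq_Rintegral => x _; rewrite subr0.
rewrite e1 in parts.
have {}parts : s ^+ 2 * (c * Phi c) = \int[mu]_x (x * sin (c * x) * p x).
  have -> : c * Phi c = \int[mu]_x (c * cos (c * x) * p x).
    under [RHS]eq_Rintegral do rewrite -mulrA.
    by rewrite RintegralZl//; apply: intf.
  by rewrite parts mulrA divff ?mul1r// expf_neq0.
by rewrite -parts mulNr mulrA.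
Qed.

(** By [is_derive_charf] the quotient of the two sides has derivative zero. *)
Lemma normal_charf c : \int[mu]_x (cos (c * x) * p x) = expR (- (c ^+ 2 * s ^+ 2 / 2)).
Proof.
pose Psi (c : R) := Phi c * expR (c ^+ 2 * s ^+ 2 / 2).
have dPsi (x : R) : is_derive x 1 Psi 0.
  have := is_derive_charf x => ?.
  apply: is_derive_eq; rewrite /GRing.scale /=.
  by field.
have := is_derive_0_is_cst c 0 dPsi; rewrite /Psi.
have -> : Phi 0 = 1.
  rewrite /Phi; under eq_Rintegral do rewrite mul0r cos0 mul1r.
  exact: Rintegral_normal_pdf.
rewrite expr0n/= !mul0r expR0 mulr1 => /(congr1 (fun z => z * expR (- (c ^+ 2 * s ^+ 2 / 2)))).
by rewrite -mulrA -expRD subrr expR0 mulr1 mul1r.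
Qed.

End Centered.
End CharacteristicFunction.

Section GaussianVariable.
Context (R : realType) d (T : measurableType d) (P : probability T R).
Local Notation mu := (@lebesgue_measure R).
Local Notation N := (@normal_prob R).

(** Change of variables for signed integrands with no integrability assumption: both
    sides split into the same positive and negative parts. *)
Lemma integral_law (X : T -> R) (nu : {measure set (measurableTypeR R) -> \bar R}) (g : R -> R) :
  measurable_fun setT X -> measurable_fun setT g ->
  (forall A : set R, measurable A -> P (X @^-1` A) = nu A) ->
  (\int[P]_w (g (X w))%:E = \int[nu]_x (g x)%:E)%E.
Proof.
move=> mX mg law.
have ge0 (h : R -> \bar R) : measurable_fun setT h -> (forall x, 0 <= h x)%E ->
    (\int[P]_w h (X w) = \int[nu]_x h x)%E.
  move=> mh h0; have mX' : measurable_fun setT (X : T -> measurableTypeR R) := mX.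
  rewrite -(@ge0_integral_pushforward _ _ T (measurableTypeR R) R X mX' P setT h)//.
  by apply: eq_measure_integral => A mA _; exact: law.
have mg' : measurable_fun setT (EFin \o g) by exact/measurable_EFinP.
rewrite integralE [RHS]integralE; congr (_ - _)%E.
- have := ge0 ((EFin \o g)^\+)%E (measurable_funepos mg') (fun x => funepos_ge0 _ x).
  by apply: etrans; apply: eq_integral => w _; rewrite !funeposE.
- have := ge0 ((EFin \o g)^\-)%E (measurable_funeneg mg') (fun x => funeneg_ge0 _ x).
  by apply: etrans; apply: eq_integral => w _; rewrite !funenegE.
Qed.

Lemma normal_integral (m s : R) (g : R -> R) : measurable_fun setT g ->
  (\int[N m s]_x (g x)%:E = \int[mu]_x (g x * normal_pdf m s x)%:E)%E.
Proof.
move=> mg.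
have mg' : measurable_fun setT (EFin \o g) by exact/measurable_EFinP.
rewrite integralE normal_integral_ge0//; last exact: measurable_funepos.
rewrite normal_integral_ge0//; last exact: measurable_funeneg.
rewrite [RHS]integralE; congr (_ - _)%E; apply: eq_integral => x _.
- rewrite !funeposE -!EFin_max -EFinM; congr EFin.
  by rewrite maxr_pMl ?normal_pdf_ge0// mul0r.
- rewrite !funenegE -!EFin_max -EFinM; congr EFin.
  by rewrite maxr_pMl ?normal_pdf_ge0// mul0r mulNr.
Qed.

Variables (X : T -> R) (v : R).
Hypothesis mX : measurable_fun setT X.
Hypothesis gX : gaussian_rv P X.
Hypothesis EX : 'E_P[X]%E = 0%E.
Hypothesis VX : covariance P X X = v%:E.

Let var_integral : (\int[P]_w (X w ^+ 2)%:E = v%:E)%E.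
Proof.
move: VX; rewrite unlock EX /= unlock => <-.
by apply: eq_integral => w _; rewrite mulrfctE /= !subr0 expr2.
Qed.

(** The law of [X] is a Dirac mass or a normal law; the first two moments determine
    its parameters, and then the characteristic function. *)
Lemma centered_gaussian_charf (c : R) :
  (\int[P]_w (cos (c * X w))%:E = (expR (- (c ^+ 2 * v / 2)))%:E)%E.
Proof.
have mcos : measurable_fun setT (fun x : R => cos (c * x)).
  apply: continuous_measurable_fun => x.
  apply: (continuous_comp (f := fun x : R => c * x)); last exact: continuous_cos.
  by apply: cvgMr; exact: cvg_id.
have msq : measurable_fun setT (fun x : R => x ^+ 2) by exact: exprn_measurable.
have mid : measurable_fun setT (fun x : R => x) by exact: measurable_id.
have [m [s law]] := gX.
move: EX; rewrite unlock => EX'; move: var_integral.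
have [s0|s0] := eqVneq s 0.
  pose D : {measure set (measurableTypeR R) -> \bar R} := @dirac _ (measurableTypeR R) m R.
  have {}law (A : set R) : measurable A -> P (X @^-1` A) = D A.
    by move=> /law ->; rewrite /gaussian_law s0 eqxx.
  move: EX'; rewrite (integral_law mX mid law) /D integral_dirac ?diracT ?mul1e //.
  move=> [] /= m0.
  rewrite (integral_law mX msq law) /D integral_dirac ?diracT ?mul1e //; last by exact/measurable_EFinP.
  move=> [] <-.
  rewrite (integral_law mX mcos law) /D integral_dirac ?diracT ?mul1e //; last by exact/measurable_EFinP.
  by rewrite m0 mulr0 cos0 expr0n/= mulr0 mul0r oppr0 expR0.
have {}law A : measurable A -> P (X @^-1` A) = N m s A.
  by move=> /law ->; rewrite /gaussian_law (negbTE s0).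
move: EX'; rewrite (integral_law mX mid law) normal_integral//.
have ip1 : mu.-integrable setT (fun x => ((x - m) * normal_pdf m s x)%:E).
  apply: (integrable_pdf_le s0 (A := 1) (B := 1)).
    by apply: measurable_funB.
  move=> x; rewrite mul1r -real_normK ?num_real//.
  by have := sqr_ge0 (`|x - m| - 1); have := normr_ge0 (x - m); nra.
have ip0 := integrable_normal_pdf m s.
rewrite (_ : (\int[mu]_x _ = m%:E)%E) => [[m0]|]; last first.
  have -> : m%:E = (\int[mu]_x ((x - m) * normal_pdf m s x + m * normal_pdf m s x)%:E)%E.
    under eq_integral do rewrite EFinD.
    rewrite integralD//; last by under eq_fun do rewrite EFinM; exact: integrableZl.
    have -> : (\int[mu]_x ((x - m) * normal_pdf m s x)%:E = 0)%E.
      rewrite -(fineK (integrable_fin_num _ ip1))//; congr EFin.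
      exact: normal_centered_mean.
    under eq_integral do rewrite EFinM.
    by rewrite integralZl// integral_normal_pdf mule1 add0e.
  by apply: eq_integral => x _; rewrite -mulrDl subrK.
subst m; rewrite (integral_law mX msq law) normal_integral//.
have ip2 : mu.-integrable setT (fun x => (x ^+ 2 * normal_pdf 0 s x)%:E).
  apply: (integrable_pdf_le s0 (A := 0) (B := 1)) => //.
  by move=> x; rewrite mul1r subr0 add0r ger0_norm ?sqr_ge0.
rewrite -(fineK (integrable_fin_num _ ip2))// => -[].
have /= := normal_variance 0 s0.
under eq_Rintegral do rewrite subr0.
rewrite /Rintegral => -> <-.
rewrite (integral_law mX mcos law) normal_integral// -normal_charf//.
rewrite /Rintegral fineK//; apply: integrable_fin_num => //.
apply: (integrable_pdf_le s0 (A := 1) (B := 0)) => //.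
by move=> x; rewrite mul0r addr0 ler_norml cos_le1 cos_geN1.
Qed.

Lemma centered_gaussian_variance_ge0 : 0 <= v.
Proof.
by rewrite -lee_fin -var_integral; apply: integral_ge0 => w _; rewrite lee_fin sqr_ge0.
Qed.

End GaussianVariable.

(** * Gaussian measure of thin elliptic annuli *)

Section EllipticAnnulus.
Variable R : realType.
Local Notation mu := (@lebesgue_measure R).

Variables a b : R.
Hypothesis a0 : 0 < a.
Hypothesis b0 : 0 < b.

(** Half the length of the vertical chord of the ellipse [a u^2 + b v^2 < y] above
    [u], and 0 where the chord is empty. *)
Let halfchord (y u : R) : R := Num.sqrt (Num.max (y - a * u ^+ 2) 0 / b).

Let halfchord_ge0 y u : 0 <= halfchord y u. Proof. exact: sqrtr_ge0. Qed.

Let sliceE y u : [set v : R | b * v ^+ 2 < y - a * u ^+ 2] =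
  `]- halfchord y u, halfchord y u[%classic.
Proof.
apply/seteqP; split => v /=; rewrite in_itv/= -ltr_norml /halfchord.
- move=> yv; have c0 : 0 < y - a * u ^+ 2.
    by apply: le_lt_trans yv; rewrite mulr_ge0 ?sqr_ge0// ltW.
  rewrite max_l ?ltW// -(ltr_pXn2r (n := 2)) ?nnegrE ?sqrtr_ge0//.
  rewrite sqr_sqrtr ?divr_ge0 ?ltW// real_normK ?num_real//.
  by rewrite ltr_pdivlMr// mulrC.
- have [c0|c0] := ltP (y - a * u ^+ 2) 0.
    by rewrite mul0r sqrtr0 ltNge normr_ge0.
  rewrite -(ltr_pXn2r (n := 2)) ?nnegrE ?sqrtr_ge0//.
  rewrite sqr_sqrtr ?divr_ge0 ?(ltW b0)// real_normK ?num_real//.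
  by rewrite ltr_pdivlMr// mulrC.
Qed.

Let slice_measure y u :
  mu [set v : R | b * v ^+ 2 < y - a * u ^+ 2] = (2 * halfchord y u)%:E.
Proof.
rewrite sliceE lebesgue_measure_itv/= lte_fin.
case: ifPn => [_|]; first by rewrite -EFinD opprK mulr2n mulrDl mul1r.
rewrite -leNgt => h; congr EFin.
by have := halfchord_ge0 y u; lra.
Qed.

Let cont_halfchord y : continuous (halfchord y).
Proof.
move=> u; rewrite /halfchord.
apply: (continuous_comp (f := fun u : R => Num.max (y - a * u ^+ 2) 0 / b)); last exact: sqrt_continuous.
apply: cvgMl; apply: (@continuous_max _ _ (fun u : R => y - a * u ^+ 2) (fun=> 0)); last exact: cvg_cst.
apply: cvgB; first exact: cvg_cst.
apply: cvgMr; exact: exprn_continuous.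
Qed.

(** The area of the ellipse [a u^2 + b v^2 < y]. *)
Let J (y : R) : \bar R := (\int[mu]_u (2 * halfchord y u)%:E)%E.

(** The ellipse of level [y] is the image of that of level 1 under scaling by
    [sqrt y], so the area is linear in the level. *)
Let J_scale y : 0 < y -> J y = (y%:E * J 1)%E.
Proof.
move=> y0; rewrite /J; pose F (u : R) : R := Num.sqrt y * u.
have s0 : 0 < Num.sqrt y by rewrite sqrtr_gt0.
have dF (x : R) : is_derive x 1 F (Num.sqrt y).
  by rewrite /F; apply: is_derive_eq; by rewrite /GRing.scale/=; ring.
have F'E : F^`()%classic = cst (Num.sqrt y).
  by apply/funext => x; rewrite derive1E; exact: derive_val.
rewrite (@increasing_ge0_integration_by_substitutionT R F) ?F'E.
- rewrite -ge0_integralZl//; last 3 first.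
  + apply/measurable_EFinP; apply: measurable_funM => //.
    exact: continuous_measurable_fun.
  + by move=> u _; rewrite lee_fin mulr_ge0.
  + by rewrite lee_fin ltW.
  apply: eq_integral => u _; rewrite -EFinM; congr EFin.
  rewrite mulrfctE /= /F /halfchord exprMn sqr_sqrtr ?ltW//.
  rewrite (_ : y - a * (y * u ^+ 2) = y * (1 - a * u ^+ 2)); last by ring.
  rewrite -{1}(mulr0 y) -maxr_pMr ?(ltW y0)// -(mulrA y) (sqrtrM _ (ltW y0)).
  rewrite -{3}(sqr_sqrtr (ltW y0)).
  by ring.
- by move=> x z xz; rewrite /F ltr_pM2l.
- by move=> ?; exact: cvg_cst.
- exact: is_cvg_cst.
- exact: is_cvg_cst.
- by move=> x; have := dF x => ?; exact: ex_derive.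
- by apply: gt0_cvgMrNy => //; exact: cvg_id.
- by apply: gt0_cvgMry => //; exact: cvg_id.
- by move=> x; apply: cvgMr; exact: cont_halfchord.
- by move=> x; rewrite mulr_ge0.
Qed.

Let J_le0 y : y <= 0 -> J y = 0%E.
Proof.
move=> y0; rewrite /J; under eq_integral.
  move=> u _; rewrite /halfchord max_r; last first.
    by rewrite subr_le0 (le_trans y0)// mulr_ge0 ?sqr_ge0// ltW.
  rewrite mul0r sqrtr0 mulr0; over.
by rewrite integral0.
Qed.

(** Bounding box: the sides are [2 / sqrt a] and [2 / sqrt b]. *)
Let J1 : (J 1 <= (4 / Num.sqrt (a * b))%:E)%E.
Proof.
have sa : 0 < Num.sqrt a by rewrite sqrtr_gt0.
have sb : 0 < Num.sqrt b by rewrite sqrtr_gt0.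
pose r := (Num.sqrt a)^-1.
have r0 : 0 < r by rewrite invr_gt0.
apply: (@le_trans _ _ (\int[mu]_u ((2 / Num.sqrt b)%:E * (\1_`[- r, r]%classic u)%:E))%E).
  apply: ge0_le_integral => //=.
  - by move=> u _; rewrite lee_fin mulr_ge0.
  - apply/measurable_EFinP; apply: measurable_funM => //.
    exact: continuous_measurable_fun.
  - apply: measurable_funeM; exact/measurable_EFinP/measurable_indic.
  move=> u _; rewrite -EFinM lee_fin -mulrA ler_wpM2l// indicE.
  case: (boolP (u \in _)) => [_|].
    rewrite mulr1 /halfchord sqrtrM; last by rewrite le_max lexx orbT.
    rewrite sqrtrV ?(ltW b0)// ler_piMl ?invr_ge0 ?(ltW sb)//.
    rewrite -[leRHS]sqrtr1 ler_wsqrtr// ge_max ler01 andbT gerBl mulr_ge0 ?sqr_ge0//.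
    exact: ltW.
  rewrite notin_setE/= in_itv/= => /negP; rewrite -ler_norml -ltNge => ru.
  rewrite mulr0 /halfchord max_r ?mul0r ?sqrtr0//.
  rewrite subr_le0 -real_normK ?num_real//.
  have : r ^+ 2 <= `|u| ^+ 2 by rewrite ler_pXn2r ?nnegrE ?(ltW r0) ?(ltW ru)//.
  move=> /(ler_wpM2l (ltW a0)); apply: le_trans.
  by rewrite /r exprVn sqr_sqrtr ?(ltW a0)// divff// gt_eqF.
rewrite ge0_integralZl//; last exact/measurable_EFinP/measurable_indic.
rewrite integral_indic//= setIT lebesgue_measure_itv/= lte_fin gtrN//.
rewrite -EFinD -EFinM lee_fin opprK /r sqrtrM ?(ltW a0)//.
by rewrite le_eqVlt; apply/orP; left; apply/eqP; field; rewrite !gt_eqF.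
Qed.

Let J1_fin : J 1 \is a fin_num.
Proof.
rewrite ge0_fin_numE; first by apply: le_lt_trans J1 _; rewrite ltry.
by apply: integral_ge0 => u _; rewrite lee_fin mulr_ge0.
Qed.

(** The area of the ellipse is linear in its level, so the region between two levels
    has an area proportional to their difference, wherever the levels are. *)
Lemma elliptic_annulus_area (y D : R) : 0 <= D ->
  (\int[mu]_u mu [set v : R | (y - D <= a * u ^+ 2 + b * v ^+ 2 < y)%R]
    <= (D * (4 / Num.sqrt (a * b)))%:E)%E.
Proof.
move=> D0.
have mslice z u : measurable [set v : R | b * v ^+ 2 < z - a * u ^+ 2].
  by rewrite sliceE; exact: measurable_itv.
have Jfin z : J z \is a fin_num.
  have [z0|z0] := leP z 0; first by rewrite J_le0.
  by rewrite J_scale// fin_numM.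
have intJ z : mu.-integrable setT (fun u => (2 * halfchord z u)%:E).
  apply/integrableP; split.
    apply/measurable_EFinP; apply: measurable_funM => //.
    exact: continuous_measurable_fun.
  under eq_integral do rewrite gee0_abs ?lee_fin ?mulr_ge0//.
  by have := Jfin z; rewrite fin_numElt => /andP[].
have chordm u : mu [set v : R | (y - D <= a * u ^+ 2 + b * v ^+ 2 < y)%R] =
    ((2 * halfchord y u)%:E - (2 * halfchord (y - D) u)%:E)%E.
  rewrite -!slice_measure.
  have -> : [set v : R | (y - D <= a * u ^+ 2 + b * v ^+ 2 < y)%R] =
     [set v : R | b * v ^+ 2 < y - a * u ^+ 2] `\`
     [set v : R | b * v ^+ 2 < (y - D) - a * u ^+ 2].
    apply/seteqP; split => v /=.
      by move=> /andP[h1 h2]; split; [lra|apply/negP; rewrite -leNgt; lra].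
    by move=> [h1 /negP]; rewrite -leNgt => h2; apply/andP; split; lra.
  rewrite measureD//; last by rewrite [X in (X < _)%E]slice_measure ltry.
  - congr (_ - mu _)%E; apply/seteqP; split => v /=; first by case.
    by move=> h; split => //; lra.
  - exact: mslice.
  - exact: mslice.
under eq_integral do rewrite chordm.
rewrite integralB// -/(J y) -/(J (y - D)).
have [y0|y0] := leP y 0.
  rewrite !J_le0//; last lra.
  by rewrite sube0 lee_fin mulr_ge0// divr_ge0// sqrtr_ge0.
rewrite (J_scale y0).
apply: (@le_trans _ _ (D%:E * J 1)%E); last by rewrite EFinM lee_wpmul2l.
rewrite -(fineK J1_fin) -!EFinM.
have j0 : 0 <= fine (J 1).
  by apply: fine_ge0; apply: integral_ge0 => u _; rewrite lee_fin mulr_ge0.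
have [yD|yD] := leP (y - D) 0.
  have -> : J (y - D) = 0%E by exact: J_le0.
  by rewrite oppe0 adde0 lee_fin ler_wpM2r//; lra.
rewrite (J_scale yD) -[X in (_ * X)%E](fineK J1_fin) -EFinM -EFinB lee_fin; lra.
Qed.

End EllipticAnnulus.

Section GaussianAnnulus.
Variable R : realType.
Local Notation mR := (measurableTypeR R).
Local Notation mu := (@lebesgue_measure R).
Local Notation N := (@normal_prob R 0 1).
Local Notation p := (@normal_pdf R 0 1).

(** Geometric decay over the radial shells [4 k <= g^2 + h^2 < 4 (k + 1)], from
    [exp (- 2) <= 1 / 4]. *)
Lemma std_normal_pdfM_le (g h : R) (k : nat) : 4 * k%:R <= g ^+ 2 + h ^+ 2 ->
  p g * p h <= normal_peak 1 ^+ 2 / 4 ^+ k.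
Proof.
move=> kr; rewrite !normal_pdfE ?oner_eq0// /normal_fun !subr0 expr1n.
rewrite mulrACA -expr2 ler_wpM2l ?sqr_ge0// -expRD.
apply: (@le_trans _ _ (expR (- (2 * k%:R)))).
  by rewrite ler_expR !mulNr -opprD lerN2 -mulrDl ler_pdivlMr//; lra.
rewrite expRN lef_pV2 ?posrE ?expR_gt0 ?exprn_gt0//.
rewrite expRM_natr.
have h2 : (4 : R) <= expR 2.
  have -> : (2 : R) = 1 + 1 by [].
  have e1 := expR_ge1Dx (1 : R).
  rewrite expRD; have := expR_gt0 (1 : R); nra.
by rewrite lerXn2r// nnegrE ?expR_ge0.
Qed.

Lemma measurable_annulus (a b x D d0 d1 : R) :
  measurable [set z : mR * mR | x - D - (d0 * z.1 ^+ 2 + d1 * z.2 ^+ 2) <=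
    a * z.1 ^+ 2 + b * z.2 ^+ 2 < x].
Proof.
have mq1 (c : R) : measurable_fun setT (fun z : mR * mR => c * z.1 ^+ 2 : mR).
  by apply: measurable_funM => //; apply: measurable_funX; exact: measurable_fst.
have mq2 (c : R) : measurable_fun setT (fun z : mR * mR => c * z.2 ^+ 2 : mR).
  by apply: measurable_funM => //; apply: measurable_funX; exact: measurable_snd.
pose q (c e : R) (z : mR * mR) : R := c * z.1 ^+ 2 + e * z.2 ^+ 2.
have mq c e : measurable_fun setT (q c e) by apply: measurable_funD; [exact: mq1|exact: mq2].
have -> : [set z : mR * mR | x - D - (d0 * z.1 ^+ 2 + d1 * z.2 ^+ 2) <=
    a * z.1 ^+ 2 + b * z.2 ^+ 2 < x] =
    (q a b @^-1` `]-oo, x[) `&` ((q a b \+ q d0 d1) @^-1` `[x - D, +oo[).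
  apply/seteqP; split => z; rewrite /q /= !in_itv/= andbT.
    by move=> /andP[h1 h2]; split => //; lra.
  by move=> [h1 h2]; apply/andP; split => //; lra.
apply: measurableI.
  rewrite -[X in measurable X]setTI; apply: mq => //; exact: measurable_itv.
rewrite -[X in measurable X]setTI.
have : measurable_fun setT (q a b \+ q d0 d1) by exact: measurable_funD.
by apply => //; exact: measurable_itv.
Qed.

Variables a b : R.
Hypothesis a0 : 0 < a.
Hypothesis b0 : 0 < b.

(** Where [g^2 + h^2 < 4 (k + 1)] the thickness [D + d0 g^2 + d1 h^2] is at most
    [4 (k + 1) E] with [E = D + d0 + d1], so the shell of index [k] has an area at
    most [4 (k + 1) E * 4 / sqrt (a b)] and a density at most [p(0)^2 / 4^k]. Since
    [k + 1 <= 2^k], the sum over [k] is bounded by a geometric series of ratio 1/2. *)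
Lemma gaussian_annulus (x D d0 d1 : R) : 0 <= D -> 0 <= d0 -> 0 <= d1 ->
  (\int[N]_g N [set h | (x - D - (d0 * g ^+ 2 + d1 * h ^+ 2) <=
       a * g ^+ 2 + b * h ^+ 2 < x)%R]
   <= (32 * normal_peak 1 ^+ 2 / Num.sqrt (a * b) * (D + d0 + d1))%:E)%E.
Proof.
move=> D0 d00 d10.
set E := D + d0 + d1.
have E0 : 0 <= E by rewrite /E; lra.
have sab : 0 < Num.sqrt (a * b) by rewrite sqrtr_gt0 mulr_gt0.
pose A (k : nat) : set (mR * mR) :=
  [set z | x - 4 * E * k.+1%:R <= a * z.1 ^+ 2 + b * z.2 ^+ 2 < x].
pose S : set (mR * mR) := [set z | x - D - (d0 * z.1 ^+ 2 + d1 * z.2 ^+ 2) <=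
  a * z.1 ^+ 2 + b * z.2 ^+ 2 < x].
have mS : measurable S := measurable_annulus a b x D d0 d1.
have mA k : measurable (A k).
  have := measurable_annulus a b x (4 * E * k.+1%:R) 0 0; congr (measurable _).
  by apply/seteqP; split => z /=; rewrite !mul0r addr0 subr0.
have SE g : xsection S g = [set h | (x - D - (d0 * g ^+ 2 + d1 * h ^+ 2) <=
       a * g ^+ 2 + b * h ^+ 2 < x)%R].
  by apply/seteqP; split => h; rewrite /xsection /= inE.
have AE k g : xsection (A k) g =
    [set h | (x - 4 * E * k.+1%:R <= a * g ^+ 2 + b * h ^+ 2 < x)%R].
  by apply/seteqP; split => h; rewrite /xsection /= inE.
under eq_integral do rewrite -SE.
rewrite normal_integral_ge0//; last by apply: measurable_fun_xsection.
pose c k : R := normal_peak 1 ^+ 2 / 4 ^+ k.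
have c0 k : 0 <= c k by rewrite divr_ge0 ?sqr_ge0// exprn_ge0.
have key g : (N (xsection S g) * (p g)%:E <=
    \sum_(k <oo) ((c k)%:E * mu (xsection (A k) g)))%E.
  have mSg : measurable (xsection S g) by exact: measurable_xsection.
  rewrite /normal_prob integral_mkcond muleC -ge0_integralZl//; last 3 first.
  - apply/measurable_restrict => //; rewrite setTI; apply: measurable_funTS.
    by apply/measurable_EFinP; exact: measurable_normal_pdf.
  - by move=> h _; rewrite patchE; case: ifPn => // _; rewrite lee_fin normal_pdf_ge0.
  - by rewrite lee_fin normal_pdf_ge0.
  have -> : (\sum_(k <oo) ((c k)%:E * mu (xsection (A k) g)) =
      \int[mu]_h \sum_(k <oo) ((c k)%:E * (\1_(xsection (A k) g) h)%:E))%E.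
    rewrite integral_nneseries//; last 2 first.
    - move=> k; apply: measurable_funeM; apply/measurable_EFinP; apply: measurable_indic.
      exact: measurable_xsection.
    - by move=> k h _; rewrite mule_ge0// lee_fin.
    apply: eq_eseriesr => k _; rewrite ge0_integralZl//; last 2 first.
    - apply/measurable_EFinP; apply: measurable_indic; exact: measurable_xsection.
    - by rewrite lee_fin.
    by rewrite integral_indic ?setIT//; exact: measurable_xsection.
  apply: ge0_le_integral => //.
  - move=> h _; rewrite mule_ge0 ?lee_fin ?normal_pdf_ge0//.
    by rewrite patchE; case: ifPn => // _; rewrite lee_fin normal_pdf_ge0.
  - apply: measurable_funeM; apply/measurable_restrict => //; rewrite setTI; apply: measurable_funTS.
    by apply/measurable_EFinP; exact: measurable_normal_pdf.
  - apply: ge0_emeasurable_sum => k.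
      by move=> h _ _; rewrite mule_ge0// lee_fin.
    move=> _; apply: measurable_funeM; apply/measurable_EFinP; apply: measurable_indic.
    exact: measurable_xsection.
  move=> h _; rewrite patchE; case: ifPn => [|_]; last first.
    by rewrite mule0; apply: nneseries_ge0 => k _ _; rewrite mule_ge0// lee_fin.
  rewrite inE SE /= => /andP[h1 h2].
  (* The shell that contains the point bounds both the thickness and the density. *)
  pose k := Num.truncn ((g ^+ 2 + h ^+ 2) / 4).
  have /andP[k1 k2] : k%:R <= (g ^+ 2 + h ^+ 2) / 4 < k.+1%:R.
    by apply: truncn_itv; rewrite divr_ge0// addr_ge0 ?sqr_ge0.
  apply: (@le_trans _ _ ((c k)%:E * (\1_(xsection (A k) g) h)%:E)%E); last first.
    apply: le_trans (@nneseries_lim_ge R _ xpredT 0 k.+1 _); last first.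
      by move=> i _ _; rewrite mule_ge0// lee_fin.
    rewrite big_mkord big_ord_recr/= leeDr// sume_ge0// => i _.
    by rewrite mule_ge0// lee_fin.
  have hA : h \in xsection (A k) g.
    rewrite inE AE /=; apply/andP; split => //.
    apply: le_trans h1.
    have g2 := sqr_ge0 g; have hh2 := sqr_ge0 h.
    have k3 : g ^+ 2 + h ^+ 2 <= 4 * k.+1%:R by move: (ltW k2); rewrite ler_pdivrMr// mulrC.
    have k4 : 1 <= (k.+1%:R : R) by rewrite ler1n.
    rewrite /E; nra.
  rewrite indicE hA mule1 -EFinM lee_fin; apply: std_normal_pdfM_le.
  by move: k1; rewrite ler_pdivlMr// mulrC.
apply: (@le_trans _ _ (\int[mu]_g \sum_(k <oo) ((c k)%:E * mu (xsection (A k) g)))%E).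
  apply: ge0_le_integral => //.
  - by move=> g _; rewrite mule_ge0 ?lee_fin ?normal_pdf_ge0.
  - apply: emeasurable_funM; first exact: measurable_fun_xsection.
    by apply/measurable_EFinP; exact: measurable_normal_pdf.
  - apply: ge0_emeasurable_sum => k.
      by move=> h _ _; rewrite mule_ge0// lee_fin.
    by move=> _; apply: measurable_funeM; exact: measurable_fun_xsection.
rewrite integral_nneseries//; last 2 first.
- by move=> k; apply: measurable_funeM; exact: measurable_fun_xsection.
- by move=> k h _; rewrite mule_ge0// lee_fin.
pose r : R := 32 * normal_peak 1 ^+ 2 / Num.sqrt (a * b) * E.
have /cvg_lim rE := @cvg_geometric_eseries_half R r 0.
rewrite -/E -/r (_ : r%:E = (r / 2 ^+ 0)%:E); last by rewrite expr0 divr1.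
rewrite -rE//.
apply: lee_nneseries.
  by move=> k _ _; apply: integral_ge0 => g _; rewrite mule_ge0// lee_fin.
move=> k _; rewrite ge0_integralZl//; last 2 first.
- exact: measurable_fun_xsection.
- by rewrite lee_fin.
under eq_integral do rewrite AE.
have Ek0 : 0 <= 4 * E * k.+1%:R by rewrite !mulr_ge0.
have := elliptic_annulus_area a0 b0 x Ek0.
move=> /(lee_wpmul2l _) => /(_ (c k)%:E); rewrite lee_fin => /(_ (c0 k)) => /le_trans; apply.
rewrite -EFinM lee_fin /c /r addn1.
have k2 : (k.+1%:R : R) <= 2 ^+ k by rewrite -natrX ler_nat ltn_expl.
have -> : normal_peak 1 ^+ 2 / 4 ^+ k * (4 * E * k.+1%:R * (4 / Num.sqrt (a * b)))
   = 16 * normal_peak 1 ^+ 2 / Num.sqrt (a * b) * E / 4 ^+ k * k.+1%:R :> R.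
  by field; rewrite expf_neq0//= gt_eqF.
have -> : 32 * normal_peak 1 ^+ 2 / Num.sqrt (a * b) * E / (2 ^ k.+1)%:R
   = 16 * normal_peak 1 ^+ 2 / Num.sqrt (a * b) * E / 4 ^+ k * 2 ^+ k :> R.
  have -> : (4 : R) ^+ k = 2 ^+ k * 2 ^+ k by rewrite -exprMn -natrM.
  rewrite natrX (exprS 2 k).
  have : (2 : R) ^+ k != 0 by rewrite expf_neq0.
  move: (2 ^+ k) => t t0.
  by field; rewrite t0/= gt_eqF.
apply: ler_wpM2l => //.
by rewrite divr_ge0 ?exprn_ge0// !mulr_ge0 ?normal_peak_ge0// invr_ge0 ltW.
Qed.

End GaussianAnnulus.

(** * Weighted chi-square laws *)

Section WeightedChiSquare.
Variable R : realType.
Local Notation mR := (measurableTypeR R).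
Local Notation mu := (@lebesgue_measure R).
Local Notation N := (@normal_prob R 0 1).

Definition sqr_shift (a : R) (z : mR * mR) : mR := a * z.1 ^+ 2 + z.2.

Lemma measurable_sqr_shift a : measurable_fun setT (sqr_shift a).
Proof.
apply: measurable_funD; last exact: measurable_snd.
by apply: measurable_funM => //; apply: measurable_funX; exact: measurable_fst.
Qed.

HB.instance Definition _ a := isMeasurableFun.Build _ _ _ _ (sqr_shift a) (measurable_sqr_shift a).

(** The law of [sum_i l_i g_i^2] with independent standard normal [g_i], built by
    adding one square at a time. *)
Fixpoint wchisq (l : seq R) : probability mR R :=
  if l is a :: l' then distribution (N \x wchisq l')%E (sqr_shift a)
  else \d_(0 : mR).

Lemma ge0_integral_wchisq_cons (a : R) l (f : mR -> \bar R) :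
  measurable_fun setT f -> (forall s, 0 <= f s)%E ->
  (\int[wchisq (a :: l)]_s f s =
   \int[N]_g \int[wchisq l]_s f ((a * g ^+ 2 + s)%R : mR))%E.
Proof.
move=> mf f0.
rewrite [LHS](ge0_integral_distribution (sqr_shift a))// fubini_tonelli1//.
- apply: (measurableT_comp mf); exact: measurable_sqr_shift.
- by move=> z; exact: f0.
Qed.

Lemma measurable_exp_sqr (t : R) : measurable_fun setT (fun g : R => expR (- (t * g ^+ 2))).
Proof.
apply: continuous_measurable_fun => x.
apply: (continuous_comp (f := fun x : R => - (t * x ^+ 2))); last exact: continuous_expR.
apply: (@cvgN _ R); apply: cvgMr; exact: exprn_continuous.
Qed.

(** Multiplying the standard density by [exp (- t g^2)] gives, up to a factor, the
    centered normal density of variance [1 / (1 + 2 t)]. *)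
Lemma integral_exp_sqr (t : R) : 0 <= t ->
  (\int[N]_g (expR (- (t * g ^+ 2)))%:E = ((Num.sqrt (1 + 2 * t))^-1)%:E)%E.
Proof.
move=> t0; have s0 : 0 < Num.sqrt (1 + 2 * t) by rewrite sqrtr_gt0; lra.
pose s := (Num.sqrt (1 + 2 * t))^-1.
have ss : s != 0 by rewrite invr_eq0 gt_eqF.
rewrite normal_integral//; last exact: measurable_exp_sqr.
transitivity (\int[mu]_x (s%:E * (normal_pdf 0 s x)%:E))%E; last first.
  rewrite ge0_integralZl//.
  - by rewrite integral_normal_pdf mule1.
  - by apply/measurable_EFinP; exact: measurable_normal_pdf.
  - by move=> x _; rewrite lee_fin normal_pdf_ge0.
  - by rewrite lee_fin invr_ge0 ltW.
apply: eq_integral => x _; rewrite -EFinM; congr EFin.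
rewrite !normal_pdfE ?oner_eq0// /normal_fun !subr0 mulrCA -expRD [in RHS]mulrA.
have s2 : s ^+ 2 = (1 + 2 * t)^-1.
  by rewrite /s exprVn sqr_sqrtr//; lra.
congr (_ * expR _).
  rewrite /normal_peak expr1n mul1r -mulrnAr sqrtrM ?sqr_ge0// sqrtr_sqr ger0_norm.
    by rewrite invfM mulrA divff// mul1r.
  by rewrite invr_ge0 ltW.
rewrite s2 expr1n; field; by rewrite gt_eqF//; lra.
Qed.

Lemma wchisq_cons (a : R) l (A : set mR) : measurable A ->
  (wchisq (a :: l) A = \int[N]_g wchisq l [set s : mR | A ((a * g ^+ 2 + s)%R : mR)])%E.
Proof.
move=> mA.
rewrite -[in LHS](setIT A) -integral_indic// ge0_integral_wchisq_cons//.
apply: eq_integral => g _.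
have mB : measurable [set s : mR | A ((a * g ^+ 2 + s)%R : mR)].
  have : measurable_fun setT (fun s : mR => (a * g ^+ 2 + s)%R : mR).
    by apply: measurable_funD => //; exact: measurable_id.
  by move=> /(_ measurableT A mA); rewrite setTI.
rewrite -[in RHS](setIT [set s | _]) -integral_indic//.
exact/measurable_EFinP/measurable_indic.
Qed.

Definition wtail l (x : R) : \bar R := wchisq l `[x, +oo[%classic.

Lemma wtail_cons a l x : (wtail (a :: l) x = \int[N]_g wtail l (x - a * g ^+ 2)%R)%E.
Proof.
rewrite /wtail wchisq_cons//; apply: eq_integral => g _; congr (wchisq l _).
by apply/seteqP; split => s /=; rewrite !in_itv/= !andbT lerBlDl.
Qed.

Lemma wtail_nil x : wtail [::] x = (if (x <= 0)%R then 1 else 0)%E.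
Proof.
rewrite /wtail /= diracE; case: ifPn => h; first by rewrite mem_set//= in_itv/= andbT.
by rewrite memNset//= in_itv/= andbT; apply/negP.
Qed.

Lemma wtail1 b x : (wtail [:: b] x = N [set h | (x <= b * h ^+ 2)%R])%E.
Proof.
rewrite wtail_cons -[in RHS](setIT [set h | _]) -integral_indic//; last first.
  have : measurable_fun setT (fun h : mR => b * h ^+ 2 : mR).
    by apply: measurable_funM => //; apply: measurable_funX; exact: measurable_id.
  move=> /(_ measurableT `[x, +oo[%classic (measurable_itv _)); rewrite setTI.
  congr (measurable _); apply/seteqP; split => h /=; rewrite in_itv/= andbT//.
apply: eq_integral => h _; rewrite wtail_nil subr_le0 indicE.
by case: ifPn => h1; [rewrite mem_set|rewrite memNset//; apply/negP].
Qed.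

Lemma wtail_anti l (x y : R) : x <= y -> (wtail l y <= wtail l x)%E.
Proof.
move=> xy; apply: le_measure; rewrite ?inE//; try exact: measurable_itv.
by move=> s /=; rewrite !in_itv/= !andbT; apply: le_trans.
Qed.

Lemma wtail_fin l x : wtail l x \is a fin_num.
Proof. exact: fin_num_measure. Qed.

Lemma measurable_wtail l a x :
  measurable_fun setT (fun g : mR => wtail l (x - a * g ^+ 2)).
Proof.
have -> : (fun g : mR => wtail l (x - a * g ^+ 2)) =
  EFin \o ((fun y => fine (wtail l y)) \o (fun g : mR => x - a * g ^+ 2)).
  by apply/funext => g /=; rewrite fineK ?wtail_fin.
apply/measurable_EFinP; apply: measurableT_comp.
  apply: nonincreasing_measurable => // y z yz.
  by apply: fine_le; rewrite ?wtail_fin// wtail_anti.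
apply: measurable_funB => //; apply: measurable_funM => //.
Qed.

Lemma integral_sqr_normal : (\int[N]_g (g ^+ 2)%:E = 1)%E.
Proof.
rewrite normal_integral; last exact: exprn_measurable.
have ip2 : mu.-integrable setT (fun x => (x ^+ 2 * normal_pdf 0 1 x)%:E).
  apply: (integrable_pdf_le (oner_neq0 R) (A := 0) (B := 1)).
    exact: exprn_measurable.
  by move=> x; rewrite mul1r subr0 add0r ger0_norm ?sqr_ge0.
rewrite -(fineK (integrable_fin_num _ ip2))//; congr EFin.
have := normal_variance 0 (oner_neq0 R).
by under eq_Rintegral do rewrite subr0; rewrite expr1n.
Qed.

(** The entries of [s] are pairs of a weight and its increment. *)
Lemma wtail_le_weights (s : seq (R * R)) x : all (fun q => 0 <= q.2) s ->
  (wtail [seq q.1 | q <- s] x <= wtail [seq (q.1 + q.2)%R | q <- s] x)%E.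
Proof.
elim: s x => [//|[a e] s IH] x /= /andP[e0 s0].
rewrite !wtail_cons; apply: ge0_le_integral => //.
- exact: measurable_wtail.
- exact: measurable_wtail.
- move=> g _; apply: (le_trans (IH _ s0)); apply: wtail_anti.
  by rewrite lerD2l lerN2 ler_wpM2r ?sqr_ge0// lerDl.
Qed.

(** The constant of [gaussian_annulus]; [normal_peak 1] is the standard normal density
    at 0. *)
Definition annulus_const : R := 32 * normal_peak 1 ^+ 2.

Lemma annulus_const_gt0 : 0 < annulus_const.
Proof. by rewrite mulr_gt0// exprn_gt0// normal_peak_gt0// oner_eq0. Qed.

Section Comparison.
Variables a b : R.
Hypothesis a0 : 0 < a.
Hypothesis b0 : 0 < b.

Let K := annulus_const / Num.sqrt (a * b).

Let K0 : 0 <= K.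
Proof. by rewrite divr_ge0 ?sqrtr_ge0// ltW// annulus_const_gt0. Qed.

(** If the perturbed sum reaches [x - D], then either the original sum reaches [x] or
    the point lies in the annulus. *)
Lemma wtail2_perturbed (x D d0 d1 : R) : 0 <= D -> 0 <= d0 -> 0 <= d1 ->
  (wtail [:: (a + d0)%R; (b + d1)%R] (x - D)%R <= wtail [:: a; b] x + (K * (D + d0 + d1))%:E)%E.
Proof.
move=> D0 d00 d10.
pose S g : set mR := [set h | x - D - (d0 * g ^+ 2 + d1 * h ^+ 2) <=
       a * g ^+ 2 + b * h ^+ 2 < x].
pose B g : set mR := [set h | x - a * g ^+ 2 <= b * h ^+ 2].
have SE g : S g = xsection [set z : mR * mR | x - D - (d0 * z.1 ^+ 2 + d1 * z.2 ^+ 2) <=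
       a * z.1 ^+ 2 + b * z.2 ^+ 2 < x] g.
  by apply/seteqP; split => h; rewrite /xsection /= inE.
have mS g : measurable (S g).
  by rewrite SE; apply: measurable_xsection; exact: measurable_annulus.
have mNS : measurable_fun setT (fun g : mR => N (S g)).
  under eq_fun do rewrite SE.
  apply: measurable_fun_xsection; exact: measurable_annulus.
have mq (c y : R) : measurable [set h : mR | y <= c * h ^+ 2].
  have : measurable_fun setT (fun h : mR => c * h ^+ 2 : mR).
    by apply: measurable_funM => //; exact: exprn_measurable.
  move=> /(_ measurableT `[y, +oo[%classic (measurable_itv _)); rewrite setTI.
  by congr (measurable _); apply/seteqP; split => h /=; rewrite in_itv/= andbT.
rewrite !wtail_cons.
apply: (@le_trans _ _ (\int[N]_g (wtail [:: b] (x - a * g ^+ 2)%R + N (S g)))%E).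
  apply: ge0_le_integral => //.
  - exact: measurable_wtail.
  - apply: emeasurable_funD => //; exact: measurable_wtail.
  - move=> g _; rewrite !wtail1.
    apply: le_trans (measureU2 _ (mq _ _) (mS g)).
    apply: le_measure; rewrite ?inE//; first exact: measurableU.
    move=> h /= hh; have [h1|h1] := leP (x - a * g ^+ 2) (b * h ^+ 2); [left|right] => //.
    by rewrite /S /=; apply/andP; split; lra.
rewrite ge0_integralD//; last exact: measurable_wtail.
by apply: leeD => //; exact: gaussian_annulus.
Qed.

(** The weights [a] and [b] of the annulus come last, so that the other coordinates
    are integrated out by induction: given [g], an increment [e] of the first weight
    only enlarges the margin [D] to [D + e * g ^+ 2], and [g^2] has mean 1. *)
Lemma wtail_perturbed (s : seq (R * R)) (x D d0 d1 : R) :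
  0 <= D -> 0 <= d0 -> 0 <= d1 -> all (fun q => 0 <= q.2) s ->
  (wtail [seq (q.1 + q.2)%R | q <- s ++ [:: (a, d0); (b, d1)]] (x - D)%R
   <= wtail [seq q.1 | q <- s ++ [:: (a, d0); (b, d1)]] x
      + (K * (D + \sum_(q <- s ++ [:: (a, d0); (b, d1)]) q.2))%:E)%E.
Proof.
move=> + d00 d10; elim: s x D => [|[c e] s IH] x D D0 /=.
  move=> _; rewrite !big_cons big_nil/= addr0 addrA; exact: wtail2_perturbed.
move=> /andP[e0 s0]; rewrite !wtail_cons big_cons/=.
set S := \sum_(q <- _) q.2 in IH *.
have Kge g : 0 <= K * (D + e * g ^+ 2 + S).
  rewrite mulr_ge0// addr_ge0//; first by rewrite addr_ge0// mulr_ge0// sqr_ge0.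
  rewrite /S big_cat/= addr_ge0//; last by rewrite !big_cons big_nil/= addr0 addr_ge0.
  by rewrite big_seq sumr_ge0// => q qs; move/allP : s0; exact.
have mq : measurable_fun setT (fun g : mR => (K * (D + e * g ^+ 2 + S))%:E).
  apply/measurable_EFinP; apply: measurable_funM => //; apply: measurable_funD => //.
  by apply: measurable_funD => //; apply: measurable_funM => //; exact: exprn_measurable.
apply: (@le_trans _ _ (\int[N]_g (wtail [seq q.1 | q <- s ++ [:: (a, d0); (b, d1)]] (x - c * g ^+ 2)%R
    + (K * (D + e * g ^+ 2 + S))%:E))%E).
  apply: ge0_le_integral => //.
  - exact: measurable_wtail.
  - apply: emeasurable_funD => //; exact: measurable_wtail.
  - move=> g _; have De : 0 <= D + e * g ^+ 2 by rewrite addr_ge0// mulr_ge0// sqr_ge0.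
    have := IH (x - c * g ^+ 2) _ De s0; apply: le_trans.
    by rewrite le_eqVlt; apply/orP; left; apply/eqP; congr (wtail _ _); ring.
rewrite ge0_integralD//; last 2 first.
- exact: measurable_wtail.
- by move=> g _; rewrite lee_fin.
apply: leeD => //.
have -> : (\int[N]_g (K * (D + e * g ^+ 2 + S))%:E =
   \int[N]_g ((K * (D + S))%:E + (K * e)%:E * (g ^+ 2)%:E))%E.
  by apply: eq_integral => g _; rewrite -EFinM -EFinD; congr EFin; ring.
have S0 : 0 <= K * (D + S) by have := Kge 0; rewrite expr0n mulr0 addr0.
have Ke : 0 <= K * e by rewrite mulr_ge0.
have msqr : measurable_fun setT (fun g : mR => (g ^+ 2)%:E).
  by apply/measurable_EFinP; exact: exprn_measurable.
rewrite ge0_integralD//; last 2 first.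
- by move=> g _; rewrite -EFinM lee_fin; apply: mulr_ge0 => //; exact: sqr_ge0.
- exact: measurable_funeM.
rewrite integral_cst// ge0_integralZl//; last 1 first.
- by move=> g _; rewrite lee_fin sqr_ge0.
rewrite integral_sqr_normal mule1 [X in (_ * X + _)%E](_ : _ = 1%E); last first.
  exact: (probability_setT (normal_prob 0 1)).
rewrite mule1 -EFinD lee_fin.
by rewrite le_eqVlt; apply/orP; left; apply/eqP; ring.
Qed.
End Comparison.

Lemma wchisq_neg0 l : all (fun c => 0 <= c) l -> wchisq l `]-oo, 0[%classic = 0%E.
Proof.
elim: l => [_|a l IH /andP[a0 l0]].
  by rewrite /= diracE memNset//= in_itv/= ltxx.
rewrite wchisq_cons//; under eq_integral.
  move=> g _; rewrite (_ : wchisq _ _ = 0%E); last first.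
    apply/eqP; rewrite eq_le measure_ge0 andbT -(IH l0).
    have := mulr_ge0 a0 (sqr_ge0 g) => ag.
    apply: le_measure; rewrite ?inE//.
      have -> : [set s : mR | `]-oo, 0[%classic ((a * g ^+ 2 + s)%R : mR)] = `]-oo, (- (a * g ^+ 2))[%classic.
        by apply/seteqP; split => s /=; rewrite !in_itv/=; lra.
      exact: measurable_itv.
    by move=> s /=; rewrite !in_itv/=; lra.
  over.
by rewrite integral0.
Qed.

Lemma integral_exp_wchisq (l : seq R) (t : R) : 0 <= t -> all (fun c => 0 <= c) l ->
  (\int[wchisq l]_s (expR (- (t * s)))%:E =
   (\prod_(c <- l) (Num.sqrt (1 + 2 * (t * c)))^-1)%:E)%E.
Proof.
move=> t0; have mexp : measurable_fun setT (fun s : mR => (expR (- (t * s)))%:E).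
  apply/measurable_EFinP; apply: continuous_measurable_fun => x.
  apply: (continuous_comp (f := fun x : R => - (t * x))); last exact: continuous_expR.
  by apply: (@cvgN _ R); apply: cvgMr; exact: cvg_id.
elim: l => [_|a l IH /andP[a0 l0]].
  by rewrite big_nil integral_dirac// diracT mul1e mulr0 oppr0 expR0.
rewrite ge0_integral_wchisq_cons//.
under eq_integral.
  move=> g _; under eq_integral do rewrite mulrDr opprD expRD EFinM.
  rewrite ge0_integralZl// IH// -EFinM mulrC EFinM mulrA; over.
rewrite ge0_integralZl//; last 2 first.
- by apply/measurable_EFinP; exact: measurable_exp_sqr.
- by rewrite lee_fin; apply: prodr_ge0 => c _; rewrite invr_ge0.
by rewrite integral_exp_sqr ?mulr_ge0// -EFinM big_cons mulrC.
Qed.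

End WeightedChiSquare.

(** * Laplace transforms determine tails *)

Section LaplaceTail.
Variable R : realType.
Local Notation mR := (measurableTypeR R).
Local Notation D := (`[0%R, +oo[%classic : set mR).

Let mD : measurable D. Proof. exact: measurable_itv. Qed.

Let mexp (t : R) : measurable_fun setT (fun s : mR => (expR (- (t * s)))%:E).
Proof.
apply/measurable_EFinP; apply: continuous_measurable_fun => x.
apply: (continuous_comp (f := fun x : R => - (t * x))); last exact: continuous_expR.
by apply: (@cvgN _ R); apply: cvgMr; exact: cvg_id.
Qed.

(** As [k] grows this tends to the indicator of [x < s], except at [s = x]; for fixed
    [k] it is a power series in [exp (- k s)], whose integral is therefore determined
    by the Laplace transform. *)
Definition gumbel (k : nat) (x s : R) : R := expR (- expR (- (k%:R * (s - x)))).

Let natmul_cvgy (c : R) : 0 < c -> k%:R * c @[k --> \oo] --> +oo.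
Proof.
move=> c0; apply/cvgryPge => A; near=> k.
rewrite -ler_pdivrMr//; near: k; exact: nbhs_infty_ger.
Unshelve. all: by end_near. Qed.

Section OneMeasure.
Variable nu : probability mR R.

Let intc (c : R) : nu.-integrable D (fun=> c%:E).
Proof. exact: finite_measure_integrable_cst. Qed.

Let int_exp (t : R) : 0 <= t -> nu.-integrable D (fun s => (expR (- (t * s)))%:E).
Proof.
move=> t0; apply: (@le_integrable _ _ _ nu D mD _ (fun=> 1%:E)) => //.
- by apply: measurable_funTS; exact: mexp.
- move=> s /=; rewrite in_itv/= andbT => s0.
  by rewrite lee_fin normr1 ger0_norm ?expR_ge0// -expR0 ler_expR oppr_le0 mulr_ge0.
Qed.

(** On [s >= 0] the partial sums of the exponential series are dominated by the
    constant [exp (exp (k x))]. *)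
Lemma cvg_integral_gumbel_series (k : nat) (x : R) :
  (\sum_(0 <= j < n) ((- expR (k%:R * x)) ^+ j / j`!%:R)%:E *
     \int[nu]_(s in D) (expR (- ((j * k)%:R * s)))%:E)%E @[n --> \oo]
  --> (\int[nu]_(s in D) (gumbel k x s)%:E)%E.
Proof.
pose u (n : nat) (s : mR) : \bar R :=
  (\sum_(0 <= j < n) ((- expR (k%:R * x)) ^+ j / j`!%:R)%:E * (expR (- ((j * k)%:R * s)))%:E)%E.
have iterm j : nu.-integrable D (fun s => ((- expR (k%:R * x)) ^+ j / j`!%:R)%:E * (expR (- ((j * k)%:R * s)))%:E)%E.
  by apply: integrableZl => //; exact: int_exp.
rewrite (_ : (fun n => _) = (fun n => \int[nu]_(s in D) u n s)%E); last first.
  apply/funext => n; rewrite /u integral_sum//; apply: eq_bigr => j _.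
  by rewrite integralZl//; exact: int_exp.
have uE n s : u n s = (series (exp_coeff (- expR (- (k%:R * (s - x))))) n)%:E.
  rewrite /u /series /= -sumEFin; apply: eq_bigr => j _.
  rewrite -EFinM /exp_coeff /=; congr EFin.
  rewrite mulrAC; congr (_ / _).
  rewrite exprNn [in RHS]exprNn -mulrA; congr (_ * _).
  rewrite -!expRM_natl -expRD; congr expR.
  by rewrite natrM; ring.
apply: (@dominated_cvg _ _ _ nu D mD _ _ (fun=> (expR (expR (k%:R * x)))%:E)).
- move=> n; apply: measurable_int; rewrite /u; apply: integrable_sum => //.
- move=> s _; under eq_fun do rewrite uE.
  apply/cvg_EFin; first exact: nearW.
  exact: is_cvg_series_exp_coeff.
- by [].
- exact: intc.
- move=> n s /=; rewrite in_itv/= andbT => s0.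
  rewrite uE lee_fin.
  apply: (@le_trans _ _ (series (exp_coeff `|- expR (- (k%:R * (s - x)))|) n)).
    rewrite -normed_series_exp_coeff /series /=; exact: ler_norm_sum.
  rewrite normrN ger0_norm ?expR_ge0//.
  apply: (@le_trans _ _ (expR (expR (- (k%:R * (s - x)))))).
    apply: nondecreasing_cvgn_le; last exact: is_cvg_series_exp_coeff.
    apply: nondecreasing_series => j _ _; exact: exp_coeff_ge0 (expR_ge0 _).
  by rewrite !ler_expR mulrBr opprB gerBl mulr_ge0.
Qed.

(** The pointwise limit; the value [exp (- 1)] at the atom [s = x] is harmless because
    it lies between 0 and 1. *)
Let limg (x s : R) : R := if s < x then 0 else if x < s then 1 else expR (- 1).

Lemma cvg_integral_gumbel (x : R) :
  (\int[nu]_(s in D) (gumbel k x s)%:E)%E @[k --> \oo] --> (\int[nu]_(s in D) (limg x s)%:E)%E.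
Proof.
have mgum k : measurable_fun D (fun s => (gumbel k x s)%:E).
  apply: measurable_funTS; apply/measurable_EFinP; apply: continuous_measurable_fun => s.
  apply: (continuous_comp (f := fun s : R => - expR (- (k%:R * (s - x))))); last exact: continuous_expR.
  apply: (@cvgN _ R).
  apply: (continuous_comp (f := fun s : R => - (k%:R * (s - x)))); last exact: continuous_expR.
  apply: (@cvgN _ R); apply: cvgMr; apply: cvgB; [exact: cvg_id|exact: cvg_cst].
apply: (@dominated_cvg _ _ _ nu D mD _ _ (fun=> 1%:E)) => //.
- move=> s _; apply/cvg_EFin; first exact: nearW.
  rewrite /= /limg /gumbel; case: ltgtP => [sx|xs|->]; last first.
  + by rewrite subrr; under eq_fun do rewrite mulr0 oppr0 expR0; exact: cvg_cst.
  + have h2 : k%:R * (s - x) @[k --> \oo] --> +oo.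
      by apply: natmul_cvgy; rewrite subr_gt0.
    have h1 : expR (- (k%:R * (s - x))) @[k --> \oo] --> 0.
      exact: (cvg_comp _ _ h2 (@cvgr_expR R)).
    rewrite -[X in _ --> X](expR0 R) -[X in _ --> expR X](oppr0 R).
    apply: continuous_cvg; first exact: continuous_expR.
    exact: cvgN.
  + have h1 : expR (k%:R * (x - s)) @[k --> \oo] --> +oo.
      have h2 : k%:R * (x - s) @[k --> \oo] --> +oo.
        by apply: natmul_cvgy; rewrite subr_gt0.
      apply/cvgryPge => A; move/cvgryPge : h2 => /(_ A); apply: filterS => k kA.
      by apply: (le_trans kA); apply: le_trans (expR_ge1Dx _); rewrite lerDr.
    under eq_fun do rewrite -mulrN opprB.
    exact: (cvg_comp _ _ h1 (@cvgr_expR R)).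
- move=> n s _; rewrite lee_fin /gumbel ger0_norm ?expR_ge0//.
Qed.

Let mlimg x : measurable_fun D (fun s => (limg x s)%:E).
Proof.
apply: measurable_funTS; apply/measurable_EFinP; apply: nondecreasing_measurable => // s t st.
have e1 : expR (- 1) <= 1 :> R by rewrite -[leRHS]expR0 ler_expR; lra.
have e0 := expR_ge0 (- 1 : R).
by rewrite /limg; case: (ltgtP s x) => sx; case: (ltgtP t x) => tx; lra.
Qed.

Let limg_ge0 x s : (0 <= (limg x s)%:E)%E.
Proof. by rewrite lee_fin /limg; case: ltgtP => // _; rewrite expR_ge0. Qed.

Lemma integral_limg_lb x : 0 <= x ->
  (nu `]x, +oo[%classic <= \int[nu]_(s in D) (limg x s)%:E)%E.
Proof.
move=> x0; have -> : nu `]x, +oo[%classic = (\int[nu]_(s in D) (\1_(`]x, +oo[%classic : set mR) s)%:E)%E.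
  rewrite integral_indic//; congr (nu _); apply/seteqP; split => s /=; rewrite !in_itv/= !andbT; last by case.
  by move=> xs; split => //; rewrite ltW// (le_lt_trans x0).
apply: ge0_le_integral => //.
- by apply/measurable_EFinP; exact: measurable_indic.
- move=> s _; rewrite lee_fin indicE; case: (boolP (s \in _)) => [|_].
    by rewrite inE /= in_itv/= andbT /limg => xs; rewrite xs ltNge (ltW xs).
  exact: limg_ge0.
Qed.

Lemma integral_limg_ub x : 0 <= x ->
  (\int[nu]_(s in D) (limg x s)%:E <= nu `[x, +oo[%classic)%E.
Proof.
move=> x0; have -> : nu `[x, +oo[%classic = (\int[nu]_(s in D) (\1_(`[x, +oo[%classic : set mR) s)%:E)%E.
  rewrite integral_indic//; congr (nu _); apply/seteqP; split => s /=; rewrite !in_itv/= !andbT; last by case.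
  by move=> xs; split => //; exact: le_trans xs.
apply: ge0_le_integral => //.
- by apply/measurable_EFinP; exact: measurable_indic.
- move=> s _; rewrite lee_fin indicE; case: (boolP (s \in _)) => [_|].
    by rewrite /limg; case: ltgtP => // _; rewrite -[leRHS]expR0 ler_expR; lra.
  rewrite notin_setE /= in_itv/= andbT => /negP; rewrite -ltNge => sx.
  by rewrite /limg sx.
Qed.

Lemma integral_exp_nonneg t : nu `]-oo, 0[%classic = 0%E ->
  (\int[nu]_s (expR (- (t * s)))%:E = \int[nu]_(s in D) (expR (- (t * s)))%:E)%E.
Proof.
move=> nu0; rewrite (@ge0_negligible_integral _ _ _ nu setT `]-oo, 0[%classic)//.
congr (integral _ _ _); apply/seteqP; split => s /=; rewrite !in_itv/= andbT.
  by move=> [_ /negP]; rewrite -leNgt.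
by move=> s0; split => //; apply/negP; rewrite -leNgt.
Qed.

End OneMeasure.

(** The half-open and open tails on the two sides leave room for the value of the
    limit function at [x], so that no statement about atoms is needed. *)
Lemma laplace_tail_le (nu1 nu2 : probability mR R) :
  nu1 `]-oo, 0[%classic = 0%E -> nu2 `]-oo, 0[%classic = 0%E ->
  (forall t : R, (0 <= t)%R -> \int[nu1]_s (expR (- (t * s)))%:E = \int[nu2]_s (expR (- (t * s)))%:E)%E ->
  forall x : R, (nu1 `]x, +oo[%classic <= nu2 `[x, +oo[%classic)%E.
Proof.
move=> n1 n2 lap x; have [x0|x0] := leP 0 x; last first.
  apply: (@le_trans _ _ 1%E); first exact: probability_le1.
  have <- : nu2 (~` `]-oo, 0[%classic) = 1%E.
    by rewrite probability_setC// n2 sube0.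
  apply: le_measure; rewrite ?inE//; first by apply: measurableC.
  by move=> s /=; rewrite !in_itv/= andbT => /negP; rewrite -leNgt; apply: le_trans; exact: ltW.
apply: (le_trans (integral_limg_lb nu1 x0)); apply: le_trans (integral_limg_ub nu2 x0).
rewrite le_eqVlt; apply/orP; left; apply/eqP.
have c1 := @cvg_integral_gumbel nu1 x; have c2 := @cvg_integral_gumbel nu2 x.
have /funext E : (fun k => \int[nu1]_(s in D) (gumbel k x s)%:E)%E =1
    (fun k => \int[nu2]_(s in D) (gumbel k x s)%:E)%E.
  move=> k; have s1 := @cvg_integral_gumbel_series nu1 k x.
  have s2 := @cvg_integral_gumbel_series nu2 k x.
  have /funext F : (fun n => (\sum_(0 <= j < n) ((- expR (k%:R * x)) ^+ j / j`!%:R)%:E *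
     \int[nu1]_(s in D) (expR (- ((j * k)%:R * s)))%:E)%E) =1 (fun n =>
     (\sum_(0 <= j < n) ((- expR (k%:R * x)) ^+ j / j`!%:R)%:E *
     \int[nu2]_(s in D) (expR (- ((j * k)%:R * s)))%:E)%E).
    move=> n; apply: eq_bigr => j _; congr (_ * _)%E.
    by rewrite -!integral_exp_nonneg// lap.
  by rewrite F in s1; exact: (cvg_unique _ s1 s2).
by rewrite E in c1; exact: (cvg_unique _ c1 c2).
Qed.

End LaplaceTail.

(** * Hilbert spaces and orthogonal systems *)

Section Hilbert.
Variables (R : realType) (H : completeNormedModType R).
Variable dot : {dot H for idfun}.
Hypothesis hilbertH : hilbert_norm dot.

Lemma dotC x y : dot x y = dot y x.
Proof. by have := hermC dot x y; rewrite expr0 mul1r. Qed.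

Lemma dotDl x y z : dot (x + y) z = dot x z + dot y z.
Proof. exact: linearDl. Qed.

Lemma dotZl a x y : dot (a *: x) y = a * dot x y.
Proof. exact: linearZl_LR. Qed.

Lemma dotNl x y : dot (- x) y = - dot x y.
Proof. by rewrite -scaleN1r dotZl mulN1r. Qed.

Lemma dotBl x y z : dot (x - y) z = dot x z - dot y z.
Proof. by rewrite dotDl dotNl. Qed.

Lemma dotDr x y z : dot z (x + y) = dot z x + dot z y.
Proof. by rewrite dotC dotDl !(dotC z). Qed.

Lemma dotZr a x y : dot y (a *: x) = a * dot y x.
Proof. by rewrite dotC dotZl (dotC y). Qed.

Lemma dotBr x y z : dot z (x - y) = dot z x - dot z y.
Proof. by rewrite dotC dotBl !(dotC z). Qed.

Lemma dot0l y : dot 0 y = 0.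
Proof. by rewrite -(scale0r 0) dotZl mul0r. Qed.

Lemma dot0r y : dot y 0 = 0.
Proof. by rewrite dotC dot0l. Qed.

Lemma dot_suml I (r : seq I) (P : pred I) (f : I -> H) y :
  dot (\sum_(i <- r | P i) f i) y = \sum_(i <- r | P i) dot (f i) y.
Proof.
apply: (big_morph (fun x => dot x y)) => [x1 x2|]; first exact: dotDl.
exact: dot0l.
Qed.

Lemma dot_ge0 x : 0 <= dot x x.
Proof. by rewrite hilbertH sqr_ge0. Qed.

Lemma dot_eq0 x : dot x x = 0 -> x = 0.
Proof. by rewrite hilbertH => /eqP; rewrite sqrf_eq0 normr_eq0 => /eqP. Qed.

Lemma dot_cauchy x y : `|dot x y| <= `|x| * `|y|.
Proof.
rewrite -(@ler_pXn2r _ 2) ?nnegrE ?mulr_ge0// exprMn real_normK ?num_real//.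
rewrite -!hilbertH.
have [y0|y0] := eqVneq (dot y y) 0.
  by rewrite (dot_eq0 y0) dot0r expr0n/= mulr_ge0 ?dot_ge0.
have yy : 0 < dot y y by rewrite lt_def y0 dot_ge0.
have := dot_ge0 (x - (dot x y / dot y y) *: y).
rewrite dotBl !dotBr !dotZl !dotZr (dotC y x).
rewrite [X in 0 <= X](_ : _ = dot x x - dot x y ^+ 2 / dot y y); last by field.
by rewrite subr_ge0 ler_pdivrMr.
Qed.

Lemma dot_continuous y : continuous (fun x => dot x y).
Proof.
move=> x; apply/cvgrPdist_le => e e0.
near=> z; rewrite -dotBl; apply: (le_trans (dot_cauchy _ _)).
apply: (@le_trans _ _ (`|x - z| * (`|y| + 1))); first by rewrite ler_wpM2l// lerDl.
rewrite -ler_pdivlMr ?ltr_wpDl//.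
near: z; apply: cvgr_dist_le => //; rewrite divr_gt0// ltr_wpDl//.
Unshelve. all: by end_near. Qed.

(** Vanishing vectors are allowed, so that Gram-Schmidt on linearly dependent vectors,
    and finite-dimensional spaces, need no separate treatment. *)
Definition orthosys (b : nat -> H) : Prop :=
  (forall i j, i != j -> dot (b i) (b j) = 0) /\
  (forall i, dot (b i) (b i) = 1 \/ b i = 0).

Section OrthoSystem.
Variable b : nat -> H.
Hypothesis ob : orthosys b.

Definition proj n x : H := \sum_(i < n) dot x (b i) *: b i.

Lemma dot_proj_b n x i : (i < n)%N -> dot (proj n x) (b i) = dot x (b i).
Proof.
move=> ni; rewrite /proj dot_suml (bigD1 (Ordinal ni))//= dotZl.
rewrite big1 ?addr0; last first.
  move=> j ji; rewrite dotZl (ob.1) ?mulr0//.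
have [->|->] := ob.2 i; first by rewrite mulr1.
by rewrite !dot0r mulr0.
Qed.

Lemma dot_proj_ge n x i : (n <= i)%N -> dot (proj n x) (b i) = 0.
Proof.
move=> ni; rewrite /proj dot_suml big1// => j _.
by rewrite dotZl ob.1 ?mulr0// neq_ltn (leq_trans (ltn_ord j) ni).
Qed.

Lemma dot_proj n x y : dot (proj n x) y = \sum_(i < n) dot x (b i) * dot y (b i).
Proof.
by rewrite /proj dot_suml; apply: eq_bigr => i _; rewrite dotZl (dotC y).
Qed.

Lemma dot_projC n x y : dot (proj n x) y = dot x (proj n y).
Proof.
by rewrite (dotC x) !dot_proj; apply: eq_bigr => i _; rewrite mulrC.
Qed.

Lemma proj_idem n x : proj n (proj n x) = proj n x.
Proof. by apply: eq_bigr => i _; rewrite dot_proj_b. Qed.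

Lemma dot_proj_resid n x i : (i < n)%N -> dot (x - proj n x) (b i) = 0.
Proof. by move=> ni; rewrite dotBl dot_proj_b// subrr. Qed.

Lemma sqr_norm_proj n x : `|proj n x| ^+ 2 = \sum_(i < n) dot x (b i) ^+ 2.
Proof.
by rewrite -hilbertH -dot_projC proj_idem dot_proj; apply: eq_bigr => i _; rewrite expr2.
Qed.

Lemma sqr_norm_resid n x : `|x - proj n x| ^+ 2 = `|x| ^+ 2 - \sum_(i < n) dot x (b i) ^+ 2.
Proof.
rewrite -sqr_norm_proj -!hilbertH dotBl !dotBr (dotC x).
by rewrite -dot_projC proj_idem (dotC _ x) -dot_projC; ring.
Qed.

Lemma bessel n x : \sum_(i < n) dot x (b i) ^+ 2 <= `|x| ^+ 2.
Proof. by rewrite -subr_ge0 -sqr_norm_resid sqr_ge0. Qed.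

Lemma norm_proj_le n x : `|proj n x| <= `|x|.
Proof. by rewrite -(@ler_pXn2r _ 2) ?nnegrE// sqr_norm_proj bessel. Qed.

Lemma norm_resid_le n x : `|x - proj n x| <= `|x|.
Proof.
rewrite -(@ler_pXn2r _ 2) ?nnegrE// sqr_norm_resid gerBl sumr_ge0// => i _.
exact: sqr_ge0.
Qed.

Lemma projB n x y : proj n (x - y) = proj n x - proj n y.
Proof.
by rewrite /proj -sumrB; apply: eq_bigr => i _; rewrite dotBl scalerBl.
Qed.

End OrthoSystem.

End Hilbert.

(** * Compact symmetric forms *)

Section CompactForms.
Variables (R : realType) (H : completeNormedModType R).
Variable dot : {dot H for idfun}.
Hypothesis hilbertH : hilbert_norm dot.

Definition symform (B : H -> H -> R) : Prop :=
  (forall x y, B x y = B y x) /\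
  (forall a x y z, B (a *: x + y) z = a * B x z + B y z).

(** Compactness of a bounded form in coordinates: it is uniformly small against the
    vectors orthogonal to the first [N] vectors of [b]. *)
Definition cptform (b : nat -> H) (B : H -> H -> R) : Prop :=
  (exists M : R, forall x y, `|B x y| <= M * (`|x| * `|y|)) /\
  (forall e : R, 0 < e -> exists N : nat, forall x y,
     (forall i, (i < N)%N -> dot y (b i) = 0) -> `|B x y| <= e * (`|x| * `|y|)).

Section SymForm.
Variable B : H -> H -> R.
Hypothesis sB : symform B.

Lemma sformDl x y z : B (x + y) z = B x z + B y z.
Proof. by have := sB.2 1 x y z; rewrite scale1r mul1r. Qed.

Lemma sform0l z : B 0 z = 0.
Proof. by have /eqP := sformDl 0 0 z; rewrite addr0 -subr_eq0 opprD addNKr oppr_eq0 => /eqP. Qed.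

Lemma sformZl a x z : B (a *: x) z = a * B x z.
Proof. by have := sB.2 a x 0 z; rewrite addr0 sform0l addr0. Qed.

Lemma sformBl x y z : B (x - y) z = B x z - B y z.
Proof. by rewrite sformDl -scaleN1r sformZl mulN1r. Qed.

Lemma sformDr x y z : B z (x + y) = B z x + B z y.
Proof. by rewrite sB.1 sformDl !(sB.1 z). Qed.

Lemma sformZr a x z : B z (a *: x) = a * B z x.
Proof. by rewrite sB.1 sformZl (sB.1 z). Qed.

Lemma sformBr x y z : B z (x - y) = B z x - B z y.
Proof. by rewrite sB.1 sformBl !(sB.1 z). Qed.

Lemma sform_suml I (r : seq I) (P : pred I) (f : I -> H) y :
  B (\sum_(i <- r | P i) f i) y = \sum_(i <- r | P i) B (f i) y.
Proof.
apply: (big_morph (fun x => B x y)) => [x1 x2|]; first exact: sformDl.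
exact: sform0l.
Qed.

Lemma sform_sumr I (r : seq I) (P : pred I) (f : I -> H) y :
  B y (\sum_(i <- r | P i) f i) = \sum_(i <- r | P i) B y (f i).
Proof. by rewrite sB.1 sform_suml; apply: eq_bigr => i _; rewrite sB.1. Qed.

(** First order condition: a maximizer of the Rayleigh quotient is an eigenvector. *)
Lemma sform_maximizer (f : H) (m : R) : (forall x, B x x <= m * `|x| ^+ 2) ->
  B f f = m * `|f| ^+ 2 -> forall y, B f y = m * dot f y.
Proof.
move=> Bm Bf y; apply/eqP; rewrite -subr_eq0; apply/eqP.
apply: (@quadratic_domination_eq0 R _ (m * `|y| ^+ 2 - B y y)) => t.
have := Bm (f + t *: y).
rewrite -hilbertH !(sformDl, sformDr, sformZl, sformZr) !(dotDl, dotDr, dotZl, dotZr).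
rewrite Bf (sB.1 y) -!hilbertH (dotC dot y f).
set a := dot f f; set c := B f y; set e := dot f y; set g := B y y; set h := dot y y.
move=> Hh; nra.
Qed.

End SymForm.

Section Attained.
Variable b : nat -> H.
Hypothesis ob : orthosys dot b.
Variable B : H -> H -> R.
Hypothesis sB : symform B.
Hypothesis cB : cptform b B.

Local Notation P := (proj dot b).

Lemma form_proj_approx (e : R) : 0 < e -> exists N : nat, forall n x, (N <= n)%N ->
  `|x| <= 1 -> `|B x x - B (P n x) (P n x)| <= e.
Proof.
move=> e0; have [N HN] := cB.2 (e / 2) (divr_gt0 e0 (ltr0Sn _ 1)).
exists N => n x Nn x1.
have xr : `|x - P n x| <= 1 by apply: le_trans (norm_resid_le hilbertH ob n x) x1.
have xp : `|P n x| <= 1 by apply: le_trans (norm_proj_le hilbertH ob n x) x1.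
have r0 i : (i < N)%N -> dot (x - P n x) (b i) = 0.
  by move=> iN; apply: dot_proj_resid => //; exact: leq_trans Nn.
have -> : B x x - B (P n x) (P n x) = B x (x - P n x) + B (P n x) (x - P n x).
  by rewrite !sformBr// (sB.1 (P n x) x); ring.
rewrite (splitr e); apply: (le_trans (ler_normD _ _)); apply: lerD.
  apply: (le_trans (HN x _ r0)); rewrite ler_piMr ?divr_ge0 ?(ltW e0)//.
  by rewrite mulr_ile1.
apply: (le_trans (HN (P n x) _ r0)); rewrite ler_piMr ?divr_ge0 ?(ltW e0)//.
by rewrite mulr_ile1.
Qed.

(** Weak compactness of the unit ball: the coordinate sequences lie in a product of
    segments, which is compact by Tychonoff's theorem. The limit is taken along a
    filter finer than the sequence instead of a subsequence. *)
Lemma weak_cluster (x : nat -> H) : (forall n, `|x n| <= 1) ->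
  exists c : nat -> R, exists G : set_system (nat -> R),
   [/\ ProperFilter G, (forall i, f i @[f --> G] --> c i) &
    (fun n i => dot (x n) (b i)) @ \oo `<=` G].
Proof.
move=> x1; pose u n : nat -> R := fun i => dot (x n) (b i).
have b1 i : `|b i| <= 1.
  rewrite -(@ler_pXn2r _ 2) ?nnegrE// -hilbertH expr1n.
  by case: (ob.2 i) => [->//|->]; rewrite dot0l.
have cA : compact [set f : prod_topology (fun _ : nat => R : topologicalType) | forall i, `[-1, 1]%classic (f i)].
  by apply: (@tychonoff nat (fun=> R : topologicalType) (fun=> `[-1, 1]%classic)) => i; exact: segment_compact.
have FA : (u @ \oo) [set f | forall i, `[-1, 1]%classic (f i)].
  exists 0%N => // n _ i /=; rewrite in_itv/= -ler_norml.
  by apply: (le_trans (dot_cauchy hilbertH _ _)); rewrite mulr_ile1.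
have [c [_]] := cA (u @ \oo) _ FA.
rewrite cluster_cvgE => -[G PG [Gc uG]].
exists c, G; split => // i.
exact: (cvg_comp _ _ Gc (@proj_continuous nat (fun=> R : topologicalType) i c)).
Qed.

(** The limit coordinates [c] are square summable and define a vector [f]. Along the
    filter the form converges on every finite section, and by compactness the form is
    uniformly close to its value on large sections. *)
Lemma weak_limit (x : nat -> H) (m : R) : (forall n, `|x n| <= 1) ->
  (forall n, m - n.+1%:R^-1 < B (x n) (x n)) ->
  exists2 f : H, `|f| <= 1 & m <= B f f.
Proof.
move=> x1 xm; have [c [G [PG Gc uG]]] := weak_cluster x1.
pose p n : H := \sum_(i < n) c i *: b i.
pose q n (f : nat -> R) : R := \sum_(i < n) \sum_(j < n) f i * f j * B (b i) (b j).
have qp n : B (p n) (p n) = q n c.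
  rewrite /p sform_suml//; apply: eq_bigr => i _; rewrite sform_sumr//; apply: eq_bigr => j _.
  by rewrite sformZl// sformZr// mulrA.
have qP n k : B (P n (x k)) (P n (x k)) = q n (fun i => dot (x k) (b i)).
  rewrite /proj sform_suml//; apply: eq_bigr => i _; rewrite sform_sumr//; apply: eq_bigr => j _.
  by rewrite sformZl// sformZr// mulrA.
have qc n : q n f @[f --> G] --> q n c.
  apply: (cvg_big (@add_continuous R)) => i _; apply: (cvg_big (@add_continuous R)) => j _.
  exact: (cvgM (cvgM (Gc i) (Gc j)) (cvg_cst _)).
have sc n : \sum_(i < n) c i ^+ 2 <= 1.
  have cv : \sum_(i < n) f i ^+ 2 @[f --> G] --> \sum_(i < n) c i ^+ 2.
    by apply: (cvg_big (@add_continuous R)) => i _; exact: (cvgM (Gc i) (Gc i)).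
  apply: (cvgr_to_le cv).
  apply: uG; exists 0%N => // k _ /=.
  apply: (le_trans (bessel hilbertH ob n (x k))).
  by rewrite expr_le1.
have pn k n : (k <= n)%N -> `|p n - p k| ^+ 2 <= \sum_(i < n) c i ^+ 2 - \sum_(i < k) c i ^+ 2.
  move=> kn; rewrite -hilbertH.
  have splitsum (V : zmodType) (g : nat -> V) :
      \sum_(i < n) g i - \sum_(i < k) g i = \sum_(k <= i < n) g i.
    rewrite -!(big_mkord xpredT g) (big_cat_nat (n := k))//=.
    by rewrite addrAC subrr add0r.
  rewrite /p (splitsum _ (fun i => c i *: b i)) (splitsum _ (fun i => c i ^+ 2)).
  rewrite dot_suml; rewrite [leLHS]big_nat [leRHS]big_nat; apply: ler_sum => i /andP[ki iN].
  rewrite dotZl dotC dot_suml (bigD1_seq i) ?mem_index_iota ?iota_uniq ?ki//=.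
  rewrite big1_seq ?addr0; last first.
    by move=> j /andP[ji _]; rewrite dotZl ob.1 ?mulr0// .
  rewrite dotZl mulrA -expr2 ler_piMr ?sqr_ge0//.
  by case: (ob.2 i) => [->//|->]; rewrite dot0l.
have scv : cvgn (fun n => \sum_(i < n) c i ^+ 2).
  apply: nondecreasing_is_cvgn.
    by apply/nondecreasing_seqP => n; rewrite big_ord_recr/= lerDl sqr_ge0.
  by exists 1 => _ [n _ <-].
pose L := limn (fun n => \sum_(i < n) c i ^+ 2).
have sL n : \sum_(i < n) c i ^+ 2 <= L.
  apply: (nondecreasing_cvgn_le _ scv n).
  by apply/nondecreasing_seqP => k; rewrite big_ord_recr/= lerDl sqr_ge0.
have pcv : cvgn p.
  apply/cauchy_cvgP/cauchyP => e e0.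
  have : \forall n \near \oo, `|L - \sum_(i < n) c i ^+ 2| < e ^+ 2.
    by move/cvgrPdist_lt : scv; apply; rewrite exprn_gt0.
  move=> [N _ HN]; exists (p N); exists N => // n /= Nn.
  rewrite -ball_normE /= distrC -(@ltr_pXn2r _ 2) ?nnegrE ?(ltW e0)//.
  apply: (le_lt_trans (pn _ _ Nn)); have := HN N (leqnn N); rewrite ger0_norm ?subr_ge0//.
  by have := sL n; lra.
have pn1 n : `|p n| <= 1.
  have := pn 0%N n (leq0n n); rewrite {2}/p !big_ord0 !subr0 => h.
  by rewrite -(@ler_pXn2r _ 2) ?nnegrE// expr1n (le_trans h).
pose f := limn p.
have f1 : `|f| <= 1.
  by apply: (cvgr_to_le (cvg_norm pcv)); exact: nearW.
exists f => //.
suff key (e : R) : 0 < e -> m - e <= B f f.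
  by apply/ler_addgt0Pr => e e0; rewrite -lerBlDr; exact: key.
move=> e0.
have [N HN] := form_proj_approx (divr_gt0 e0 (ltr0Sn _ 1)).
have qN n : (N <= n)%N -> m - e <= B (p n) (p n).
  move=> Nn; rewrite qp.
  apply: (cvgr_to_ge (qc n)).
  apply: uG.
  have [k0 k0P] : exists k0, forall k, (k0 <= k)%N -> (k.+1%:R^-1 : R) <= e / 2.
    exists (Num.truncn (2 / e)) => k hk.
    rewrite -[leRHS]invrK lef_pV2 ?posrE ?invr_gt0 ?divr_gt0// invfM invrK mulrC.
    apply: (le_trans (ltW (truncnS_gt _))); by rewrite ler_nat.
  exists k0 => // k hk /=; rewrite -qP.
  have := HN n (x k) Nn (x1 k); rewrite ler_norml => /andP[_ h1].
  by have := xm k; have := k0P k hk; move: (k.+1%:R^-1 : R) => z; lra.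
have cvB : B (p n) (p n) @[n --> \oo] --> B f f.
  have [[M HM] _] := cB.
  have M0 : 0 <= `|M| by [].
  have HM' u v : `|B u v| <= `|M| * (`|u| * `|v|).
    by apply: (le_trans (HM u v)); rewrite ler_wpM2r ?mulr_ge0// ler_norm.
  apply/cvgrPdist_le => e' e'0; near=> n.
  have -> : B f f - B (p n) (p n) = B f (f - p n) + B (p n) (f - p n).
    by rewrite !sformBr// (sB.1 (p n) f); ring.
  apply: (@le_trans _ _ (2 * `|M| * `|f - p n|)).
    apply: (le_trans (ler_normD _ _)).
    have h1 := HM' f (f - p n); have h2 := HM' (p n) (f - p n).
    have pd : 0 <= `|f - p n| by [].
    have g1 : `|f| * `|f - p n| <= `|f - p n| by rewrite ler_piMl.
    have g2 : `|p n| * `|f - p n| <= `|f - p n| by rewrite ler_piMl.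
    have k1 := ler_wpM2l M0 g1; have k2 := ler_wpM2l M0 g2; lra.
  apply: (@le_trans _ _ ((2 * `|M| + 1) * `|f - p n|)).
    by rewrite ler_wpM2r// lerDl.
  rewrite -ler_pdivlMl ?ltr_wpDl ?mulr_ge0//.
  near: n; move/cvgrPdist_le : (pcv : p n @[n --> \oo] --> f); apply.
  by rewrite mulr_gt0// invr_gt0 ltr_wpDl// mulr_ge0.
apply: (cvgr_to_ge cvB).
by exists N => // n; exact: qN.
Unshelve. all: by end_near. Qed.

(** A weak limit of a maximizing sequence is a maximizer, and it has norm 1 because
    the supremum is positive. *)
Lemma form_sup_attained x0 : 0 < B x0 x0 -> exists f m,
  [/\ `|f| = 1, 0 < m, (forall x, B x x <= m * `|x| ^+ 2) & forall y, B f y = m * dot f y].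
Proof.
move=> B0; have [[M HM] _] := cB.
pose S := [set B x x | x in [set x | `|x| <= 1]].
have S0 : S !=set0 by exists (B 0 0), 0 => //=; rewrite normr0.
have hS : has_sup S.
  split => //; exists `|M| => _ [x /= x1 <-].
  apply: (le_trans (ler_norm _)); apply: (le_trans (HM x x)).
  apply: (@le_trans _ _ (`|M| * (`|x| * `|x|))).
    by rewrite ler_wpM2r ?mulr_ge0// ler_norm.
  by rewrite ler_piMr// mulr_ile1.
pose m := sup S.
have Sm x : B x x <= m * `|x| ^+ 2.
  have [->|xn0] := eqVneq x 0; first by rewrite sform0l// normr0 expr0n mulr0.
  have x0' : 0 < `|x| by rewrite normr_gt0.
  have : B (`|x|^-1 *: x) (`|x|^-1 *: x) <= m.
    apply: sup_ubound => //; first by case: hS.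
    by exists (`|x|^-1 *: x) => //=; rewrite normrZ normrV ?unitfE ?gt_eqF// normr_id mulVf// gt_eqF.
  rewrite sformZl// sformZr// mulrA -expr2 exprVn ler_pdivrMl ?exprn_gt0//.
  by rewrite mulrC.
have m0 : 0 < m.
  have x00 : 0 < `|x0| ^+ 2.
    rewrite exprn_gt0// normr_gt0; apply/eqP => x00.
    by move: B0; rewrite x00 sform0l// ltxx.
  by have := lt_le_trans B0 (Sm x0); rewrite pmulr_lgt0.
have ex n : exists x, `|x| <= 1 /\ m - n.+1%:R^-1 < B x x.
  have n0 : 0 < (n.+1%:R^-1 : R) by rewrite invr_gt0.
  by have [_ [x x1 <-] mx] := sup_adherent n0 hS; exists x.
pose x n := projT1 (cid (ex n)).
have xP n : `|x n| <= 1 /\ m - n.+1%:R^-1 < B (x n) (x n) := projT2 (cid (ex n)).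
have [f f1 fm] := weak_limit (fun n => (xP n).1) (fun n => (xP n).2).
have fn : `|f| = 1.
  apply/eqP; rewrite eq_le f1/=.
  have := le_trans fm (Sm f); rewrite ler_pMr// expr2 => h.
  by have := normr_ge0 f; nra.
exists f, m; split => //; apply: sform_maximizer => //.
apply/eqP; rewrite eq_le Sm fn expr1n mulr1 fm //.
Qed.

End Attained.
End CompactForms.

(** * Orthonormal bases of separable Hilbert spaces *)

Section GramSchmidt.
Variables (R : realType) (H : completeNormedModType R).
Variable dot : {dot H for idfun}.
Hypothesis hilbertH : hilbert_norm dot.

(** The first [n] vectors of the process, padded with 0; computing them as a function
    of the index lets each step project on all the previous vectors. The normalization
    sends a vanishing remainder to 0. *)
Fixpoint gram_schmidt (d : nat -> H) (n : nat) : nat -> H :=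
  if n is m.+1 then fun i =>
    if (i < m)%N then gram_schmidt d m i
    else if i == m then
      let r := d m - proj dot (gram_schmidt d m) m (d m) in `|r|^-1 *: r
    else 0
  else fun=> 0.

Definition gs d i := gram_schmidt d i.+1 i.

Lemma gram_schmidt_gs d n i : (i < n)%N -> gram_schmidt d n i = gs d i.
Proof.
elim: n => [//|n IH]; rewrite ltnS leq_eqVlt => /orP[/eqP -> //|ni].
by rewrite /= ni IH.
Qed.

Lemma gs_unit (x : H) : dot (`|x|^-1 *: x) (`|x|^-1 *: x) = 1 \/ `|x|^-1 *: x = 0.
Proof.
have [->|x0] := eqVneq x 0; first by right; rewrite scaler0.
left; rewrite dotZl dotZr hilbertH expr2 mulrA.
by rewrite mulrACA mulrA; field; rewrite normr_eq0.
Qed.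

Lemma gram_schmidt_orthosys d n : orthosys dot (gram_schmidt d n).
Proof.
elim: n => [|n IH]; first by split => [i j|i] /=; [rewrite dot0l|right].
set g := gram_schmidt d n in IH *.
pose r := d n - proj dot g n (d n).
have rg i : (i < n)%N -> dot (`|r|^-1 *: r) (g i) = 0.
  by move=> ni; rewrite dotZl dot_proj_resid// mulr0.
split => [i j|i]; last first.
  rewrite /= -/g -/r; case: ifP => _; first exact: IH.2.
  by case: ifP => _; [exact: gs_unit|right].
rewrite /= -/g -/r; case: (ltnP i n) => ni; case: (ltnP j n) => nj.
- exact: IH.1.
- by case: (j =P n) => _ _; [rewrite dotC rg|rewrite dot0r].
- by case: (i =P n) => _ _; [rewrite rg|rewrite dot0l].
- case: (i =P n) => [->|_]; last by rewrite dot0l.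
  by case: (j =P n) => [->|_]; [rewrite eqxx|rewrite dot0r].
Qed.

Lemma gs_orthosys d : orthosys dot (gs d).
Proof.
split => [i j ij|i]; last exact: (gram_schmidt_orthosys d i.+1).2.
pose n := (maxn i j).+1.
rewrite -(@gram_schmidt_gs d n i) ?ltnS ?leq_maxl//.
rewrite -(@gram_schmidt_gs d n j) ?ltnS ?leq_maxr//.
exact: (gram_schmidt_orthosys d n).1.
Qed.

(** [d k] is its projection on the first [k] vectors plus its remainder, and the
    latter is a multiple of the next vector. *)
Lemma gs_span d k n : (k < n)%N -> proj dot (gs d) n (d k) = d k.
Proof.
have ob := gs_orthosys d; move=> kn.
pose r := d k - proj dot (gs d) k (d k).
have gk : gs d k = `|r|^-1 *: r.
  rewrite /gs /= ltnn eqxx; rewrite (_ : proj dot (gram_schmidt d k) k (d k) = proj dot (gs d) k (d k))//.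
  by apply: eq_bigr => i _; rewrite gram_schmidt_gs.
have rE : r = dot (d k) (gs d k) *: gs d k.
  have -> : dot (d k) (gs d k) = dot r (gs d k).
    by rewrite /r dotBl dot_proj_ge// subr0.
  rewrite gk dotZr hilbertH scalerA.
  have [r0|r0] := eqVneq r 0; first by rewrite r0 scaler0.
  by rewrite -[LHS]scale1r; congr (_ *: _); field; rewrite normr_eq0.
have kE : proj dot (gs d) k.+1 (d k) = d k.
  by rewrite /proj big_ord_recr/= -/(proj dot (gs d) k (d k)) -rE /r addrC subrK.
rewrite -{1}kE; rewrite /proj; under eq_bigr => i _.
  rewrite (_ : dot _ _ = if (i < k.+1)%N then dot (d k) (gs d i) else 0); last first.
    case: ltnP => ik; first by rewrite [LHS](dot_proj_b ob).
    exact: (dot_proj_ge ob).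
  over.
rewrite -[RHS]kE /proj.
rewrite -!(big_mkord xpredT (fun i => dot (d k) (gs d i) *: gs d i)).
rewrite -(big_mkord xpredT (fun i => (if (i < k.+1)%N then dot (d k) (gs d i) else 0) *: gs d i)).
rewrite (big_cat_nat (n := k.+1))//= [X in _ + X]big_nat_cond [X in _ + X]big1 ?addr0.
  by rewrite big_nat [RHS]big_nat; apply: eq_bigr => i /= ->.
by move=> i /andP[/andP[ki _] _]; rewrite ltnNge ki scale0r.
Qed.

Lemma separable_dense_seq : separable H ->
  exists d : nat -> H, forall x (e : R), 0 < e -> exists k, `|x - d k| <= e.
Proof.
move=> [D /countable_injP[f injf] dD].
pose d k : H := if pselect (exists2 y, D y & f y = k) is left h then s2val (cid2 h) else 0.
exists d => x e e0.
have [y [yx Dy]] : (ball x e) `&` D !=set0.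
  by apply: dD; [exists x; exact: ballxx|exact: ball_open].
exists (f y); rewrite /d; case: pselect => [h|[]]; last by exists y.
case: cid2 => z Dz /= fz; have -> : z = y by apply: injf => //; rewrite inE.
by move: yx; rewrite -ball_normE /= => /ltW.
Qed.

(** Gram-Schmidt on a dense sequence preceded by the vectors of [u]. *)
Lemma exists_basis (u : seq H) : separable H -> exists b : nat -> H,
  [/\ orthosys dot b,
   (forall x (e : R), 0 < e -> exists N, forall n, (N <= n)%N -> `|x - proj dot b n x| <= e) &
   (forall x n, x \in u -> (size u <= n)%N -> proj dot b n x = x)].
Proof.
move=> /separable_dense_seq[d0 dd].
pose d i := if (i < size u)%N then nth 0 u i else d0 (i - size u)%N.
have ob := gs_orthosys d.
exists (gs d); split => //.
  move=> x e e0; have [k xk] := dd x e e0.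
  exists (size u + k).+1 => n kn.
  have dk : d (size u + k)%N = d0 k by rewrite /d ltnNge leq_addr/= addKn.
  have -> : x - proj dot (gs d) n x = (x - d0 k) - proj dot (gs d) n (x - d0 k).
    rewrite projB// -[in proj dot _ _ (d0 k)]dk gs_span// dk.
    by rewrite opprB addrA subrK.
  exact: le_trans (norm_resid_le hilbertH ob n _) xk.
move=> x n xu un.
have iu : (index x u < size u)%N by rewrite index_mem.
have <- : d (index x u) = x by rewrite /d iu nth_index.
by rewrite gs_span// (leq_trans iu).
Qed.

End GramSchmidt.

(** * Eigenvalues and the trace norm *)

Section TraceNorm.
Variables (R : realType) (H : completeNormedModType R).
Variable dot : {dot H for idfun}.
Hypothesis hilbertH : hilbert_norm dot.
Variable b : nat -> H.
Hypothesis ob : orthosys dot b.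
Hypothesis pb : forall x (e : R), 0 < e -> exists N, forall n, (N <= n)%N ->
  `|x - proj dot b n x| <= e.

Definition eigenfamily (B : H -> H -> R) (f : nat -> H) (m : nat -> R) (K : nat) :=
  (forall i j, (i < K)%N -> (j < K)%N -> dot (f i) (f j) = (i == j)%:R) /\
  (forall i, (i < K)%N -> forall y, B (f i) y = m i * dot (f i) y).

Definition deflation (B : H -> H -> R) (f : nat -> H) (m : nat -> R) K (x y : H) : R :=
  B x y - \sum_(i < K) m i * (dot x (f i) * dot y (f i)).

Section Form.
Variable B : H -> H -> R.
Hypothesis sB : symform B.
Hypothesis cB : cptform dot b B.

Lemma deflation_symform f m K : symform (deflation B f m K).
Proof.
split=> [x y|a x y z]; rewrite /deflation.
  by rewrite sB.1; congr (_ - _); apply: eq_bigr => i _; rewrite (mulrC (dot x _)).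
rewrite sformDl// sformZl// mulrBr addrACA -opprD; congr (_ - _).
rewrite mulr_sumr -big_split; apply: eq_bigr => i _ /=.
by rewrite dotDl dotZl; ring.
Qed.

(** A finite rank form is compact because each [f i] is approximated by its
    projections. *)
Lemma deflation_cptform f m K : cptform dot b (deflation B f m K).
Proof.
pose S := \sum_(i < K) `|m i| * `|f i|.
have S0 : 0 <= S by rewrite sumr_ge0// => i _; rewrite mulr_ge0.
have [[M HM] HN] := cB; split.
  exists (M + \sum_(i < K) `|m i| * (`|f i| * `|f i|)) => x y.
  rewrite /deflation mulrDl mulr_suml; apply: (le_trans (ler_normB _ _)).
  apply: lerD => //; apply: (le_trans (ler_norm_sum _ _ _)); apply: ler_sum => i _.
  rewrite !normrM -[leRHS]mulrA ler_wpM2l//.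
  apply: (le_trans (ler_pM _ _ (dot_cauchy hilbertH x (f i)) (dot_cauchy hilbertH y (f i)))) => //.
  by rewrite le_eqVlt; apply/orP; left; apply/eqP; ring.
move=> e e0.
have [N0 HN0] := HN (e / 2) (divr_gt0 e0 (ltr0Sn _ 1)).
have d0 : 0 < e / 2 / (S + 1) by rewrite divr_gt0 ?divr_gt0 ?ltr_wpDl.
have [N1 HN1] : exists N1, forall i, (i < K)%N -> forall n, (N1 <= n)%N ->
    `|f i - proj dot b n (f i)| <= e / 2 / (S + 1).
  elim: K {S S0 HN0 d0} (e / 2 / (S + 1)) d0 => [|K IH] d d0; first by exists 0%N.
  have [N1 h1] := IH d d0; have [N2 h2] := pb (f K) d0.
  exists (maxn N1 N2) => i; rewrite ltnS leq_eqVlt => /orP[/eqP -> n|iK n].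
    by rewrite geq_max => /andP[_]; exact: h2.
  by rewrite geq_max => /andP[nN _]; exact: h1.
exists (maxn N0 N1) => x y y0.
rewrite /deflation (splitr e) mulrDl; apply: (le_trans (ler_normB _ _)); apply: lerD.
  by apply: HN0 => i iN; apply: y0; rewrite (leq_trans iN)// leq_maxl.
apply: (le_trans (ler_norm_sum _ _ _)).
apply: (@le_trans _ _ (\sum_(i < K) (`|m i| * `|f i|) * (e / 2 / (S + 1) * (`|x| * `|y|)))).
  apply: ler_sum => i _; rewrite !normrM -!mulrA ler_wpM2l//.
  have h1 : `|dot x (f i)| <= `|x| * `|f i| by exact: dot_cauchy.
  have h2 : `|dot y (f i)| <= `|y| * (e / 2 / (S + 1)).
    have -> : dot y (f i) = dot y (f i - proj dot b N1 (f i)).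
      rewrite dotBr -dot_projC dot_proj big1 ?subr0// => j _.
      by rewrite y0 ?mul0r// (leq_trans (ltn_ord j))// leq_maxr.
    apply: (le_trans (dot_cauchy hilbertH _ _)); rewrite ler_wpM2l//.
    exact: HN1.
  apply: (le_trans (ler_pM _ _ h1 h2)) => //.
  by rewrite le_eqVlt; apply/orP; left; apply/eqP; ring.
rewrite -mulr_suml -/S mulrA ler_wpM2r ?mulr_ge0//.
rewrite mulrCA mulrC ler_piMl ?divr_ge0 ?(ltW e0)//.
by rewrite ler_pdivrMr ?ltr_wpDl// mul1r lerDl.
Qed.

(** The deflated form, or its opposite, is positive at [x], hence attains its supremum
    at an eigenvector [g], with an eigenvalue larger than [e]. Deflation vanishes on
    the [f i], so [g] is orthogonal to them and is an eigenvector of [B] as well. *)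
Lemma eigenfamily_extend f m K e x : 0 < e -> eigenfamily B f m K ->
  e * `|x| ^+ 2 < `|deflation B f m K x x| ->
  exists f' m', [/\ eigenfamily B f' m' K.+1, forall i, (i < K)%N -> m' i = m i & e < `|m' K|].
Proof.
move=> e0 [fo fe] xe.
have sD := deflation_symform f m K; have cD := deflation_cptform f m K.
have [g [nu [g1 gnu nu0 nue]]] : exists g nu,
    [/\ `|g| = 1, (forall y, deflation B f m K g y = nu * dot g y), nu != 0 & e < `|nu|].
  have [D0|D0|D0] := ltgtP (deflation B f m K x x) 0.
  - pose B' x y := - deflation B f m K x y.
    have sB' : symform B'.
      by split => [u v|a u v w]; rewrite /B'; [rewrite sD.1|rewrite sD.2; ring].
    have cB' : cptform dot b B'.
      have [[M HM] HN] := cD; split; first by exists M => u v; rewrite normrN.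
      by move=> d d0; have [N hN] := HN d d0; exists N => u v uv; rewrite normrN; exact: hN.
    have [|g [nu [g1 nu0 gmax geig]]] := form_sup_attained hilbertH ob sB' cB' (x0 := x).
      by rewrite oppr_gt0.
    exists g, (- nu); split => //.
    + by move=> y; rewrite mulNr -geig opprK.
    + by rewrite oppr_eq0 gt_eqF.
    + rewrite normrN gtr0_norm//; have := gmax x; rewrite /B' -ltr0_norm// => h.
      have x2 : 0 < `|x| ^+ 2.
        have := le_lt_trans _ (lt_le_trans xe h) => /(_ 0); rewrite pmulr_rgt0//; apply.
        by rewrite mulr_ge0 ?sqr_ge0// ltW.
      by have := lt_le_trans xe h; rewrite ltr_pM2r.
  - have [|g [nu [g1 nu0 gmax geig]]] := form_sup_attained hilbertH ob sD cD (x0 := x) => //.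
    exists g, nu; split => //; first by rewrite gt_eqF.
    rewrite gtr0_norm//; have := gmax x; rewrite -[X in X <= _]gtr0_norm// => h.
    have x2 : 0 < `|x| ^+ 2.
      have := le_lt_trans _ (lt_le_trans xe h) => /(_ 0); rewrite pmulr_rgt0//; apply.
      by rewrite mulr_ge0 ?sqr_ge0// ltW.
    by have := lt_le_trans xe h; rewrite ltr_pM2r.
  - by move: xe; rewrite D0 normr0 ltNge mulr_ge0 ?sqr_ge0// ltW.
have gf i : (i < K)%N -> dot g (f i) = 0.
  move=> iK; have := gnu (f i); rewrite /deflation sB.1 fe// (bigD1 (Ordinal iK))//= fo// eqxx mulr1.
  rewrite (dotC dot (f i) g) opprD addrA subrr add0r big1; last first.
    by move=> j ji; rewrite fo// (_ : (i == j :> nat) = false) ?mulr0//; apply/negbTE; rewrite eq_sym.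
  by rewrite oppr0 => /esym/eqP; rewrite mulf_eq0 (negbTE nu0)/= => /eqP.
exists (fun i => if i == K then g else f i), (fun i => if i == K then nu else m i); split.
- split=> [i j|i]; rewrite !ltnS.
    rewrite (leq_eqVlt i) (leq_eqVlt j) => /orP[/eqP->|iK] /orP[/eqP->|jK].
    + by rewrite eqxx hilbertH g1 expr1n.
    + by rewrite eqxx (ltn_eqF jK) gf// (gtn_eqF jK).
    + by rewrite eqxx (ltn_eqF iK) dotC gf.
    + by rewrite (ltn_eqF iK) (ltn_eqF jK) fo.
  rewrite leq_eqVlt => /orP[/eqP->|iK] y; last by rewrite (ltn_eqF iK) fe.
  rewrite eqxx -gnu /deflation big1 ?subr0// => j _.
  by rewrite gf ?mul0r ?mulr0.
- by move=> i iK; rewrite (ltn_eqF iK).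
- by rewrite eqxx.
Qed.

(** If the residual never became small, [s / e] and one more eigenvectors with
    eigenvalues larger than [e] would exceed the bound [s]. *)
Lemma form_residual_small (s e : R) : 0 < e ->
  (forall f m K, eigenfamily B f m K -> (forall i, (i < K)%N -> m i != 0) -> \sum_(i < K) `|m i| <= s) ->
  exists f m K, [/\ eigenfamily B f m K, (forall i, (i < K)%N -> m i != 0) &
    forall x, `|deflation B f m K x x| <= e * `|x| ^+ 2].
Proof.
move=> e0 Hs; apply: contrapT => no.
have ex K : exists f m, eigenfamily B f m K /\ forall i, (i < K)%N -> e < `|m i|.
  elim: K => [|K [f [m [fam em]]]]; first by exists (fun=> 0), (fun=> 0).
  have m0 i : (i < K)%N -> m i != 0.
    by move=> iK; rewrite -normr_gt0 (lt_trans e0)// em.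
  have [x xe] : exists x, e * `|x| ^+ 2 < `|deflation B f m K x x|.
    apply: contrapT => h; apply: no; exists f, m, K; split => // x.
    by rewrite leNgt; apply/negP => h'; apply: h; exists x.
  have [f' [m' [fam' mE eK]]] := eigenfamily_extend e0 fam xe.
  exists f', m'; split => // i; rewrite ltnS leq_eqVlt => /orP[/eqP ->//|iK].
  by rewrite mE// em.
pose K := (Num.truncn (s / e)).+1.
have [f [m [fam em]]] := ex K.
have m0 i : (i < K)%N -> m i != 0.
  by move=> iK; rewrite -normr_gt0 (lt_trans e0)// em.
have := Hs f m K fam m0; apply/negP; rewrite -ltNge.
apply: (@lt_le_trans _ _ (\sum_(i < K) e)); last by apply: ler_sum => i _; rewrite ltW// em.
rewrite sumr_const card_ord -mulr_natl -ltr_pdivrMr// .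
exact: truncnS_gt.
Qed.

(** Up to the residual, [B] is the sum of the [m i] times the squares of the dot
    products with [f i]; Bessel's inequality bounds the sum over [j] of these squares
    by 1. *)
Lemma sum_form_le (s : R) n (w : 'I_n -> H) :
  (forall f m K, eigenfamily B f m K -> (forall i, (i < K)%N -> m i != 0) -> \sum_(i < K) `|m i| <= s) ->
  (forall x, \sum_j dot x (w j) ^+ 2 <= `|x| ^+ 2) -> (forall j, `|w j| <= 1) ->
  \sum_j `|B (w j) (w j)| <= s.
Proof.
move=> Hs wb w1.
suff key (e : R) : 0 < e -> \sum_j `|B (w j) (w j)| <= s + n%:R * e.
  apply/ler_addgt0Pr => e e0.
  apply: (le_trans (key (e / (n%:R + 1)) _)); first by rewrite divr_gt0// ltr_wpDl.
  rewrite lerD2l mulrCA ler_piMr ?(ltW e0)// ler_pdivrMr ?ltr_wpDl// mul1r lerDl//.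
move=> e0.
have [f [m [K [fam m0 res]]]] := form_residual_small e0 Hs.
apply: (@le_trans _ _ (\sum_j (\sum_(i < K) `|m i| * dot (f i) (w j) ^+ 2 + e))).
  apply: ler_sum => j _.
  have -> : B (w j) (w j) = \sum_(i < K) m i * (dot (w j) (f i) * dot (w j) (f i)) + deflation B f m K (w j) (w j).
    by rewrite /deflation addrC subrK.
  apply: (le_trans (ler_normD _ _)); apply: lerD.
    apply: (le_trans (ler_norm_sum _ _ _)); apply: ler_sum => i _.
    by rewrite -expr2 normrM (dotC dot (f i)) [X in _ * X]ger0_norm ?sqr_ge0.
  by apply: (le_trans (res (w j))); rewrite ler_piMr ?(ltW e0)// expr_le1.
rewrite big_split/= sumr_const card_ord mulr_natl lerD2r exchange_big/=.
apply: le_trans (Hs f m K fam m0); apply: ler_sum => i _.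
rewrite -mulr_sumr ler_piMr//; apply: (le_trans (wb (f i))).
by rewrite -hilbertH fam.1// eqxx.
Qed.

End Form.

(** Grouping the vectors by eigenvalue, those for the value [v] are linearly
    independent, so their number is at most the multiplicity of [v]. *)
Lemma eigenfamily_le_schatten (A : H -> H) f m K :
  eigenfamily (fun x y => dot (A x) y) f m K ->
  ((\sum_(i < K) `|m i|)%:E <= schatten1_norm A)%E.
Proof.
move=> [fo fe].
have Af i : (i < K)%N -> A (f i) = m i *: f i.
  move=> iK; apply/eqP; rewrite -subr_eq0; apply/eqP/(dot_eq0 hilbertH).
  by rewrite dotBl fe// dotZl subrr.
pose s := [seq m i | i <- iota 0 K].
apply: (@le_trans _ _ (\sum_(v <- undup s) (`|v|%:E * eigen_mult A v))%E); last first.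
  rewrite fsbig_seq ?undup_uniq//; apply: ereal_sup_ubound.
  exists [set` undup s] => //; rewrite /fsets/=; split => //; exact: finite_seq.
have mult_ge v : ((count_mem v s)%:R%:E <= eigen_mult A v)%E.
  apply: ereal_sup_ubound; exists (count_mem v s) => //=.
  pose t := [seq i <- iota 0 K | m i == v].
  have st : size t = count_mem v s.
    by rewrite /t size_filter /s count_map; apply: eq_count => i /=.
  have tK (j : 'I_(count_mem v s)) : (nth 0%N t j < K)%N /\ m (nth 0%N t j) = v.
    have : nth 0%N t j \in t by rewrite mem_nth// st.
    by rewrite mem_filter mem_iota add0n => /andP[/eqP -> /andP[_ ->]].
  exists (fun j => f (nth 0%N t j)); last by move=> j; have [h1 h2] := tK j; rewrite Af// h2.
  move=> c c0 i; have := congr1 (fun x => dot x (f (nth 0%N t i))) c0.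
  rewrite dot0l dot_suml (bigD1 i)//= dotZl fo; [|by case: (tK i)..].
  rewrite eqxx mulr1 big1 ?addr0// => j ji; rewrite dotZl fo; [|by case: (tK j)|by case: (tK i)].
  rewrite nth_uniq ?st// ?filter_uniq ?iota_uniq//.
  by rewrite (_ : (j == i :> nat) = false) ?mulr0//; apply/negbTE.
apply: (@le_trans _ _ (\sum_(v <- undup s) (`|v|%:E * (count_mem v s)%:R%:E))%E); last first.
  by apply: lee_sum => v _; rewrite lee_wpmul2l// lee_fin.
rewrite (eq_bigr (fun v => (`|v| * (count_mem v s)%:R)%R%:E)); last by move=> v _.
rewrite sumEFin lee_fin le_eqVlt; apply/orP; left; apply/eqP.
rewrite -(big_mkord xpredT (fun i => `|m i|)) /index_iota subn0.
rewrite -(big_map m xpredT (fun v => `|v|)) -/s.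
rewrite -[LHS]big_undup_iterop_count; apply: eq_bigr => v _.
by rewrite Monoid.iteropE [LHS]iter_addr_0 mulr_natr.
Qed.

End TraceNorm.

(** * Gaussian elements *)

Lemma bounded_integrable d (T : measurableType d) (R : realType)
    (mu : {measure set T -> \bar R}) (f : T -> R) (M : R) :
  (mu setT < +oo)%E -> measurable_fun setT f -> (forall x, `|f x| <= M) ->
  mu.-integrable setT (EFin \o f).
Proof.
move=> muf mf fM; apply: measurable_bounded_integrable => //.
exists M; split; first exact: num_real.
by move=> x Mx y _ /=; apply: (le_trans (fM y)); exact: ltW.
Qed.

Lemma probability_fin d (T : measurableType d) (R : realType) (P : probability T R) :
  (P setT < +oo)%E.
Proof. by rewrite probability_setT ltry. Qed.

Lemma bounded_Fubini d1 d2 (T1 : measurableType d1) (T2 : measurableType d2) (R : realType)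
    (P1 : probability T1 R) (P2 : probability T2 R) (f : T1 * T2 -> R) (M : R) :
  measurable_fun setT f -> (forall z, `|f z| <= M) ->
  (\int[P1]_x \int[P2]_y (f (x, y))%:E = \int[P2]_y \int[P1]_x (f (x, y))%:E)%E.
Proof.
move=> mf fM; apply: (@Fubini _ _ _ _ _ P1 P2 (EFin \o f)).
apply: (bounded_integrable _ mf fM).
by rewrite -setXTT [ltLHS]product_measure1E//= !probability_setT mule1 ltry.
Qed.

Lemma std_normal_charf (R : realType) (c : R) :
  (\int[normal_prob 0 1]_g (cos (c * g))%:E = (expR (- (c ^+ 2 / 2)))%:E)%E.
Proof.
have mcos : measurable_fun setT (fun x : R => cos (c * x)).
  apply: continuous_measurable_fun => x.
  apply: (continuous_comp (f := fun x : R => c * x)); last exact: continuous_cos.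
  by apply: cvgMr; exact: cvg_id.
rewrite normal_integral// (_ : c ^+ 2 / 2 = c ^+ 2 * 1 ^+ 2 / 2); last by rewrite expr1n mulr1.
rewrite -normal_charf ?oner_eq0//.
rewrite /Rintegral fineK//; apply: integrable_fin_num => //.
apply: (integrable_pdf_le (oner_neq0 R) (A := 1) (B := 0)) => //.
by move=> x; rewrite mul0r addr0 ler_norml cos_le1 cos_geN1.
Qed.

Section GaussianElement.
Variables (R : realType) (H : completeNormedModType R).
Variable dot : {dot H for idfun}.
Hypothesis hilbertH : hilbert_norm dot.
Context d (T : measurableType d) (P : probability T R).
Variable xi : T -> H.
Hypothesis gxi : gaussian_element dot P xi.
Hypothesis mxi : is_mean dot P xi 0.
Variable S : {linear H -> H}.
Hypothesis cov : is_covariance_operator dot P xi S.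

Local Notation N := (@normal_prob R 0 1).
Local Notation q := (fun x y => dot (S x) y).

Lemma measurable_continuous_comp (g : H -> R) :
  continuous g -> measurable_fun setT (fun w => g (xi w)).
Proof.
move=> /continuousP cg; apply: (measurability _ (RGenOpens.measurableE R)).
move=> _ [_ [a [b ->] <-]]; rewrite setTI.
have [mx _] := gxi; apply: (mx (g @^-1` `]a, b[%classic)); apply: sub_sigma_algebra.
by apply: cg; exact: interval_open.
Qed.

Lemma measurable_dot h : measurable_fun setT (fun w => dot (xi w) h).
Proof. by apply: (measurable_continuous_comp (g := fun x => dot x h)); exact: dot_continuous. Qed.

Lemma measurable_sqr_norm : measurable_fun setT (fun w => `|xi w| ^+ 2).
Proof.
apply: (@measurableT_comp _ _ _ _ _ _ (fun x : R => x ^+ 2)); first exact: exprn_measurable.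
by apply: (measurable_continuous_comp (g := fun x => `|x|)); exact: norm_continuous.
Qed.

Lemma covariance_sym u v : dot (S u) v = dot (S v) u.
Proof. by apply: EFin_inj; rewrite !cov covarianceC. Qed.

Lemma covariance_symform : symform q.
Proof.
split=> [x y|a x y z]; first exact: covariance_sym.
by rewrite linearP dotDl dotZl.
Qed.

Lemma element_charf h : (\int[P]_w (cos (dot (xi w) h))%:E = (expR (- (q h h / 2)))%:E)%E.
Proof.
have := @centered_gaussian_charf _ _ _ P (fun w => dot (xi w) h) (dot (S h) h)
  (measurable_dot h) (gxi.2 h).
rewrite mxi dot0l cov => /(_ erefl erefl 1).
by under eq_integral do rewrite mul1r; rewrite expr1n mul1r.
Qed.

Lemma covariance_ge0 h : 0 <= q h h.
Proof.
apply: (@centered_gaussian_variance_ge0 _ _ _ P (fun w => dot (xi w) h) (dot (S h) h)).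
- by rewrite mxi dot0l.
- by rewrite cov.
Qed.

Lemma measurable_cos_dot h : measurable_fun setT (fun w => cos (dot (xi w) h)).
Proof.
apply: (@measurableT_comp _ _ _ _ _ _ (@cos R)); last exact: measurable_dot.
by apply: continuous_measurable_fun; exact: continuous_cos.
Qed.

Definition sum_sqr (w : nat -> H) k om : R := \sum_(i < k) dot (xi om) (w i) ^+ 2.

Lemma sum_sqr_ge0 w k om : 0 <= sum_sqr w k om.
Proof. by apply: sumr_ge0 => i _; exact: sqr_ge0. Qed.

Lemma measurable_sum_sqr w k : measurable_fun setT (sum_sqr w k).
Proof.
apply: measurable_sum => i.
by apply: (@measurableT_comp _ _ _ _ _ _ (fun x : R => x ^+ 2));
  [exact: exprn_measurable|exact: measurable_dot].
Qed.

Lemma measurable_exp_sum_sqr (t : R) w k :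
  measurable_fun setT (fun om => expR (- (t * sum_sqr w k om))).
Proof.
apply: measurableT_comp => //; apply: measurable_funN.
apply: measurable_funM => //; exact: measurable_sum_sqr.
Qed.

(** Induction on [k]. Replacing [exp (- t Y^2)], for [Y = <xi, w k>], by the mean of
    [cos (sqrt (2 t) g Y)] and the product of cosines by half the sum of
    [cos <xi, h + sqrt (2 t) g w_k>] and [cos <xi, h - sqrt (2 t) g w_k>] gives back
    the statement for [k], at two vectors that are still [q]-orthogonal to the
    previous ones. The remaining mean over [g] is that of [exp (- t q(w_k) g^2)]. *)
Lemma laplace_cos (t : R) w k h : 0 <= t ->
  (forall i, (i < k)%N -> q (w i) h = 0) ->
  (forall i j, (i < k)%N -> (j < k)%N -> i != j -> q (w i) (w j) = 0) ->
  (\int[P]_om (expR (- (t * sum_sqr w k om)) * cos (dot (xi om) h))%:E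
   = ((\prod_(i < k) (Num.sqrt (1 + 2 * (t * q (w i) (w i))))^-1)
      * expR (- (q h h / 2)))%:E)%E.
Proof.
move=> t0; elim: k h => [|k IH] h wh ww.
  rewrite big_ord0 mul1r -element_charf; apply: eq_integral => om _.
  by rewrite /sum_sqr big_ord0 mulr0 oppr0 expR0 mul1r.
(* [c * g] is the random frequency whose mean cosine is [exp (- t Y^2)]. *)
pose c := Num.sqrt (2 * t); have c2 : c ^+ 2 = 2 * t by rewrite sqr_sqrtr ?mulr_ge0.
pose E om := expR (- (t * sum_sqr w k om)).
have E1 om : `|E om| <= 1.
  by rewrite ger0_norm ?expR_ge0// /E -[leRHS]expR0 ler_expR oppr_le0 mulr_ge0 ?sum_sqr_ge0.
have cos1 (x : R) : `|cos x| <= 1 by rewrite ler_norml cos_le1 cos_geN1.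
pose F (z : T * measurableTypeR R) := E z.1 * cos (dot (xi z.1) h) * cos (c * dot (xi z.1) (w k) * z.2).
have F1 z : `|F z| <= 1.
  by rewrite /F !normrM mulr_ile1 ?mulr_ge0 ?mulr_ile1.
have mF : measurable_fun setT F.
  apply: measurable_funM; first apply: measurable_funM.
  - by apply: (@measurableT_comp _ _ _ _ _ _ E); [exact: measurable_exp_sum_sqr|exact: measurable_fst].
  - by apply: (@measurableT_comp _ _ _ _ _ _ (fun om => cos (dot (xi om) h)));
      [exact: measurable_cos_dot|exact: measurable_fst].
  - apply: (@measurableT_comp _ _ _ _ _ _ (@cos R)).
      by apply: continuous_measurable_fun; exact: continuous_cos.
    apply: measurable_funM; last exact: measurable_snd.
    apply: measurable_funM => //.
    by apply: (@measurableT_comp _ _ _ _ _ _ (fun om => dot (xi om) (w k)));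
      [exact: measurable_dot|exact: measurable_fst].
transitivity (\int[P]_om \int[N]_g (F (om, g))%:E)%E.
  apply: eq_integral => om _; rewrite /F/=.
  under [RHS]eq_integral do rewrite EFinM.
  rewrite integralZl//; last first.
    apply: (@bounded_integrable _ _ _ _ _ 1) => //; first exact: probability_fin.
    apply: (@measurableT_comp _ _ _ _ _ _ (@cos R)).
      by apply: continuous_measurable_fun; exact: continuous_cos.
    exact: measurable_funM.
  rewrite std_normal_charf -EFinM; congr EFin.
  rewrite /E /sum_sqr big_ord_recr/= mulrDr opprD expRD exprMn c2.
  by rewrite [RHS]mulrAC; congr (_ * expR _ * _); field.
rewrite (bounded_Fubini _ _ mF F1).
pose K := (\prod_(i < k) (Num.sqrt (1 + 2 * (t * q (w i) (w i))))^-1) * expR (- (q h h / 2)).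
have sq := covariance_symform.
transitivity (\int[N]_g (K%:E * (expR (- (t * q (w k) (w k) * g ^+ 2)))%:E))%E.
  apply: eq_integral => g _; rewrite /F/=.
  pose h' (e : R) := h + (e * (c * g)) *: w k.
  have ih e : e ^+ 2 = 1 -> (\int[P]_om (E om * cos (dot (xi om) (h' e)))%:E
     = (K * expR (- (t * q (w k) (w k) * g ^+ 2)))%:E)%E.
    move=> e2; rewrite IH; first last.
    - by move=> i j ik jk; apply: ww; exact: ltnW.
    - move=> i ik; rewrite /h' dotDr dotZr wh; last exact: ltnW.
      by rewrite ww ?mulr0 ?addr0//; [exact: ltnW|rewrite ltn_eqF].
    have qE : dot (S (h' e)) (h' e)
        = dot (S h) h + e ^+ 2 * c ^+ 2 * g ^+ 2 * dot (S (w k)) (w k).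
      have qwh : q (w k) h = 0 by exact: wh.
      have qhw : q h (w k) = 0 by rewrite covariance_sym.
      rewrite /h' (sformDl sq) (sformZl sq) !(sformDr sq) !(sformZr sq) qwh qhw.
      by ring.
    congr EFin; rewrite /K -mulrA -expRD; congr (_ * expR _); rewrite qE.
    by rewrite e2 c2; field.
  have iE e : P.-integrable setT (fun om => (E om * cos (dot (xi om) (h' e)))%:E).
    apply: (@bounded_integrable _ _ _ _ (fun om => E om * cos (dot (xi om) (h' e))) 1).
    - exact: probability_fin.
    - by apply: measurable_funM; [exact: measurable_exp_sum_sqr|exact: measurable_cos_dot].
    - by move=> om; rewrite normrM mulr_ile1.
  transitivity (\int[P]_om ((2^-1)%R%:E * ((E om * cos (dot (xi om) (h' 1)))%:E
      + (E om * cos (dot (xi om) (h' (-1))))%:E)))%E.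
    apply: eq_integral => om _; rewrite -EFinD -EFinM; congr EFin.
    rewrite /h' !dotDr !dotZr mul1r mulN1r mulNr (_ : c * dot (xi om) (w k) * g = c * g * dot (xi om) (w k)); last by ring.
    by rewrite cosD cosB; field.
  rewrite integralZl//; last exact: integrableD.
  rewrite integralD// ih ?expr1n// ih ?sqrrN ?expr1n// -EFinD -!EFinM.
  by congr EFin; field.
rewrite ge0_integralZl//.
- rewrite integral_exp_sqr ?mulr_ge0 ?covariance_ge0// -EFinM big_ord_recr/=; congr EFin.
  by rewrite /K; ring.
- by apply/measurable_EFinP; exact: measurable_exp_sqr.
- rewrite lee_fin /K mulr_ge0 ?expR_ge0//.
  by apply: prodr_ge0 => i _; rewrite invr_ge0.
Qed.

End GaussianElement.

Lemma laplace_wchisq_tails d (T : measurableType d) (R : realType) (P : probability T R)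
    (X : T -> R) (l : seq R) : measurable_fun setT X -> (forall w, 0 <= X w) ->
  all (fun a => 0 <= a) l ->
  (forall t, 0 <= t -> (\int[P]_w (expR (- (t * X w)))%:E
    = (\prod_(c <- l) (Num.sqrt (1 + 2 * (t * c)))^-1)%:E)%E) ->
  forall y, ((P [set w | (y < X w)%R] <= wtail l y)
    /\ (wchisq l `]y, +oo[%classic <= P [set w | (y <= X w)%R]))%E.
Proof.
move=> mX X0 l0 lap y.
have mX' : measurable_fun setT (X : T -> measurableTypeR R) := mX.
pose nu : probability (measurableTypeR R) R :=
  distribution P (@mfun_Sub _ _ T (measurableTypeR R) X (mem_set mX')).
have nuE A : nu A = P (X @^-1` A) by [].
have nu0 : nu `]-oo, 0[%classic = 0%E.
  rewrite nuE (_ : _ @^-1` _ = set0) ?measure0//.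
  by apply/seteqP; split => w //=; rewrite in_itv/= ltNge X0.
have w0 := wchisq_neg0 l0.
have lapE t : 0 <= t ->
    (\int[nu]_s (expR (- (t * s)))%:E = \int[wchisq l]_s (expR (- (t * s)))%:E)%E.
  move=> t0; rewrite integral_exp_wchisq// -lap//.
  rewrite (@integral_law _ _ _ P X nu (fun x => expR (- (t * x))))//.
  by apply: measurableT_comp => //; apply: measurable_funN; exact: measurable_funM.
have oE : nu `]y, +oo[%classic = P [set w | (y < X w)%R].
  by rewrite nuE; congr (P _); apply/seteqP; split => w /=; rewrite in_itv/= andbT.
have cE : nu `[y, +oo[%classic = P [set w | (y <= X w)%R].
  by rewrite nuE; congr (P _); apply/seteqP; split => w /=; rewrite in_itv/= andbT.
split; first by rewrite -oE /wtail; exact: laplace_tail_le.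
by rewrite -cE; apply: laplace_tail_le => // t t0; rewrite lapE.
Qed.

Section CovarianceForm.
Variables (R : realType) (H : completeNormedModType R).
Variable dot : {dot H for idfun}.
Hypothesis hilbertH : hilbert_norm dot.
Context d (T : measurableType d) (P : probability T R).
Variable xi : T -> H.
Hypothesis gxi : gaussian_element dot P xi.
Hypothesis mxi : is_mean dot P xi 0.
Variable S : {linear H -> H}.
Hypothesis cov : is_covariance_operator dot P xi S.

Local Notation q := (fun x y => dot (S x) y).

Lemma sum_sqr_tails (w : nat -> H) k :
  (forall i j, (i < k)%N -> (j < k)%N -> i != j -> q (w i) (w j) = 0) ->
  forall y, ((P [set om | (y < sum_sqr dot xi w k om)%R]
       <= wtail [seq q (w i) (w i) | i <- iota 0 k] y)
    /\ (wchisq [seq q (w i) (w i) | i <- iota 0 k] `]y, +oo[%classic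
       <= P [set om | (y <= sum_sqr dot xi w k om)%R]))%E.
Proof.
move=> ww; apply: laplace_wchisq_tails.
- exact: (measurable_sum_sqr hilbertH gxi).
- by move=> om; exact: sum_sqr_ge0.
- by apply/allP => _ /mapP[i _ ->]; rewrite /=; exact: (covariance_ge0 mxi cov).
move=> t t0; have := laplace_cos hilbertH gxi mxi cov (w := w) (k := k) (h := 0) t0.
have -> : dot (S 0) 0 = 0 by exact: dot0r.
rewrite mul0r oppr0 expR0 mulr1 big_map.
rewrite -(big_mkord xpredT (fun i => (Num.sqrt (1 + 2 * (t * dot (S (w i)) (w i))))^-1)).
rewrite /index_iota subn0 => <- //.
- by apply: eq_integral => om _; rewrite dot0r cos0 mulr1.
- by move=> i _; exact: dot0r.
Qed.

Variable b : nat -> H.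
Hypothesis ob : orthosys dot b.
Hypothesis pb : forall x (e : R), 0 < e -> exists N, forall n, (N <= n)%N ->
  `|x - proj dot b n x| <= e.

(** A bound that tends to 0 with [x] is all that is needed; the mean value theorem
    gives this one. *)
Lemma one_sub_cos_le (x : R) : 1 - cos x <= `|x|.
Proof.
wlog x0 : x / 0 <= x.
  by move=> h; have [/h//|/ltW xn] := leP 0 x; rewrite -cosN -normrN; apply: h; rewrite oppr_ge0.
have [c _] := @MVT_segment R (@cos R) (fun x => - sin x) 0 x x0
  (fun x _ => is_derive_cos x) (continuous_subspaceT (@continuous_cos R)).
rewrite cos0 subr0 => /eqP; rewrite subr_eq => /eqP ->.
rewrite opprD addrCA subrr addr0 mulNr opprK ger0_norm//.
by rewrite ler_piMl// sin_le1.
Qed.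

(** [1 - exp (- q(h) / 2)] is the mean of [1 - cos <xi, h>]. For [h] orthogonal to the
    first [N] vectors of [b], [<xi, h>] only sees the remainder of [xi], and the mean
    of [min (2, |remainder|)] tends to 0 by dominated convergence. *)
Lemma covariance_small_tail (e : R) : 0 < e -> exists N, forall h,
  (forall i, (i < N)%N -> dot h (b i) = 0) -> `|h| <= 1 -> q h h <= e.
Proof.
move=> e0.
pose Z n om : R := Num.min 2 `|xi om - proj dot b n (xi om)|.
have mZ n : measurable_fun setT (Z n).
  apply: measurable_minr; first exact: measurable_cst.
  rewrite (_ : (fun _ => _) = (fun om => Num.sqrt (`|xi om| ^+ 2 - sum_sqr dot xi b n om))).
    apply: (@measurableT_comp _ _ _ _ _ _ (@Num.sqrt R)).
      by apply: continuous_measurable_fun; exact: sqrt_continuous.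
    by apply: measurable_funB;
      [exact: (measurable_sqr_norm gxi)|exact: (measurable_sum_sqr hilbertH gxi)].
  by apply/funext => om; rewrite -sqr_norm_resid// sqrtr_sqr ger0_norm.
have Z0 n om : 0 <= Z n om by rewrite /Z le_min normr_ge0 ler0n.
have Z2 n om : Z n om <= 2 by rewrite /Z ge_min lexx.
have cZ om : Z n om @[n --> \oo] --> 0.
  apply/cvgrPdist_le => d' d0; near=> n; rewrite sub0r normrN ger0_norm//.
  rewrite /Z ge_min; apply/orP; right.
  by near: n; have [N hN] := pb (xi om) d0; exists N.
have [] := @dominated_convergence _ _ _ P setT measurableT (fun n om => (Z n om)%:E) (cst 0%E) (cst 2%:E).
- by move=> n; exact/measurable_EFinP.
- exact: measurable_cst.
- by apply: aeW => om _; apply: cvg_EFin; [near=> n|exact: cZ].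
- by apply: (@bounded_integrable _ _ _ _ (cst 2) 2); [exact: probability_fin|exact: measurable_cst|move=> x; rewrite ger0_norm].
- by apply: aeW => om n _; rewrite gee0_abs ?lee_fin.
move=> _ _; rewrite integral0 => cE.
have iZ n : P.-integrable setT (fun om => (Z n om)%:E).
  by apply: (@bounded_integrable _ _ _ _ (Z n) 2) => //; [exact: probability_fin|move=> om; rewrite ger0_norm].
have e1 : 0 < 1 - expR (- (e / 2)).
  by rewrite subr_gt0 -[ltRHS]expR0 ltr_expR oppr_lt0 divr_gt0.
have [N hN] : exists N, (\int[P]_om (Z N om)%:E <= (1 - expR (- (e / 2)))%:E)%E.
  apply: contrapT => no; suff : (1 - expR (- (e / 2)) <= 0)%R by rewrite leNgt e1.
  rewrite -lee_fin; apply: (cvge_to_ge cE); apply: nearW => n.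
  by apply: ltW; rewrite ltNge; apply/negP => h; apply: no; exists n.
exists N => h hb h1.
suff : 1 - expR (- (q h h / 2)) <= 1 - expR (- (e / 2)).
  by rewrite lerD2l lerN2 ler_expR lerN2 ler_pM2r ?invr_gt0.
rewrite -lee_fin; apply: le_trans hN.
have -> : (1 - expR (- (q h h / 2)))%:E = (\int[P]_om (1 - cos (dot (xi om) h))%:E)%E.
  under eq_integral do rewrite EFinB.
  rewrite integralB//; last 2 first.
  - by apply: (@bounded_integrable _ _ _ _ (cst 1) 1) => //; [exact: probability_fin|move=> x; rewrite normr1].
  - apply: (@bounded_integrable _ _ _ _ (fun om => cos (dot (xi om) h)) 1) => //; first exact: probability_fin.
      exact: (measurable_cos_dot hilbertH gxi).
    by move=> x; rewrite ler_norml cos_le1 cos_geN1.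
  by rewrite (element_charf hilbertH gxi mxi cov) integral_cst// [X in (1 * X)%E](probability_setT P) mule1 -EFinB.
apply: ge0_le_integral => //.
- apply/measurable_EFinP; apply: measurable_funB => //.
  exact: (measurable_cos_dot hilbertH gxi).
- exact/measurable_EFinP.
move=> om _; rewrite lee_fin /Z le_min; apply/andP; split.
  by rewrite -[leRHS](_ : 1 + 1 = 2) // lerD2l lerNl cos_geN1.
have -> : dot (xi om) h = dot (xi om - proj dot b N (xi om)) h.
  by rewrite dotBl dot_proj big1 ?subr0// => j _; rewrite hb ?mulr0.
apply: (le_trans (one_sub_cos_le _)).
by apply: (le_trans (dot_cauchy hilbertH _ _)); rewrite ler_piMr.
Unshelve. all: by end_near.
Qed.

Lemma covariance_cauchy x y : q x y ^+ 2 <= q x x * q y y.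
Proof.
have sq := covariance_symform cov.
have q0 h : 0 <= q h h by exact: (covariance_ge0 mxi cov).
have qE (a c : R) : q (a *: x - c *: y) (a *: x - c *: y)
    = a ^+ 2 * q x x - 2 * (a * c) * q x y + c ^+ 2 * q y y.
  rewrite (sformBl sq) !(sformBr sq) !(sformZl sq) !(sformZr sq) (sq.1 y x); ring.
have [y0|y0] := eqVneq (q y y) 0.
  rewrite y0 mulr0 (_ : q x y = 0) ?expr0n//.
  apply: (@quadratic_domination_eq0 _ _ (q x x)) => t.
  by have := q0 (t *: x - 1 *: y); rewrite qE y0; lra.
have yp : 0 < q y y by rewrite lt_neqAle eq_sym y0 q0.
have := q0 (q y y *: x - q x y *: y); rewrite qE.
have -> : q y y ^+ 2 * q x x - 2 * (q y y * q x y) * q x y + q x y ^+ 2 * q y y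
  = q y y * (q x x * q y y - q x y ^+ 2) by ring.
by rewrite pmulr_rge0// subr_ge0.
Qed.

(** Smallness on a tail of the basis, a finite Gram matrix on the rest, and the
    Cauchy-Schwarz inequality for [q] give both boundedness and compactness. *)
Lemma covariance_cptform : cptform dot b q.
Proof.
have sq := covariance_symform cov.
have q0 h : 0 <= q h h by exact: (covariance_ge0 mxi cov).
have small (e : R) : 0 < e -> exists N, forall h,
    (forall i, (i < N)%N -> dot h (b i) = 0) -> q h h <= e * `|h| ^+ 2.
  move=> e0; have [N hN] := covariance_small_tail e0; exists N => h hb.
  have [->|h0] := eqVneq h 0; first by rewrite normr0 expr0n mulr0 (sform0l sq).
  have n0 : 0 < `|h| by rewrite normr_gt0.
  have := hN (`|h|^-1 *: h); rewrite (sformZl sq) (sformZr sq) normrZ normfV normr_id mulVf ?gt_eqF// => hq.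
  have : `|h|^-1 * (`|h|^-1 * q h h) <= e.
    by apply: hq => // i iN; rewrite dotZl hb ?mulr0.
  by rewrite mulrA -expr2 mulrC exprVn ler_pdivrMr ?exprn_gt0.
have dbl u v : q (u + v) (u + v) <= 2 * q u u + 2 * q v v.
  have := q0 (u - v).
  by rewrite (sformBl sq) !(sformBr sq) (sformDl sq) !(sformDr sq) (sq.1 v u); lra.
have [M [M0 bM]] : exists M : R, 0 <= M /\ forall x, q x x <= M * `|x| ^+ 2.
  have [N hN] := small 1 ltr01.
  pose A := \sum_(i < N) \sum_(j < N) `|q (b i) (b j)|.
  have A0 : 0 <= A by apply: sumr_ge0 => i _; apply: sumr_ge0.
  exists (2 * A + 2); split; first by rewrite addr_ge0 ?mulr_ge0.
  move=> x; pose p := proj dot b N x; pose r := x - p.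
  have qr : q r r <= `|x| ^+ 2.
    apply: (@le_trans _ _ (1 * `|r| ^+ 2)).
      by apply: hN => i iN; exact: dot_proj_resid.
    by rewrite mul1r ler_pXn2r ?nnegrE// norm_resid_le.
  have qp : q p p <= A * `|x| ^+ 2.
    rewrite /p /proj (sform_suml sq) /A mulr_suml; apply: ler_sum => i _.
    rewrite (sform_sumr sq) mulr_suml; apply: ler_sum => j _.
    rewrite (sformZl sq) (sformZr sq) mulrA mulrC.
    apply: (le_trans (ler_norm _)); rewrite normrM ler_wpM2l// normrM expr2.
    have bx (k : 'I_N) : `|dot x (b k)| <= `|x|.
      rewrite -(@ler_pXn2r _ 2) ?nnegrE// real_normK ?num_real//.
      apply: le_trans (bessel hilbertH ob N x); rewrite (bigD1 k)//= lerDl.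
      by apply: sumr_ge0 => l _; exact: sqr_ge0.
    exact: ler_pM.
  have := dbl p r; rewrite (_ : p + r = x); last by rewrite /r addrC subrK.
  by move=> h; apply: (le_trans h); rewrite [leRHS]mulrDl -[2 * A * _]mulrA; apply: lerD; rewrite ler_wpM2l.
have cs x y (u v : R) : 0 <= u -> 0 <= v -> q x x <= u -> q y y <= v -> `|q x y| <= Num.sqrt (u * v).
  move=> u0 v0 xu yv; rewrite -(@ler_pXn2r _ 2) ?nnegrE ?sqrtr_ge0// sqr_sqrtr ?mulr_ge0//.
  rewrite real_normK ?num_real//; apply: (le_trans (covariance_cauchy x y)).
  exact: ler_pM.
split.
  have Mx (x : H) : 0 <= M * `|x| ^+ 2 by rewrite mulr_ge0 ?sqr_ge0.
  exists M => x y; have := cs x y _ _ (Mx x) (Mx y) (bM x) (bM y).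
  rewrite (_ : M * `|x| ^+ 2 * (M * `|y| ^+ 2) = (M * (`|x| * `|y|)) ^+ 2); last by ring.
  by rewrite sqrtr_sqr [X in _ <= X -> _]ger0_norm ?mulr_ge0.
move=> e e0; have d0 : 0 < e ^+ 2 / (M + 1) by rewrite divr_gt0 ?exprn_gt0// ltr_wpDl.
have [N hN] := small _ d0; exists N => x y yb.
have Mx : 0 <= M * `|x| ^+ 2 by rewrite mulr_ge0 ?sqr_ge0.
have dy : 0 <= e ^+ 2 / (M + 1) * `|y| ^+ 2 by rewrite mulr_ge0 ?sqr_ge0 ?(ltW d0).
apply: (le_trans (cs x y _ _ Mx dy (bM x) (hN y yb))); rewrite -(@ger0_norm _ (e * _)) ?mulr_ge0 ?(ltW e0)// -sqrtr_sqr ler_wsqrtr//.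
rewrite (_ : M * _ * _ = M / (M + 1) * (e * (`|x| * `|y|)) ^+ 2); last by field; rewrite gt_eqF// ltr_wpDl.
by rewrite ler_piMl ?sqr_ge0// ler_pdivrMr ?ltr_wpDl// mul1r lerDl.
Qed.

End CovarianceForm.

(** * Leading eigenvectors and truncation of the norm *)

Lemma counting_ge (R : realType) (A : set nat) (s : seq nat) :
  uniq s -> (forall k, k \in s -> A k) -> ((size s)%:R%:E <= counting A :> \bar R)%E.
Proof.
move=> us sA; rewrite /counting; case: asboolP => finA; last by rewrite leey.
rewrite lee_fin ler_nat; apply: uniq_leq_size => // k ks.
by rewrite in_fset_set// inE; exact: sA.
Qed.

Section Eigenvectors.
Variables (R : realType) (H : completeNormedModType R).
Variable dot : {dot H for idfun}.
Hypothesis hilbertH : hilbert_norm dot.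
Variable A : {linear H -> H}.
Hypothesis symA : forall u v, dot (A u) v = dot (A v) u.

Lemma lin_indep_neq0 n (e : 'I_n -> H) i : lin_indep e -> e i != 0.
Proof.
move=> le; apply/eqP => ei0.
have /(_ _ i)/eqP := le (fun j => (j == i)%:R); rewrite eqxx oner_eq0 => h.
have /h // : \sum_(j < n) (j == i)%:R *: e j = 0.
apply: big1 => j _; have [->|_] := eqVneq j i; first by rewrite ei0 scaler0.
by rewrite scale0r.
Qed.

Lemma lin_indep_pair n (e : 'I_n -> H) i j (a : R) : lin_indep e -> i != j ->
  e j - a *: e i != 0.
Proof.
move=> le ij; apply/eqP => e0.
have /(_ _ j)/eqP := le (fun k => (k == j)%:R - (k == i)%:R * a).
have ji : (j == i) = false by rewrite eq_sym (negbTE ij).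
rewrite eqxx ji mul0r subr0 oner_eq0 => h.
have /h // : \sum_(k < n) ((k == j)%:R - (k == i)%:R * a) *: e k = 0.
rewrite (bigD1 i)//= (bigD1 j) ?ji//= big1; last first.
  by move=> k /andP[/negbTE -> /negbTE ->]; rewrite mul0r subr0 scale0r.
rewrite !eqxx (negbTE ij) !mul1r mul0r sub0r subr0 scale1r addr0 scaleNr.
by rewrite addrC.
Qed.

Lemma eigen_mult_ge n mu : (n.+1%:R%:E <= eigen_mult A mu)%E ->
  exists m (e : 'I_m -> H), [/\ (n < m)%N, lin_indep e & forall i, A (e i) = mu *: e i].
Proof.
move=> h.
have /ereal_sup_gt[_ [m [e le eA] <-]] : (n%:R%:E < eigen_mult A mu)%E.
  by apply: lt_le_trans h; rewrite lte_fin ltr_nat.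
by rewrite lte_fin ltr_nat => nm; exists m, e.
Qed.

Lemma normalize_eigenvector mu e : e != 0 -> A e = mu *: e ->
  dot (`|e|^-1 *: e) (`|e|^-1 *: e) = 1 /\ A (`|e|^-1 *: e) = mu *: (`|e|^-1 *: e).
Proof.
move=> e0 eA; split; last by rewrite linearZ/= eA !scalerA mulrC.
by rewrite hilbertH normrZ normfV normr_id mulVf ?normr_eq0// expr1n.
Qed.

(** If the two eigenvalues coincide, the multiplicity is at least 2 and two independent
    eigenvectors are orthonormalized; otherwise symmetry makes the two eigenvectors
    orthogonal. *)
Lemma two_eigenvectors (l : nat -> R) : eigenvalue_seq A l -> 0 < l 1%N ->
  exists u0 u1, [/\ dot u0 u0 = 1, dot u1 u1 = 1, dot u0 u1 = 0,
    A u0 = l 0%N *: u0 & A u1 = l 1%N *: u1].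
Proof.
move=> [l0 ldec lmult] l1.
have l00 : 0 < l 0%N by exact: lt_le_trans (ldec 0%N).
have [l01|l01] := eqVneq (l 0%N) (l 1%N).
  have [|m [e [m2 le eA]]] := @eigen_mult_ge 1 (l 0%N).
    rewrite -lmult//; apply: (@counting_ge _ _ [:: 0%N; 1%N]) => // k.
    by rewrite !inE => /orP[/eqP ->|/eqP ->].
  pose i0 := Ordinal (ltnW m2); pose i1 := Ordinal m2.
  have e0 := lin_indep_neq0 i0 le.
  have [u0u0 Au0] := normalize_eigenvector e0 (eA i0).
  set u0 := _ *: e i0 in u0u0 Au0.
  pose y := e i1 - dot (e i1) u0 *: u0.
  have y0 : y != 0 by rewrite /y /u0 scalerA; exact: lin_indep_pair.
  clearbody u0.
  have yA : A y = l 1%N *: y.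
    by rewrite /y linearB linearZ/= Au0 eA -l01 scalerBr !scalerA (mulrC (dot _ _)).
  have [u1u1 Au1] := normalize_eigenvector y0 yA.
  exists u0, (`|y|^-1 *: y); split => //.
  by rewrite dotZr /y dotBr dotZr u0u0 (dotC dot u0) mulr1 subrr mulr0.
have ev k : 0 < l k -> exists u, dot u u = 1 /\ A u = l k *: u.
  move=> lk; have [|m [e [m2 le eA]]] := @eigen_mult_ge 0 (l k).
    rewrite -lmult//; apply: (@counting_ge _ _ [:: k]) => // j.
    by rewrite !inE => /eqP ->.
  have e0 := lin_indep_neq0 (Ordinal m2) le.
  by have := normalize_eigenvector e0 (eA _) => h; exists (`|e (Ordinal m2)|^-1 *: e (Ordinal m2)).
have [u0 [u00 Au0]] := ev _ l00; have [u1 [u11 Au1]] := ev _ l1.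
exists u0, u1; split => //.
have := symA u0 u1; rewrite Au0 Au1 !dotZl (dotC dot u1) => /eqP.
by rewrite -subr_eq0 -mulrBl mulf_eq0 subr_eq0 (negbTE l01)/= => /eqP.
Qed.

End Eigenvectors.

Section NormTail.
Variables (R : realType) (H : completeNormedModType R).
Variable dot : {dot H for idfun}.
Hypothesis hilbertH : hilbert_norm dot.
Context d (T : measurableType d) (P : probability T R).
Variable xi : T -> H.
Hypothesis gxi : gaussian_element dot P xi.
Variable b : nat -> H.
Hypothesis ob : orthosys dot b.
Hypothesis pb : forall x (e : R), 0 < e -> exists N, forall n, (N <= n)%N ->
  `|x - proj dot b n x| <= e.

Lemma measurable_gt (X : T -> R) y : measurable_fun setT X -> measurable [set w | y < X w].
Proof.
move=> mX; have := mX measurableT _ (measurable_itv `]y, +oo[); rewrite setTI.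
by congr (measurable _); apply/seteqP; split => w /=; rewrite in_itv/= andbT.
Qed.

Lemma measurable_ge (X : T -> R) y : measurable_fun setT X -> measurable [set w | y <= X w].
Proof.
move=> mX; have := mX measurableT _ (measurable_itv `[y, +oo[); rewrite setTI.
by congr (measurable _); apply/seteqP; split => w /=; rewrite in_itv/= andbT.
Qed.

(** The partial sums increase to [`|xi| ^+ 2], so the events increase to the limit
    event. Strict inequality is essential for this. *)
Lemma norm_tail_le y (c : \bar R) n0 :
  (forall n, (n0 <= n)%N -> P [set w | (y < sum_sqr dot xi b n w)%R] <= c)%E ->
  (P [set w | (y < `|xi w| ^+ 2)%R] <= c)%E.
Proof.
move=> hc; pose F n := [set w | y < sum_sqr dot xi b n w].
have mF n : measurable (F n).
  by apply: measurable_gt; exact: (measurable_sum_sqr hilbertH gxi).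
have FE : \bigcup_n F n = [set w | y < `|xi w| ^+ 2].
  apply/seteqP; split => [w [n _ /= Fw]|w /= yw].
    exact: lt_le_trans (bessel hilbertH ob n (xi w)).
  pose e := Num.sqrt ((`|xi w| ^+ 2 - y) / 2).
  have e2 : e ^+ 2 = (`|xi w| ^+ 2 - y) / 2 by rewrite sqr_sqrtr// divr_ge0// subr_ge0 ltW.
  have e0 : 0 < e by rewrite sqrtr_gt0 divr_gt0// subr_gt0.
  have [N hN] := pb (xi w) e0; exists N => //=.
  have := hN N (leqnn _); rewrite -(@ler_pXn2r _ 2) ?nnegrE ?(ltW e0)//.
  rewrite sqr_norm_resid// e2 /F/= /sum_sqr; move: yw.
  move: (`|xi w| ^+ 2) (\sum_(i < N) _) => X s; lra.
rewrite -FE; apply: (cvge_to_le (nondecreasing_cvg_mu mF _ _)).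
- exact: bigcup_measurable.
- move=> m n mn; apply/subsetPset => w /= h; apply: (lt_le_trans h).
  rewrite /sum_sqr -(big_mkord xpredT (fun i => dot (xi w) (b i) ^+ 2)).
  rewrite -(big_mkord xpredT (fun i => dot (xi w) (b i) ^+ 2)).
  rewrite [leRHS](big_cat_nat (n := m))//= lerDl; apply: sumr_ge0 => i _; exact: sqr_ge0.
- by exists n0 => // n /= nn; exact: hc.
Qed.

End NormTail.

(** * Comparison of finite sections *)

Section EigenframeOrder.
Variables (R : realType) (n : nat).
Implicit Types (Q : 'M[R]_n) (w : nat -> 'rV[R]_n).

Lemma eigenframe_decreasing Q w i j : eigenframe Q w n -> (j <= i < n)%N ->
  mxform Q (w i) (w i) <= mxform Q (w j) (w j).
Proof.
move=> [fw ew] /andP[ji ni].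
have := ew j (leq_ltn_trans ji ni) (w i); rewrite fw// eqxx mulr1; apply => k kj.
have ki : (k < i)%N by exact: leq_trans ji.
by rewrite fw ?(ltn_trans ki)// gtn_eqF.
Qed.

Lemma eigenframe_mono Q1 Q0 w1 w0 i : Q1^T = Q1 -> eigenframe Q1 w1 n -> eigenframe Q0 w0 n ->
  (forall x, mxform Q1 x x <= mxform Q0 x x) -> (i < n)%N ->
  mxform Q1 (w1 i) (w1 i) <= mxform Q0 (w0 i) (w0 i).
Proof.
move=> sQ e1 e0 Q10 ni; have [f1 _] := e1.
have lt_n (j : 'I_i.+1) : (j < n)%N by rewrite (leq_trans (ltn_ord j)).
apply: (eigenframe_minmax e0 ni (v := w1)).
  by move=> j k ji ki; rewrite f1//; [exact: (lt_n (Ordinal ji))|exact: (lt_n (Ordinal ki))].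
move=> c; apply: le_trans (Q10 _).
rewrite mxform_suml mulr_sumr; apply: ler_sum => j _.
rewrite mxform_sumr (bigD1 j)//= big1 ?addr0; last first.
  move=> k kj; rewrite mxformZl mxformZr (eigenframe_orthogonal sQ e1) ?mulr0 ?lt_n//.
  by rewrite eq_sym.
rewrite mxformZl mxformZr mulrA -expr2 mulrC ler_wpM2l ?sqr_ge0//.
by apply: (eigenframe_decreasing e1); rewrite ni andbT -ltnS.
Qed.

End EigenframeOrder.

(** [L] lists the weights in reverse, which puts the two largest at the end as
    [wtail_perturbed] requires: the first weights [a1] are raised to [a0], and those
    are compared with [a2]. *)
Lemma weights_compare (R : realType) m (a1 a0 a2 : nat -> R) (l0 l1 x D s : R) :
  let L a := [seq a (m.+2 - i.+1)%N | i <- iota 0 m.+2] in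
  0 < l0 -> 0 < l1 -> l0 <= a2 0%N -> l1 <= a2 1%N -> 0 <= D ->
  (forall j, (j < m.+2)%N -> a1 j <= a0 j) -> (forall j, (j < m.+2)%N -> a2 j <= a0 j) ->
  \sum_(j < m.+2) (a0 j - a2 j) <= s ->
  (wtail (L a1) (x - D)%R <= wtail (L a2) x
    + (annulus_const R / Num.sqrt (l0 * l1) * (D + s))%:E)%E.
Proof.
move=> L l0p l1p l0a l1a D0 a10 a20 hs.
have a20p : 0 < a2 0%N by exact: lt_le_trans l0a.
have a21p : 0 < a2 1%N by exact: lt_le_trans l1a.
pose r i := (m.+2 - i.+1)%N.
have rlt i : (r i < m.+2)%N by rewrite /r subSS ltnS leq_subr.
have fstE (f g : nat -> R) : [seq q.1 | q <- [seq (f (r i), g (r i) - f (r i)) | i <- iota 0 m.+2]] = L f.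
  by rewrite -map_comp.
have sndE (f g : nat -> R) :
    [seq q.1 + q.2 | q <- [seq (f (r i), g (r i) - f (r i)) | i <- iota 0 m.+2]] = L g.
  by rewrite -map_comp; apply: eq_map => i /=; rewrite addrC subrK.
apply: (@le_trans _ _ (wtail (L a0) (x - D))).
  have := @wtail_le_weights R [seq (a1 (r i), a0 (r i) - a1 (r i)) | i <- iota 0 m.+2] (x - D).
  rewrite fstE sndE; apply.
  by apply/allP => _ /mapP[i _ ->] /=; rewrite subr_ge0 a10.
pose s' := [seq (a2 (r i), a0 (r i) - a2 (r i)) | i <- iota 0 m].
have sE : s' ++ [:: (a2 1%N, a0 1%N - a2 1%N); (a2 0%N, a0 0%N - a2 0%N)]
    = [seq (a2 (r i), a0 (r i) - a2 (r i)) | i <- iota 0 m.+2].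
  have rm : r m = 1%N by rewrite /r subSn// subnn.
  have rm1 : r m.+1 = 0%N by rewrite /r subnn.
  have -> : iota 0 m.+2 = iota 0 m ++ [:: m; m.+1] by rewrite -addn2 iotaD.
  by rewrite map_cat /= rm rm1.
have sumE : \sum_(q <- [seq (a2 (r i), a0 (r i) - a2 (r i)) | i <- iota 0 m.+2]) q.2
    = \sum_(i < m.+2) (a0 i - a2 i).
  rewrite big_map (eq_bigr (fun i => a0 (r i) - a2 (r i)))//.
  rewrite -(big_mkord xpredT (fun i => a0 i - a2 i)) [RHS]big_nat_rev add0n.
  by rewrite /index_iota subn0.
have := @wtail_perturbed R _ _ a21p a20p s' x D (a0 1%N - a2 1%N) (a0 0%N - a2 0%N) D0.
rewrite !subr_ge0 !a20// => /(_ isT isT); rewrite sE fstE sndE => h.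
apply: (le_trans (y := wtail (L a2) x + (annulus_const R / Num.sqrt (a2 1%N * a2 0%N) *
    (D + \sum_(i < m.+2) (a0 i - a2 i)))%:E)%E).
  by rewrite -sumE; apply: h; apply/allP => _ /mapP[i _ ->] /=; rewrite subr_ge0 a20.
apply: leeD => //; rewrite lee_fin.
have K0 := ltW (annulus_const_gt0 R).
have s0 : 0 <= \sum_(i < m.+2) (a0 i - a2 i).
  by apply: sumr_ge0 => i _; rewrite subr_ge0 a20.
apply: ler_pM; rewrite ?addr_ge0 ?divr_ge0 ?sqrtr_ge0 ?lerD//.
rewrite ler_wpM2l// lef_pV2 ?posrE ?sqrtr_gt0 ?mulr_gt0//.
by rewrite ler_wsqrtr// mulrC; apply: ler_pM => //; exact: ltW.
Qed.

Section Gram.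
Variables (R : realType) (H : completeNormedModType R).
Variable dot : {dot H for idfun}.
Hypothesis hilbertH : hilbert_norm dot.
Variable b : nat -> H.
Hypothesis ob : orthosys dot b.
Variable n : nat.

Definition gram (B : H -> H -> R) : 'M[R]_n := \matrix_(i, j) B (b i) (b j).
Definition comb (x : 'rV[R]_n) : H := \sum_(i < n) x 0 i *: b i.
Definition coords (x : H) : 'rV[R]_n := \row_(i < n) dot x (b i).

Lemma gram_sym B : symform B -> (gram B)^T = gram B.
Proof. by move=> sB; apply/matrixP => i j; rewrite !mxE sB.1. Qed.

Lemma mxform_gram B x y : symform B -> mxform (gram B) x y = B (comb x) (comb y).
Proof.
move=> sB; rewrite mxform_sum /comb (sform_suml sB); apply: eq_bigr => i _.
rewrite (sform_sumr sB); apply: eq_bigr => j _.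
by rewrite (sformZl sB) (sformZr sB) mxE; ring.
Qed.

Lemma dot_comb x y : dot x (comb y) = dotrow (coords x) y.
Proof.
rewrite dotrow_sum /comb dotC dot_suml; apply: eq_bigr => i _.
by rewrite dotZl mxE (dotC dot x) mulrC.
Qed.

Lemma comb_coords x : comb (coords x) = proj dot b n x.
Proof. by apply: eq_bigr => i _; rewrite mxE. Qed.

Lemma dotrow_coords x y : dotrow (coords x) (coords y) = dot (proj dot b n x) y.
Proof. by rewrite dot_proj dotrow_sum; apply: eq_bigr => i _; rewrite !mxE. Qed.

Lemma comb_bessel w x : frame w n -> \sum_(j < n) dot x (comb (w j)) ^+ 2 <= `|x| ^+ 2.
Proof.
move=> fw; under eq_bigr do rewrite dot_comb.
rewrite frame_parseval// dotrow_sum; apply: le_trans (bessel hilbertH ob n x).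
by apply: ler_sum => i _; rewrite mxE.
Qed.

Lemma norm_comb_le w (j : 'I_n) : frame w n -> `|comb (w j)| <= 1.
Proof.
move=> fw; have := comb_bessel (comb (w j)) fw; set u := comb (w j).
have [u0|u0] := eqVneq u 0; first by rewrite u0 normr0.
have up : 0 < `|u| ^+ 2 by rewrite exprn_gt0 ?normr_gt0.
move=> h; suff : `|u| ^+ 2 <= 1 by rewrite expr_le1.
rewrite -(ler_pM2r up) mul1r -expr2; apply: le_trans h.
rewrite (bigD1 j)//= -/u hilbertH lerDl; apply: sumr_ge0 => i _; exact: sqr_ge0.
Qed.

(** Both sides are the squared length of the coordinate vector of [xi om]; the
    reversal of the frame matches the order of weights in [weights_compare]. *)
Lemma sum_sqr_frame (T : Type) (xi : T -> H) w om : frame w n ->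
  \sum_(i < n) dot (xi om) (comb (w (n - i.+1)%N)) ^+ 2 = \sum_(i < n) dot (xi om) (b i) ^+ 2.
Proof.
move=> fw; rewrite (reindex_inj rev_ord_inj)/=.
transitivity (\sum_(i < n) dot (xi om) (comb (w i)) ^+ 2).
  by apply: eq_bigr => i _; rewrite [X in w X](congr1 val (rev_ordK i)).
rewrite (eq_bigr (fun i : 'I_n => dotrow (coords (xi om)) (w i) ^+ 2)); last first.
  by move=> i _; rewrite dot_comb.
rewrite frame_parseval// dotrow_sum.
by apply: eq_bigr => i _; rewrite mxE -expr2.
Qed.

(** Eigenvectors [u 0], ..., [u i] that lie in the section are test vectors for the
    min-max principle. *)
Lemma eigenvalue_le_frame B (u : nat -> H) (l : nat -> R) w i : symform B ->
  eigenframe (gram B) w n -> (i < n)%N ->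
  (forall j k, (j <= i)%N -> (k <= i)%N -> dot (u j) (u k) = (j == k)%:R) ->
  (forall j, (j <= i)%N -> proj dot b n (u j) = u j) ->
  (forall j y, (j <= i)%N -> B (u j) y = l j * dot (u j) y) ->
  (forall j, (j <= i)%N -> l i <= l j) ->
  l i <= mxform (gram B) (w i) (w i).
Proof.
move=> sB ew ni uu pu eu li.
apply: (eigenframe_minmax ew ni (v := fun j => coords (u j))).
  by move=> j k ji ki; rewrite dotrow_coords pu// uu.
have le_i (j : 'I_i.+1) : (j <= i)%N by rewrite -ltnS.
have formE (j k : 'I_i.+1) (c : 'I_i.+1 -> R) :
    mxform (gram B) (c j *: coords (u j)) (c k *: coords (u k))
    = c j * (c k * (l j * (j == k)%:R)).
  by rewrite mxformZl mxformZr mxform_gram// !comb_coords !pu// eu// uu.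
move=> c; rewrite mxform_suml mulr_sumr; apply: ler_sum => j _.
rewrite mxform_sumr (bigD1 j)//= big1 ?addr0; last first.
  by move=> k kj; rewrite formE eq_sym (negbTE kj) !mulr0.
by rewrite formE eqxx mulr1 mulrA -expr2 mulrC ler_wpM2l ?sqr_ge0// li.
Qed.

End Gram.

Lemma eigenframe_tails (R : realType) (H : completeNormedModType R) (dot : {dot H for idfun})
    (hilbertH : hilbert_norm dot) d (T : measurableType d) (P : probability T R) (xi : T -> H)
    (gxi : gaussian_element dot P xi) (mxi : is_mean dot P xi 0) (S : {linear H -> H})
    (cov : is_covariance_operator dot P xi S) (b : nat -> H) n (w : nat -> 'rV[R]_n) :
  let Q := gram b n (fun x y => dot (S x) y) in
  let l := [seq mxform Q (w (n - i.+1)%N) (w (n - i.+1)%N) | i <- iota 0 n] in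
  eigenframe Q w n -> forall y,
  ((P [set om | (y < sum_sqr dot xi b n om)%R] <= wtail l y)
    /\ (wchisq l `]y, +oo[%classic <= P [set om | (y <= sum_sqr dot xi b n om)%R]))%E.
Proof.
move=> Q l ew y; have sq := covariance_symform cov.
have sQ : Q^T = Q by exact: gram_sym.
have ni i : (i < n)%N -> (n - i.+1 < n)%N by move=> ?; rewrite ltn_subrL (leq_trans _ (_ : i < n)%N).
have := sum_sqr_tails hilbertH gxi mxi cov (w := fun i => comb b (w (n - i.+1)%N)) (k := n) _ y.
have -> : sum_sqr dot xi (fun i => comb b (w (n - i.+1)%N)) n = sum_sqr dot xi b n.
  by apply/funext => om; rewrite /sum_sqr; apply: sum_sqr_frame; case: ew.
rewrite (_ : [seq _ | i <- iota 0 n] = l); last first.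
  by apply: eq_map => i; rewrite -(mxform_gram b _ _ sq).
apply => i j ni' nj ij; rewrite -(mxform_gram b _ _ sq).
apply: (eigenframe_orthogonal sQ ew); rewrite ?ni//.
apply: contra ij => /eqP h; rewrite -eqSS; apply/eqP.
by rewrite -(subKn ni') -(subKn nj) h.
Qed.

(** The tails are compared at levels shifted by [e], which absorbs the difference
    between open and closed tails at each passage; [e] then tends to 0. *)
Lemma norm_tail_compare (R : realType) (H : completeNormedModType R) (dot : {dot H for idfun})
    (hilbertH : hilbert_norm dot) d (T : measurableType d) (P : probability T R)
    (xi eta : T -> H)
    (gxi : gaussian_element dot P xi) (geta : gaussian_element dot P eta)
    (mxi : is_mean dot P xi 0) (meta : is_mean dot P eta 0)
    (Sxi Seta : {linear H -> H})
    (cxi : is_covariance_operator dot P xi Sxi) (ceta : is_covariance_operator dot P eta Seta)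
    (b : nat -> H) (ob : orthosys dot b)
    (pb : forall x (e : R), 0 < e -> exists N, forall n, (N <= n)%N -> `|x - proj dot b n x| <= e)
    (v0 v1 : H) (l0 l1 s : R) n0 :
  dot v0 v0 = 1 -> dot v1 v1 = 1 -> dot v0 v1 = 0 -> Seta v0 = l0 *: v0 -> Seta v1 = l1 *: v1 ->
  0 < l1 -> l1 <= l0 ->
  (forall n, (n0 <= n)%N -> proj dot b n v0 = v0 /\ proj dot b n v1 = v1) ->
  (forall n (w : 'I_n -> H), (forall x, \sum_j dot x (w j) ^+ 2 <= `|x| ^+ 2) ->
     (forall j, `|w j| <= 1) ->
     \sum_j `|dot (Sxi (w j)) (w j) - dot (Seta (w j)) (w j)| <= s) ->
  forall x, (P [set w | (x <= `|xi w| ^+ 2)%R] <= P [set w | (x <= `|eta w| ^+ 2)%R]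
    + (annulus_const R / Num.sqrt (l0 * l1) * s)%:E)%E.
Proof.
move=> v00 v11 v01 Sv0 Sv1 l1p l10 pv hs x.
have l0p : 0 < l0 by exact: lt_le_trans l10.
pose K := annulus_const R / Num.sqrt (l0 * l1).
have K0 : 0 < K by rewrite divr_gt0 ?annulus_const_gt0// sqrtr_gt0 mulr_gt0.
have mnorm z : gaussian_element dot P z -> measurable_fun setT (fun w => `|z w| ^+ 2).
  by move=> gz; exact: (measurable_sqr_norm gz).
have sq1 := covariance_symform cxi; have sq2 := covariance_symform ceta.
suff key (e : R) : 0 < e -> (P [set w | (x <= `|xi w| ^+ 2)%R]
    <= P [set w | (x <= `|eta w| ^+ 2)%R] + (K * (e + e + s))%:E)%E.
  apply/lee_addgt0Pr => e e0.
  have e'0 : 0 < e / (2 * K) by rewrite divr_gt0// mulr_gt0.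
  apply: (le_trans (key _ e'0)); rewrite -addeA -EFinD leeD2l// lee_fin.
  by rewrite /K -/K mulrDr addrC lerD2l le_eqVlt; apply/orP; left; apply/eqP; field; rewrite gt_eqF.
move=> e0; apply: (@le_trans _ _ (P [set w | (x - e < `|xi w| ^+ 2)%R])).
  apply: le_measure; rewrite ?inE.
  - exact: measurable_ge (mnorm _ gxi).
  - exact: measurable_gt (mnorm _ gxi).
  - by move=> w /=; apply: lt_le_trans; rewrite ltrBlDr ltrDl.
apply: (norm_tail_le hilbertH gxi ob pb (n0 := maxn n0 2)) => n.
rewrite geq_max => /andP[nn0]; case: n nn0 => [|[|m]]// nn0 _.
set n := m.+2 in nn0 *.
pose Q1 := gram b n (fun x y => dot (Sxi x) y); pose Q2 := gram b n (fun x y => dot (Seta x) y).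
have sQ1 : Q1^T = Q1 by exact: gram_sym.
have sQ2 : Q2^T = Q2 by exact: gram_sym.
have [w1 ew1] := eigenframe_exists Q1 (leqnn n).
have [w2 ew2] := eigenframe_exists Q2 (leqnn n).
have [Q0 [w [sQ0 fw Q10 Q20 trQ]]] := exists_majorant sQ1 sQ2.
have [w0 ew0] := eigenframe_exists Q0 (leqnn n).
have [xiu _] := eigenframe_tails hilbertH gxi mxi cxi ew1 (x - e).
have [_ etal] := eigenframe_tails hilbertH geta meta ceta ew2 x.
apply: (le_trans xiu).
(* The eigenvectors of [Seta] lie in the section, hence bound its two largest
   eigenvalues from below. *)
pose v i := if i == 0%N then v0 else v1; pose l i := if i == 0%N then l0 else l1.
have vv j k : (j <= 1)%N -> (k <= 1)%N -> dot (v j) (v k) = (j == k)%:R.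
  by case: j => [|[|//]]; case: k => [|[|//]] _ _ //=; rewrite dotC.
have lb i : (i <= 1)%N -> l i <= mxform Q2 (w2 i) (w2 i).
  move=> i1; apply: (eigenvalue_le_frame sq2 ew2 (u := v)).
  - exact: leq_trans i1 _.
  - by move=> j k ji ki; apply: vv; [exact: leq_trans i1|exact: leq_trans i1].
  - by move=> j _; rewrite /v; case: ifP => _; have [] := pv _ nn0.
  - by move=> j y _; rewrite /v /l; case: ifP => _; rewrite ?Sv0 ?Sv1 dotZl.
  - by move=> j ji; rewrite /l; move: ji i1; case: i => [|[|//]]; case: j => [|[|//]].
have hsum : \sum_(j < n) (mxform Q0 (w0 j) (w0 j) - mxform Q2 (w2 j) (w2 j)) <= s.
  rewrite sumrB !frame_trace; [|by case: ew2|by case: ew0].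
  apply: (le_trans trQ).
  apply: le_trans (hs n (fun j => comb b (w j)) _ _).
  - apply: ler_sum => j _; rewrite mxformDQ mxformNQ.
    by rewrite (mxform_gram b _ _ sq1) (mxform_gram b _ _ sq2).
  - by move=> y; exact: (comb_bessel hilbertH ob).
  - by move=> j; exact: (norm_comb_le hilbertH ob).
(* Comparing the levels [x - e] and [x + e] leaves a margin [e] on either side of [x]. *)
rewrite (_ : x - e = (x + e) - (e + e)); last by ring.
have a10 j : (j < n)%N -> mxform Q1 (w1 j) (w1 j) <= mxform Q0 (w0 j) (w0 j).
  by move=> jn; exact: (eigenframe_mono sQ1 ew1 ew0).
have a20 j : (j < n)%N -> mxform Q2 (w2 j) (w2 j) <= mxform Q0 (w0 j) (w0 j).
  by move=> jn; exact: (eigenframe_mono sQ2 ew2 ew0).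
have D0 : 0 <= e + e by rewrite addr_ge0// ltW.
apply: (le_trans (@weights_compare R m _ _ _ l0 l1 (x + e) (e + e) s
  l0p l1p (lb 0%N isT) (lb 1%N isT) D0 a10 a20 hsum)).
rewrite leeD2r//; apply: (le_trans _ (le_trans etal _)).
  apply: le_measure; rewrite ?inE//.
  by move=> y /=; rewrite !in_itv/= !andbT; apply: lt_le_trans; rewrite ltrDl.
apply: le_measure; rewrite ?inE.
- exact: measurable_ge (measurable_sum_sqr hilbertH geta _ _).
- exact: measurable_ge (mnorm _ geta).
- by move=> om /= h; exact: le_trans h (bessel hilbertH ob _ _).
Qed.

Theorem lemma5p1 (R : realType) :
  exists2 C : R, 0 < C &
  forall (H : completeNormedModType R) (dot : {dot H for idfun})
    (hilbertH : hilbert_norm dot) (separableH : separable H)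
    (d : measure_display) (T : measurableType d) (P : probability T R)
    (xi eta : T -> H)
    (gauss_xi : gaussian_element dot P xi)
    (gauss_eta : gaussian_element dot P eta)
    (mean_xi : is_mean dot P xi 0) (mean_eta : is_mean dot P eta 0)
    (Sxi Seta : {linear H -> H})
    (cov_xi : is_covariance_operator dot P xi Sxi)
    (cov_eta : is_covariance_operator dot P eta Seta)
    (lxi leta : nat -> R)
    (eig_xi : eigenvalue_seq Sxi lxi) (eig_eta : eigenvalue_seq Seta leta),
  (ereal_sup [set `| fine (P [set w | x <= `|xi w| ^+ 2])
                     - fine (P [set w | x <= `|eta w| ^+ 2]) |%:E
             | x in [set x : R | (0 <= x)%R]]
   <= if ((0 < lxi 1%N) && (0 < leta 1%N))%R then
        C%:E * ((Num.sqrt (leta 0%N * leta 1%N))^-1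
                + (Num.sqrt (lxi 0%N * lxi 1%N))^-1)%:E
        * schatten1_norm (fun h => Sxi h - Seta h)%R
      else +oo)%E.
Proof.
exists (annulus_const R); first exact: annulus_const_gt0.
move=> H dot hilbertH sepH d T P xi eta gxi geta mxi meta Sxi Seta cxi ceta lxi leta exi eeta.
case: ifPn => [/andP[lx le]|_]; last by rewrite leey.
have lx0 : 0 < lxi 0%N by case: exi => _ /(_ 0%N) h _; exact: lt_le_trans h.
have le0 : 0 < leta 0%N by case: eeta => _ /(_ 0%N) h _; exact: lt_le_trans h.
have ax : 0 < (Num.sqrt (lxi 0%N * lxi 1%N))^-1 by rewrite invr_gt0 sqrtr_gt0 mulr_gt0.
have ae : 0 < (Num.sqrt (leta 0%N * leta 1%N))^-1 by rewrite invr_gt0 sqrtr_gt0 mulr_gt0.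
have C0 := annulus_const_gt0 R.
pose Dl h := Sxi h - Seta h.
have famD f m K := @eigenfamily_le_schatten R H dot hilbertH Dl f m K.
have sch0 : (0 <= schatten1_norm Dl)%E.
  have := famD (fun=> 0) (fun=> 0) 0%N; rewrite big_ord0; apply.
  by split => [i j|i]; rewrite ltn0.
(* An infinite trace norm makes the bound trivial, the other factors being positive. *)
have [schoo|schfin] := eqVneq (schatten1_norm Dl) +oo%E.
  by rewrite -/Dl schoo -EFinM gt0_muley ?leey// lte_fin mulr_gt0// addr_gt0.
have sfin : schatten1_norm Dl \is a fin_num by rewrite ge0_fin_numE// ltey.
pose s := fine (schatten1_norm Dl).
have [u0 [u1 [u00 u11 u01 Su0 Su1]]] := two_eigenvectors hilbertH (covariance_sym cxi) exi lx.
have [v0 [v1 [v00 v11 v01 Sv0 Sv1]]] := two_eigenvectors hilbertH (covariance_sym ceta) eeta le.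
(* The four leading eigenvectors come first, so that every projection of rank at
   least 4 fixes them. *)
have [b [ob pb fb]] := exists_basis hilbertH [:: u0; u1; v0; v1] sepH.
have cq1 := covariance_cptform hilbertH gxi mxi cxi ob pb.
have cq2 := covariance_cptform hilbertH geta meta ceta ob pb.
have sq1 := covariance_symform cxi; have sq2 := covariance_symform ceta.
pose B x y := dot (Dl x) y.
have BE x y : B x y = dot (Sxi x) y - dot (Seta x) y by rewrite /B /Dl dotBl.
have sB : symform B.
  split=> [x y|a x y z]; rewrite !BE; first by rewrite sq1.1 sq2.1.
  by rewrite sq1.2 sq2.2; ring.
have cB : cptform dot b B.
  have [[M1 h1] H1] := cq1; have [[M2 h2] H2] := cq2; split.
    exists (M1 + M2) => x y; rewrite BE mulrDl.
    by apply: (le_trans (ler_normB _ _)); rewrite lerD.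
  move=> e e0; have [N1 g1] := H1 _ (divr_gt0 e0 (ltr0Sn _ 1)).
  have [N2 g2] := H2 _ (divr_gt0 e0 (ltr0Sn _ 1)).
  exists (maxn N1 N2) => x y yb; rewrite BE (splitr e) mulrDl.
  apply: (le_trans (ler_normB _ _)); apply: lerD.
    by apply: g1 => i iN; apply: yb; rewrite (leq_trans iN)// leq_maxl.
  by apply: g2 => i iN; apply: yb; rewrite (leq_trans iN)// leq_maxr.
have hs n (w : 'I_n -> H) : (forall x, \sum_j dot x (w j) ^+ 2 <= `|x| ^+ 2) ->
    (forall j, `|w j| <= 1) ->
    \sum_j `|dot (Sxi (w j)) (w j) - dot (Seta (w j)) (w j)| <= s.
  move=> wb w1; under eq_bigr do rewrite -BE.
  apply: (sum_form_le hilbertH ob pb sB cB) => // f m K fam _.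
  by rewrite -lee_fin /s fineK//; exact: famD fam.
have s0 : 0 <= s by exact: fine_ge0.
apply: ge_ereal_sup => _ [x _ <-].
rewrite -/Dl -(fineK sfin) -/s -!EFinM lee_fin.
have pE z : gaussian_element dot P z -> (P [set w | (x <= `|z w| ^+ 2)%R]
    = (fine (P [set w | (x <= `|z w| ^+ 2)%R]))%:E)%E.
  move=> gz; rewrite fineK//; apply: fin_num_measure; exact: measurable_ge (measurable_sqr_norm gz).
have up : (P [set w | (x <= `|xi w| ^+ 2)%R] <= P [set w | (x <= `|eta w| ^+ 2)%R]
    + (annulus_const R / Num.sqrt (leta 0%N * leta 1%N) * s)%:E)%E.
  apply: (norm_tail_compare hilbertH gxi geta mxi meta cxi ceta ob pb (v0 := v0) (v1 := v1) (n0 := 4)) => //.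
    by case: eeta.
  by move=> n n4; split; apply: fb => //; rewrite !inE eqxx ?orbT.
have dn : (P [set w | (x <= `|eta w| ^+ 2)%R] <= P [set w | (x <= `|xi w| ^+ 2)%R]
    + (annulus_const R / Num.sqrt (lxi 0%N * lxi 1%N) * s)%:E)%E.
  apply: (norm_tail_compare hilbertH geta gxi meta mxi ceta cxi ob pb (v0 := u0) (v1 := u1) (n0 := 4)) => //.
  - by case: exi.
  - by move=> n n4; split; apply: fb => //; rewrite !inE eqxx ?orbT.
  - by move=> n w wb w1; under eq_bigr do rewrite distrC; exact: hs.
move: up dn; rewrite (pE _ gxi) (pE _ geta) -!EFinD !lee_fin.
set p1 := fine _; set p2 := fine _ => up dn.
have A0 : 0 <= annulus_const R / Num.sqrt (leta 0%N * leta 1%N) * s.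
  by rewrite mulr_ge0// mulr_ge0// ltW.
have B0 : 0 <= annulus_const R / Num.sqrt (lxi 0%N * lxi 1%N) * s.
  by rewrite mulr_ge0// mulr_ge0// ltW.
rewrite mulrDr mulrDl; suff key (q1 q2 c1 c2 : R) :
  q1 <= q2 + c1 -> q2 <= q1 + c2 -> 0 <= c1 -> 0 <= c2 -> `|q1 - q2| <= c1 + c2 by exact: key.
by move=> ? ? ? ?; rewrite ler_norml; apply/andP; split; lra.
Qed.
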